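(* Let $k$ be a finite field and let $V$ be a finite-dimensional $k$-vector space. Let $\Omega(V)$ be the complement of all $k$-rational hyperplanes in the projective space $\mathbf{P}(V)$. (i) The restriction map $$\mathrm{PGL}(V)=\mathrm{Aut}_k\bigl(\mathbf{P}(V)\bigr)\longrightarrow \mathrm{Aut}_k\bigl(\Omega(V)\bigr),\qquad \varphi\mapsto \varphi_{|\Omega(V)},$$ is an isomorphism. Equivalently, every $k$-automorphism of $\Omega(V)$ extends to a $k$-automorphism of $\mathbf{P}(V)$. (ii) For every field extension $K/k$ the natural map $$\mathrm{PGL}(V)\longrightarrow \mathrm{Aut}_K\bigl(\Omega(V)_K\bigr)$$ (restrict a $k$-automorphism of $\mathbf{P}(V)$ to $\Omega(V)$ and base change to $K$) is an isomorphism. Equivalently, every $K$-automorphism of $\Omega(V)_K$ comes by base change from a $k$-automorphism of $\mathbf{P}(V)$.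
   Context: $\mathbf{P}(V)=\mathrm{Proj}(\mathrm{Sym}^\bullet V)$. For a linear subspace $W\subset V$, the surjection $\mathrm{Sym}^\bullet V\to \mathrm{Sym}^\bullet (V/W)$ gives a closed immersion $\mathbf{P}(V/W)\hookrightarrow \mathbf{P}(V)$. The $k$-scheme $\Omega(V)$ is the open subscheme $$\Omega(V)=\mathbf{P}(V)-\bigcup_{W\subset V,\ \dim W=1}\mathbf{P}(V/W).$$ For a field extension $K/k$, $\Omega(V)_K=\Omega(V)\otimes_k K$ is the base change; it is the complement of all $k$-rational hyperplanes in $\mathbf{P}(V\otimes_k K)=\mathbf{P}(V)\otimes_k K$. Automorphism groups are groups of scheme automorphisms over the indicated base field, and $\mathrm{PGL}(V)$ denotes the group $\mathrm{GL}(V)/k^\times$, identified with $\mathrm{Aut}_k(\mathbf{P}(V))$. *)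

(* Defs.v *)
From HB Require Import structures.
From mathcomp Require Import all_boot all_order all_algebra fraction.
From mathcomp Require Import boolp classical_sets functions.
From mathcomp Require Import topology_structure initial_topology subtype_topology.
From mathcomp Require Import mpoly.

Set Implicit Arguments.
Unset Strict Implicit.
Unset Printing Implicit Defensive.

Import GRing.Theory.

Local Open Scope classical_set_scope.
Local Open Scope ring_scope.

(** * Locally ringed spaces *)

Definition opens (X : topologicalType) := {U : set X | open U}.

Record presheafedSpace := PresheafedSpace {
  space_pt :> topologicalType;
  sec : opens space_pt -> comPzRingType;
  res : forall U V : opens space_pt, sval V `<=` sval U ->
    {rmorphism sec U -> sec V};
  res_id : forall (U : opens space_pt) (h : sval U `<=` sval U) (s : sec U),
    res h s = s;
  res_res : forall (U V W : opens space_pt) (hUV : sval V `<=` sval U)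
    (hVW : sval W `<=` sval V) (hUW : sval W `<=` sval U) (s : sec U),
    res hVW (res hUV s) = res hUW s }.

Arguments res {p U V}.

Lemma resE (X : presheafedSpace) (U V W : opens X) (hUV : sval V `<=` sval U)
  (hVW : sval W `<=` sval V) (s : sec U) :
  res hVW (res hUV s) = res (subset_trans hVW hUV) s.
Proof. exact: res_res. Qed.

Lemma res_irr (X : presheafedSpace) (U V : opens X) (h h' : sval V `<=` sval U)
  (s : sec U) : res h s = res h' s.
Proof. by rewrite (Prop_irrelevance h h'). Qed.

Definition is_sheaf (X : presheafedSpace) : Prop :=
  forall (U : opens X) (I : Type) (F : I -> opens X)
    (hF : forall i, sval (F i) `<=` sval U),
    sval U `<=` \bigcup_i sval (F i) ->
  forall s : forall i, sec (F i),
    (forall i j (W : opens X) (hi : sval W `<=` sval (F i))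
       (hj : sval W `<=` sval (F j)), res hi (s i) = res hj (s j)) ->
  exists! t : sec U, forall i, res (hF i) t = s i.

(* The germ of [s] at [x] is a unit of the stalk at [x]. *)
Definition germ_unit (X : presheafedSpace) (x : X) (U : opens X) (s : sec U) :=
  exists (W : opens X) (h : sval W `<=` sval U),
    sval W x /\ exists t : sec W, res h s * t = 1.

(* A ring is local iff it is nonzero and, for every [a], one of [a] and
   [1 - a] is a unit; this is that condition for each stalk, on germs. *)
Definition has_local_stalks (X : presheafedSpace) : Prop :=
  forall x : X,
    (forall U : opens X, sval U x -> (1 : sec U) <> 0) /\
    (forall (U : opens X) (s : sec U), sval U x ->
       germ_unit x s \/ germ_unit x (1 - s)).

Record lrSpace := LRSpace {
  lr_presheafed :> presheafedSpace;
  lr_sheaf : is_sheaf lr_presheafed;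
  lr_local : has_local_stalks lr_presheafed }.

Definition preim_open (X Y : topologicalType) (f : X -> Y)
  (fP : forall U : set Y, open U -> open (f @^-1` U)) (U : opens Y) : opens X :=
  exist _ (f @^-1` sval U) (fP _ (proj2_sig U)).

Record lrMor (X Y : lrSpace) := LRMor {
  lr_fun :> X -> Y;
  lr_open : forall U : set Y, open U -> open (lr_fun @^-1` U);
  pull : forall U : opens Y, {rmorphism sec U -> sec (preim_open lr_open U)};
  pull_res : forall (U V : opens Y) (h : sval V `<=` sval U)
    (h' : sval (preim_open lr_open V) `<=` sval (preim_open lr_open U))
    (s : sec U), res h' (pull U s) = pull V (res h s);
  (* the maps induced on stalks are local homomorphisms *)
  pull_local : forall (x : X) (U : opens Y) (s : sec U), sval U (lr_fun x) ->
    germ_unit x (pull U s) -> germ_unit (lr_fun x) s }.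

Lemma rmor_ext (R S : comPzRingType) (f g : {rmorphism R -> S}) :
  f =1 g -> f = g.
Proof.
case: f => f [[f1] [f2]]; case: g => g [[g1] [g2]] /= /funext e.
by case: _ / e in g1 g2 *; rewrite (Prop_irrelevance g1 f1) (Prop_irrelevance g2 f2).
Qed.

Lemma lrMor_ext (X Y : lrSpace) (f g : lrMor X Y) : (forall x, f x = g x) ->
  (forall (U : opens Y) (s : sec U) (W : opens X)
     (hf : sval W `<=` f @^-1` sval U) (hg : sval W `<=` g @^-1` sval U),
     @res _ (preim_open (lr_open f) U) W hf (pull f U s) =
     @res _ (preim_open (lr_open g) U) W hg (pull g U s)) ->
  f = g.
Proof.
case: f => f fo fp fr fl; case: g => g go gp gr gl /= /funext e.
case: _ / e in go gp gr gl *.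
rewrite -(Prop_irrelevance fo go) in gp gr gl * => h.
have e : fp = gp.
  apply: functional_extensionality_dep => U; apply: rmor_ext => s.
  have := h U s (preim_open fo U) (@subset_refl _ _) (@subset_refl _ _).
  by rewrite !res_id.
case: _ / e in gr gl *.
by rewrite (Prop_irrelevance gr fr) (Prop_irrelevance gl fl).
Qed.

Lemma germ_unit_res (X : presheafedSpace) (x : X) (U V : opens X)
  (h : sval V `<=` sval U) (s : sec U) : sval V x ->
  germ_unit x (res h s) <-> germ_unit x s.
Proof.
move=> Vx; split=> -[W [hW [Wx [t st]]]].
  exists W, (subset_trans hW h); split=> //; exists t; rewrite -st.
  by rewrite resE.
have oWV : open (sval W `&` sval V).
  by apply: openI; [exact: svalP W|exact: svalP V].
pose WV : opens X := exist _ _ oWV.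
have h1 : sval WV `<=` sval W by move=> y [].
have h2 : sval WV `<=` sval V by move=> y [].
exists WV, h2; split=> //; exists (res h1 t).
have h3 : sval WV `<=` sval U by move=> y [/hW].
by rewrite (res_res h h2 h3) -(res_res hW h1 h3) -rmorphM st rmorph1.
Qed.

Section Id.
Variable X : lrSpace.

Definition lr_id_open (U : set X) (oU : open U) : open (id @^-1` U) := oU.

Definition lr_id_pull (U : opens X) : {rmorphism sec U -> sec (preim_open lr_id_open U)} :=
  @res X U (preim_open lr_id_open U) (@subset_refl _ _).

Lemma lr_id_pull_res (U V : opens X) (h : sval V `<=` sval U)
  (h' : sval (preim_open lr_id_open V) `<=` sval (preim_open lr_id_open U))
  (s : sec U) : res h' (lr_id_pull U s) = lr_id_pull V (res h s).
Proof. by rewrite /lr_id_pull !resE; exact: res_irr. Qed.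

Lemma lr_id_pull_local (x : X) (U : opens X) (s : sec U) :
  sval U x -> germ_unit x (lr_id_pull U s) -> germ_unit x s.
Proof. by move=> Ux; rewrite /lr_id_pull germ_unit_res. Qed.

Definition lr_id : lrMor X X := LRMor lr_id_pull_res lr_id_pull_local.
End Id.

Section Comp.
Variables (X Y Z : lrSpace) (f : lrMor Y Z) (g : lrMor X Y).

Definition lr_comp_open (U : set Z) (oU : open U) : open ((f \o g) @^-1` U) :=
  lr_open g (lr_open f oU).

Definition lr_comp_pull (U : opens Z) : {rmorphism sec U -> sec (preim_open lr_comp_open U)} :=
  [the {rmorphism sec U -> sec (preim_open (lr_open g) (preim_open (lr_open f) U))}
    of pull g (preim_open (lr_open f) U) \o pull f U].

Lemma lr_comp_pull_res (U V : opens Z) (h : sval V `<=` sval U)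
  (h' : sval (preim_open lr_comp_open V) `<=` sval (preim_open lr_comp_open U))
  (s : sec U) : res h' (lr_comp_pull U s) = lr_comp_pull V (res h s).
Proof.
rewrite /lr_comp_pull /=.
have h2 : sval (preim_open (lr_open f) V) `<=` sval (preim_open (lr_open f) U).
  by move=> y /h.
by rewrite -(pull_res h h2) -(pull_res h2 h').
Qed.

Lemma lr_comp_pull_local (x : X) (U : opens Z) (s : sec U) :
  sval U ((f \o g) x) -> germ_unit x (lr_comp_pull U s) -> germ_unit (f (g x)) s.
Proof.
move=> Ux u; apply: (pull_local Ux).
exact: (@pull_local _ _ g x (preim_open (lr_open f) U)).
Qed.

Definition lr_comp : lrMor X Z := LRMor lr_comp_pull_res lr_comp_pull_local.
End Comp.

Lemma lr_compA (X Y Z T : lrSpace) (f : lrMor Z T) (g : lrMor Y Z)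
  (h : lrMor X Y) : lr_comp f (lr_comp g h) = lr_comp (lr_comp f g) h.
Proof.
by apply: lrMor_ext => // U s W hf hg; exact: res_irr.
Qed.

Lemma lr_comp1l (X Y : lrSpace) (f : lrMor X Y) : lr_comp (lr_id Y) f = f.
Proof.
apply: lrMor_ext => // U s W hf hg /=.
set V := (X in pull f X).
have h' : sval (preim_open (lr_open f) V) `<=` sval (preim_open (lr_open f) U) by [].
by rewrite -(pull_res _ h') resE; exact: res_irr.
Qed.

Lemma lr_comp1r (X Y : lrSpace) (f : lrMor X Y) : lr_comp f (lr_id X) = f.
Proof. by apply: lrMor_ext => // U s W hf hg /=; rewrite resE; exact: res_irr. Qed.

(** * Spaces over a ring and their automorphisms *)

(* A morphism from a locally ringed space to [Spec k] is the same datum as a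
   structure of sheaf of [k]-algebras on its structure sheaf. *)
Record kSpace (k : comPzRingType) := KSpace {
  k_space :> lrSpace;
  kstr : forall U : opens k_space, {rmorphism k -> sec U};
  kstr_res : forall (U V : opens k_space) (h : sval V `<=` sval U) (c : k),
    res h (kstr U c) = kstr V c }.

Arguments kstr {k _}.

Definition is_kMor (k : comPzRingType) (X Y : kSpace k) (f : lrMor X Y) : Prop :=
  forall (U : opens Y) (c : k), pull f U (kstr U c) = kstr (preim_open (lr_open f) U) c.

(* A two-sided inverse of a [k]-morphism is automatically a [k]-morphism. *)
Definition is_kAut (k : comPzRingType) (X : kSpace k) (f : lrMor X X) : Prop :=
  is_kMor f /\ exists g : lrMor X X, lr_comp f g = lr_id X /\ lr_comp g f = lr_id X.

Definition kAut (k : comPzRingType) (X : kSpace k) := {f : lrMor X X | is_kAut f}.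

Lemma is_kAut_comp (k : comPzRingType) (X : kSpace k) (f g : kAut X) :
  is_kAut (lr_comp (sval f) (sval g)).
Proof.
case: f g => f [kf [f' [ff' f'f]]] [g [kg [g' [gg' g'g]]]] /=; split.
  by move=> U c /=; rewrite kf kg.
exists (lr_comp g' f'); split.
  by rewrite lr_compA -(lr_compA f) gg' lr_comp1r.
by rewrite lr_compA -(lr_compA g') f'f lr_comp1r.
Qed.

Definition kAut_comp (k : comPzRingType) (X : kSpace k) (f g : kAut X) : kAut X :=
  exist _ _ (is_kAut_comp f g).

Definition kAut_iso (k1 k2 : comPzRingType) (X : kSpace k1) (Y : kSpace k2)
  (r : kAut X -> kAut Y) : Prop :=
  (forall f g, r (kAut_comp f g) = kAut_comp (r f) (r g)) /\ bijective r.

(** * Open subspaces *)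

Section OpenSub.
Variables (X : lrSpace) (U : opens X).

Local Notation pt := (set_type (sval U) : topologicalType).

Lemma img_open (W : opens pt) : open (set_val @` sval W : set X).
Proof.
case: W => W [A oA AW] /=.
suff -> : set_val @` W = A `&` sval U by apply: openI => //; exact: (proj2_sig U).
rewrite -AW; apply/seteqP; split => x.
  by case=> -[y yU] /= Ay <-; split=> //; exact: set_mem yU.
by case=> Ax Ux; exists (exist _ x (mem_set Ux)).
Qed.

Definition img (W : opens pt) : opens X := exist _ _ (img_open W).

Lemma img_sub (V W : opens pt) (h : sval V `<=` sval W) :
  sval (img V) `<=` sval (img W).
Proof. exact: image_subset. Qed.

Definition osub_presheafed : presheafedSpace.
Proof.
apply: (@PresheafedSpace pt (fun W => sec (img W))
         (fun V W h => res (img_sub h))).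
- by move=> V h s; exact: res_id.
- by move=> V W T h1 h2 h3 s; exact: res_res.
Defined.

Lemma osub_sheaf : is_sheaf osub_presheafed.
Proof.
move=> V I F hF hcov s hs.
apply: (@lr_sheaf X (img V) I (fun i => img (F i)) (fun i => img_sub (hF i))).
  by move=> x [y /hcov [i _ Fiy] <-]; exists i => //; exists y.
move=> i j W hi hj.
have oW : open (set_val @^-1` (sval W) : set pt).
  by exists (sval W) => //; exact: (proj2_sig W).
have hW : sval W `<=` sval (img (exist _ _ oW)).
  by move=> x Wx; have [y _ yx] := hi x Wx; exists y => //=; rewrite yx.
have h1 : sval (exist _ _ oW : opens pt) `<=` sval (F i).
  move=> y /= /hi [z Fz zy]; rewrite -(val_inj zy); exact: Fz.
have h2 : sval (exist _ _ oW : opens pt) `<=` sval (F j).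
  move=> y /= /hj [z Fz zy]; rewrite -(val_inj zy); exact: Fz.
have := congr1 (res hW) (hs i j (exist _ _ oW) h1 h2).
by rewrite /= !resE => e; rewrite (res_irr hi (subset_trans hW (img_sub h1))) e; exact: res_irr.
Qed.

Lemma osub_germ (x : pt) (W : opens pt) (s : sec (img W)) : sval W x ->
  germ_unit (set_val x : X) s -> @germ_unit osub_presheafed x W s.
Proof.
move=> Wx [V [h [Vx [t st]]]].
have oV : open (set_val @^-1` (sval V) : set pt).
  by exists (sval V) => //; exact: (proj2_sig V).
have h1 : sval (exist _ _ oV : opens pt) `<=` sval W.
  move=> y /= /h [z Wz zy]; rewrite -(val_inj zy); exact: Wz.
exists (exist _ _ oV), h1; split => //.
have h2 : sval (img (exist _ _ oV)) `<=` sval V by move=> _ [y /= Vy <-].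
exists (res h2 t) => /=.
by rewrite (res_irr _ (subset_trans h2 h)) -resE -rmorphM st rmorph1.
Qed.

Lemma osub_local : has_local_stalks osub_presheafed.
Proof.
move=> x; have [n0 un] := @lr_local X (set_val x); split.
  by move=> W Wx; apply: n0; exists x.
move=> W s Wx; case: (un (img W) s); first by exists x.
  by left; exact: osub_germ.
by right; exact: osub_germ.
Qed.

(* The open set [U] with the restriction of the structure sheaf. *)
Definition osub : lrSpace := LRSpace osub_sheaf osub_local.

Definition osub_incl_fun (x : osub) : X := set_val x.

Lemma osub_incl_open (V : set X) (oV : open V) : open (osub_incl_fun @^-1` V).
Proof. by exists V. Qed.

Lemma osub_incl_sub (V : opens X) : sval (img (preim_open osub_incl_open V)) `<=` sval V.
Proof. by move=> _ [x Vx <-]. Qed.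

Definition osub_incl : lrMor osub X.
Proof.
apply: (@LRMor osub X osub_incl_fun osub_incl_open
   (fun V => @res X V (img (preim_open osub_incl_open V)) (@osub_incl_sub V))).
- by move=> V W h h' s /=; rewrite !resE; exact: res_irr.
- move=> x V s Vx [W [h [Wx [t st]]]].
  exists (img W), (subset_trans (img_sub h) (@osub_incl_sub V)); split; first by exists x.
  by exists t; rewrite -resE.
Defined.

End OpenSub.

Definition osub_k (k : comPzRingType) (X : kSpace k) (U : opens X) : kSpace k.
Proof.
apply: (@KSpace k (osub U) (fun W => kstr (img W))).
by move=> V W h c; exact: kstr_res.
Defined.

(* The restriction of [f] to open sets [U] and [V] with [f(U)] inside [V]. *)
Section Restrict.
Variables (X Y : lrSpace) (f : lrMor X Y) (U : opens X) (V : opens Y).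
Hypothesis fUV : sval U `<=` f @^-1` sval V.

Definition restrict_fun (x : osub U) : osub V := exist _ (f (set_val x)) (mem_set (fUV (set_valP x))).

Lemma restrict_open (W : set (osub V)) (oW : open W) : open (restrict_fun @^-1` W).
Proof.
case: oW => A oA <-; exists (f @^-1` A); first exact: lr_open.
by [].
Qed.

Lemma restrict_sub (W : opens (osub V)) :
  sval (img (preim_open restrict_open W)) `<=` sval (preim_open (lr_open f) (img W)).
Proof. by move=> _ [x Wx <-]; exists (restrict_fun x). Qed.

Definition lr_restrict : lrMor (osub U) (osub V).
Proof.
apply: (@LRMor (osub U) (osub V) restrict_fun restrict_open (fun W =>
  [the {rmorphism sec (img W) -> sec (img (preim_open restrict_open W))}
    of res (@restrict_sub W) \o pull f (img W)])).
- move=> W T h h' s /=.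
  have hh : sval (preim_open (lr_open f) (img T)) `<=` sval (preim_open (lr_open f) (img W)).
    by move=> x /= [y Ty yx]; exists y => //; exact: h.
  by rewrite -(pull_res _ hh) !resE; exact: res_irr.
- move=> x W s Wx [T [h [Tx [t st]]]].
  apply: osub_germ => //; apply: (@pull_local _ _ f (set_val x) (img W) s); first by exists (restrict_fun x).
  exists (img T), (subset_trans (img_sub h) (@restrict_sub W)); split; first by exists x.
  by exists t; rewrite -st /= resE; congr (_ * _); exact: res_irr.
Defined.

End Restrict.

(** * Proj of a polynomial ring *)

Lemma subf_div (F : fieldType) (x z y w : F) : y != 0 -> w != 0 ->
  x / y - z / w = (x * w - z * y) / (y * w).
Proof. by move=> y0 w0; rewrite -mulNr addf_div // mulNr. Qed.

Section Proj.
Variables (k : fieldType) (n : nat).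
Local Notation S := {mpoly k[n]}.

Record is_projPt (p : S -> Prop) : Prop := IsProjPt {
  projPt_0 : p 0;
  projPt_D : forall f g, p f -> p g -> p (f + g);
  projPt_M : forall f g, p g -> p (f * g);
  projPt_1 : ~ p 1;
  projPt_prime : forall f g, p (f * g) -> p f \/ p g;
  projPt_homog : forall d f, p f -> p (pihomog mdeg d f);
  projPt_irrelevant : exists d f, [/\ (0 < d)%N, f \is d.-homog & ~ p f] }.

Record projPt := ProjPt {
  pt_ideal :> S -> Prop;
  pt_ideal_proj : is_projPt pt_ideal }.

HB.instance Definition _ := gen_eqMixin projPt.
HB.instance Definition _ := gen_choiceMixin projPt.

Definition homogeneous (f : S) : Prop := exists d, f \is d.-homog.

Definition zariski : set_system projPt :=
  [set U | exists2 E : set S, E `<=` homogeneous &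
             U = [set p : projPt | exists2 f, E f & ~ p f]].

Lemma zariskiP (U : set projPt) : zariski U <->
  forall p, U p -> exists f, [/\ homogeneous f, ~ p f &
    forall q : projPt, ~ q f -> U q].
Proof.
split=> [[E Eh ->] p [f Ef pf]|h].
  by exists f; split=> //; [exact: Eh|move=> q qf; exists f].
exists [set f | homogeneous f /\ forall q : projPt, ~ q f -> U q].
  by move=> f [].
apply/seteqP; split=> p; first by case/h=> f [fh pf fU]; exists f.
by case=> f [_ fU]; exact: fU.
Qed.

Lemma zariskiT : zariski setT.
Proof.
apply/zariskiP => p _; exists 1; split=> //; first by exists 0%N; exact: dhomog1.
exact: projPt_1 (pt_ideal_proj p).
Qed.

Lemma zariskiI : setI_closed zariski.
Proof.
move=> U V /zariskiP hU /zariskiP hV; apply/zariskiP => p [Up Vp].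
have [f [[d fh] pf fU]] := hU p Up; have [g [[e gh] pg gV]] := hV p Vp.
exists (f * g); split.
- by exists (d + e)%N; exact: dhomogM.
- by case/(projPt_prime (pt_ideal_proj p)).
- move=> q qfg; split; [apply: fU => qf|apply: gV => qg]; apply: qfg.
    by rewrite mulrC; exact: projPt_M (pt_ideal_proj q) _ _ qf.
  exact: projPt_M (pt_ideal_proj q) _ _ qg.
Qed.

Lemma zariski_bigU (I : Type) (F : I -> set projPt) :
  (forall i, zariski (F i)) -> zariski (\bigcup_i F i).
Proof.
move=> h; apply/zariskiP => p [i _ Fp].
have /zariskiP/(_ _ Fp) [f [fh pf fF]] := h i.
by exists f; split=> // q /fF Fq; exists i.
Qed.

HB.instance Definition _ :=
  isOpenTopological.Build projPt zariskiT zariskiI zariski_bigU.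

(* The homogeneous localization at [p] is the set of fractions [a / b] with
   [a], [b] homogeneous of the same degree and [b] not in [p]; as [S] is a
   domain, it is realized inside the field of fractions of [S]. A section is
   a family of elements of these rings, locally given by a single fraction. *)
Definition is_section (U : opens projPt) (s : sval U -> {fraction S}) : Prop :=
  forall x : sval U, exists2 W : set projPt, open W /\ W (val x) &
  exists (d : nat) (a b : S), [/\ a \is d.-homog, b \is d.-homog &
    forall y : sval U, W (val y) -> ~ val y b /\ s y = tofrac a / tofrac b].

Definition section_pred (U : opens projPt) : {pred sval U -> {fraction S}} :=
  fun s => `[< is_section s >].

Lemma frac_neq0 (p : projPt) (b : S) : ~ p b -> tofrac b != 0.
Proof.
move=> pb; rewrite tofrac_eq0; apply/eqP => b0; apply: pb; rewrite b0.
exact: projPt_0 (pt_ideal_proj p).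
Qed.

Lemma projPt_nM (p : projPt) (a b : S) : ~ p a -> ~ p b -> ~ p (a * b).
Proof. by move=> pa pb /(projPt_prime (pt_ideal_proj p)) []. Qed.

Lemma section_subring (U : opens projPt) : subring_closed (@section_pred U).
Proof.
split.
- apply/asboolP => x; exists setT; first by split=> //; exact: openT.
  exists 0%N, 1, 1; split; rewrite ?dhomog1 // => y _; split.
    exact: projPt_1 (pt_ideal_proj _).
  by rewrite tofrac1 divr1.
- move=> s t /asboolP hs /asboolP ht; apply/asboolP => x.
  have [W [oW Wx] [d [a [b [ha hb sab]]]]] := hs x.
  have [V [oV Vx] [e [c [f [hc hf tcf]]]]] := ht x.
  exists (W `&` V); first by split=> //; exact: openI.
  exists (d + e)%N, (a * f - c * b), (b * f); split.
  + by apply: rpredB; [|rewrite addnC]; exact: dhomogM.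
  + exact: dhomogM.
  + move=> y [/sab [yb sy] /tcf [yf ty]]; split; first exact: projPt_nM.
    have [b0 f0] := (frac_neq0 yb, frac_neq0 yf).
    transitivity (s y - t y) => //; rewrite sy ty.
    by rewrite (subf_div _ _ b0 f0) -!tofracM -tofracB.
- move=> s t /asboolP hs /asboolP ht; apply/asboolP => x.
  have [W [oW Wx] [d [a [b [ha hb sab]]]]] := hs x.
  have [V [oV Vx] [e [c [f [hc hf tcf]]]]] := ht x.
  exists (W `&` V); first by split=> //; exact: openI.
  exists (d + e)%N, (a * c), (b * f); split; try exact: dhomogM.
  move=> y [/sab [yb sy] /tcf [yf ty]]; split; first exact: projPt_nM.
  transitivity (s y * t y) => //; rewrite sy ty.
  by rewrite !tofracM mulf_div.
Qed.

HB.instance Definition _ (U : opens projPt) :=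
  GRing.isSubringClosed.Build (sval U -> {fraction S}) (@section_pred U)
    (section_subring U).

Record projSec (U : opens projPt) := ProjSec {
  projSec_fun :> sval U -> {fraction S};
  projSec_section : projSec_fun \in @section_pred U }.

HB.instance Definition _ (U : opens projPt) := [isSub for @projSec_fun U].
HB.instance Definition _ (U : opens projPt) := [Choice of projSec U by <:].
HB.instance Definition _ (U : opens projPt) :=
  GRing.SubChoice_isSubComPzRing.Build _ (@section_pred U) (projSec U)
    (section_subring U).


Definition widen_pt (T : Type) (U V : set T) (h : V `<=` U) (x : V) : U :=
  exist _ (val x) (mem_set (h _ (set_valP x))).

Lemma set_type_inj (T : Type) (U : set T) (x y : U) : val x = val y -> x = y.
Proof. exact: val_inj. Qed.

Section Restriction.
Variables (U V : opens projPt) (h : sval V `<=` sval U).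

Lemma proj_res_section (s : projSec U) :
  (fun y => s (widen_pt h y)) \in @section_pred V.
Proof.
apply/asboolP => x.
have /asboolP /(_ (widen_pt h x)) [W Wx [d [a [b [ha hb sab]]]]] :=
  projSec_section s.
by exists W => //; exists d, a, b; split=> // y Wy; exact: sab (widen_pt h y) Wy.
Qed.

Definition proj_res (s : projSec U) : projSec V := ProjSec (proj_res_section s).

Lemma proj_res_zmod : zmod_morphism proj_res.
Proof. by move=> s t; apply: val_inj. Qed.

Lemma proj_res_monoid : monoid_morphism proj_res.
Proof. by split; [|move=> s t]; apply: val_inj. Qed.

HB.instance Definition _ :=
  GRing.isZmodMorphism.Build (projSec U) (projSec V) proj_res proj_res_zmod.
HB.instance Definition _ :=
  GRing.isMonoidMorphism.Build (projSec U) (projSec V) proj_res proj_res_monoid.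

End Restriction.

Lemma projSec_ext (U : opens projPt) (s t : projSec U) :
  (forall x, s x = t x) -> s = t.
Proof. by move=> e; apply: val_inj; apply: funext. Qed.

Definition proj_presheafed : presheafedSpace.
Proof.
apply: (@PresheafedSpace projPt projSec (fun U V h => proj_res h)).
- by move=> U h s; apply: projSec_ext => x /=; congr (s _); exact: set_type_inj.
- by move=> U V W h1 h2 h3 s; apply: projSec_ext => x /=; congr (s _); exact: set_type_inj.
Defined.

Lemma proj_sheaf : is_sheaf proj_presheafed.
Proof.
move=> U I F hF hcov s hs.
have pick (x : sval U) : {i | sval (F i) (val x)}.
  by apply: cid; have [i _ Fx] := hcov _ (set_valP x); exists i.
have sE i j (x : sval (F i)) (y : sval (F j)) : val x = val y -> s i x = s j y.
  move=> xy.
  have oW : open (sval (F i) `&` sval (F j)).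
    by apply: openI; exact: proj2_sig.
  have h1 : sval (F i) `&` sval (F j) `<=` sval (F i) by move=> ? [].
  have h2 : sval (F i) `&` sval (F j) `<=` sval (F j) by move=> ? [].
  have Wx : (sval (F i) `&` sval (F j)) (val x).
    by split; [exact: set_valP|rewrite xy; exact: set_valP].
  pose O : opens projPt := exist _ _ oW.
  pose z : sval O := exist _ (val x) (mem_set Wx).
  have /(congr1 (fun t : projSec O => t z)) /= := hs i j O h1 h2.
  set a := widen_pt _ _; set b := widen_pt _ _ => e.
  rewrite (_ : x = a); last exact: set_type_inj.
  by rewrite (_ : y = b) //; exact: set_type_inj.
pose t (x : sval U) := s (sval (pick x)) (exist _ (val x) (mem_set (proj2_sig (pick x)))).
have tP : t \in @section_pred U.
  apply/asboolP => x; case ei : (pick x) => [i Fx].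
  have /asboolP /(_ (exist _ (val x) (mem_set Fx))) := projSec_section (s i).
  move=> [W [oW Wx] [d [a [b [ha hb sab]]]]].
  exists (W `&` sval (F i)); first by split=> //; apply: openI => //; exact: proj2_sig.
  exists d, a, b; split=> // y [Wy Fy].
  have [yb sy] := sab (exist _ (val y) (mem_set Fy)) Wy.
  by split=> //; rewrite -sy; exact: sE.
exists (ProjSec tP); split.
  by move=> i; apply: projSec_ext => x /=; exact: sE.
move=> t' ht'; apply: projSec_ext => x /=; rewrite /t -ht' /=.
by congr (t' _); exact: set_type_inj.
Qed.

Lemma proj_germ_unit (p : projPt) (U : opens projPt) (s : projSec U)
  (W : set projPt) (d : nat) (a b : S) : open W -> W p ->
  a \is d.-homog -> b \is d.-homog -> ~ p a ->
  (forall y : sval U, W (val y) -> ~ val y b /\ s y = tofrac a / tofrac b) ->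
  sval U p -> @germ_unit proj_presheafed p U s.
Proof.
move=> oW Wp ha hb pa sab Up.
have oA : open [set q : projPt | ~ q a].
  apply/zariskiP => q qa; exists a; split=> //; by exists d.
have oV : open (W `&` sval U `&` [set q : projPt | ~ q a]).
  by apply: openI => //; apply: openI => //; exact: proj2_sig.
have h : sval (exist _ _ oV : opens projPt) `<=` sval U by move=> q [[]].
exists (exist _ _ oV), h; split=> //.
have tP : (fun=> tofrac b / tofrac a) \in @section_pred (exist _ _ oV).
  apply/asboolP => x; exists setT; first by split=> //; exact: openT.
  by exists d, b, a; split=> // y _; have [_ ] := set_valP y.
exists (ProjSec tP); apply: projSec_ext => x.
have [[Wx Ux] xa] := set_valP x.
have [xb sx] := sab (widen_pt h x) Wx.
transitivity (s (widen_pt h x) * (tofrac b / tofrac a)) => //.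
rewrite sx mulf_div [_ * tofrac b]mulrC divff //.
by apply: mulf_neq0; [exact: frac_neq0 xb|exact: frac_neq0 xa].
Qed.

Lemma proj_local : has_local_stalks proj_presheafed.
Proof.
move=> p; split.
  move=> U Up /(congr1 (fun t : projSec U => t (exist _ p (mem_set Up)))).
  by move=> /eqP; apply/negP; exact: oner_neq0.
move=> U s Up.
have /asboolP /(_ (exist _ p (mem_set Up))) := projSec_section s.
move=> [W [oW Wp] [d [a [b [ha hb sab]]]]].
have [pa|npa] := pselect (p a); last by left; exact: (proj_germ_unit oW Wp ha hb).
right; apply: (@proj_germ_unit p U (1 - s) W d (b - a) b) => //.
- exact: rpredB.
- have [pb _] := sab (exist _ p (mem_set Up)) Wp.
  move=> pba; apply: pb; rewrite -(subrK a b).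
  exact: projPt_D (pt_ideal_proj p) _ _ pba pa.
- move=> y Wy; have [yb sy] := sab y Wy; split=> //.
  transitivity (1 - s y) => //; rewrite sy tofracB mulrBl divff //.
  exact: frac_neq0 yb.
Qed.

Definition proj_lr : lrSpace := LRSpace proj_sheaf proj_local.

Lemma proj_const_section (U : opens projPt) (c : k) :
  (fun=> tofrac c%:MP) \in @section_pred U.
Proof.
apply/asboolP => x; exists setT; first by split=> //; exact: openT.
exists 0%N, c%:MP, 1; split; rewrite ?dhomog1 //.
  by rewrite -[c%:MP]mulr1 mul_mpolyC; apply: rpredZ; exact: dhomog1.
move=> y _; split; last by rewrite tofrac1 divr1.
exact: projPt_1 (pt_ideal_proj _).
Qed.

Section Const.
Variable U : opens projPt.

Definition proj_const (c : k) : projSec U := ProjSec (proj_const_section U c).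

Lemma proj_const_zmod : zmod_morphism proj_const.
Proof.
by move=> a b; apply: projSec_ext => x; rewrite /= mpolyCB tofracB.
Qed.

Lemma proj_const_monoid : monoid_morphism proj_const.
Proof.
split=> [|a b]; apply: projSec_ext => x; first by rewrite /= mpolyC1 tofrac1.
by rewrite /= mpolyCM tofracM.
Qed.

HB.instance Definition _ :=
  GRing.isZmodMorphism.Build k (projSec U) proj_const proj_const_zmod.
HB.instance Definition _ :=
  GRing.isMonoidMorphism.Build k (projSec U) proj_const proj_const_monoid.

End Const.

Definition proj : kSpace k.
Proof.
apply: (@KSpace k proj_lr (fun U => proj_const U)).
by move=> U V h c; apply: projSec_ext.
Defined.

End Proj.

(** * Functoriality of Proj *)

Section FracMap.
Variables (R S : idomainType) (f : {rmorphism R -> S}).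
Hypothesis finj : injective f.

(* The extension of [f] to fields of fractions. *)
Definition frac_map (x : {fraction R}) : {fraction S} :=
  tofrac (f (\n_(repr x))) / tofrac (f (\d_(repr x))).

Lemma frac_repr (x : {fraction R}) :
  x = tofrac (\n_(repr x)) / tofrac (\d_(repr x)).
Proof.
have d0 := denom_ratioP (repr x).
apply: canRL (mulfK _) _; first by rewrite tofrac_eq0.
rewrite -{1}[x]reprK; unlock tofrac; rewrite -[LHS]FracField.pi_mul.
apply/eqmodP; rewrite /= /FracField.equivf /FracField.mulf.
by rewrite !numden_Ratio ?mulf_neq0 ?oner_neq0 // !mulr1 mulrC.
Qed.

Lemma frac_mapE (a b : R) : b != 0 ->
  frac_map (tofrac a / tofrac b) = tofrac (f a) / tofrac (f b).
Proof.
move=> b0; move ex: (tofrac a / tofrac b) => x; rewrite /frac_map.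
have d0 := denom_ratioP (repr x).
have e : tofrac (\n_(repr x) * b) = tofrac (a * \d_(repr x)).
  rewrite !tofracM; apply/eqP; rewrite -eqr_div ?tofrac_eq0 // -frac_repr -?ex //.
move/eqP: e; rewrite tofrac_eq => /eqP /(congr1 f); rewrite !rmorphM => e.
apply/eqP; rewrite eqr_div ?tofrac_eq0 -?tofracM ?e //.
  by rewrite (raddf_eq0 _ finj).
by rewrite (raddf_eq0 _ finj).
Qed.

Lemma frac_map_zmod : zmod_morphism frac_map.
Proof.
move=> x y; rewrite {1}(frac_repr x) {1}(frac_repr y).
have dx := denom_ratioP (repr x); have dy := denom_ratioP (repr y).
have fx : f (\d_(repr x)) != 0 by rewrite (raddf_eq0 _ finj).
have fy : f (\d_(repr y)) != 0 by rewrite (raddf_eq0 _ finj).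
rewrite -mulNr addf_div ?tofrac_eq0 // -tofracN -!tofracM -tofracD frac_mapE ?mulf_neq0 //.
rewrite rmorphD !rmorphM rmorphN /= tofracD !tofracM tofracN -addf_div ?tofrac_eq0 //.
by rewrite mulNr.
Qed.

Lemma frac_map_monoid : monoid_morphism frac_map.
Proof.
split; first by rewrite -[X in frac_map X](divr1) -[X in _ / X]tofrac1 -tofrac1 frac_mapE ?oner_neq0 // rmorph1 tofrac1 divr1.
move=> x y; rewrite {1}(frac_repr x) {1}(frac_repr y).
have dx := denom_ratioP (repr x); have dy := denom_ratioP (repr y).
rewrite mulf_div -!tofracM frac_mapE ?mulf_neq0 //.
by rewrite !rmorphM -mulf_div.
Qed.

End FracMap.

(* Injective graded homomorphisms that induce a morphism on all of Proj. *)
Record gradedMor (k K : fieldType) (n m : nat) := GradedMor {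
  gm_fun :> {rmorphism {mpoly k[n]} -> {mpoly K[m]}};
  gm_inj : injective gm_fun;
  gm_homog : forall d f, f \is d.-homog -> gm_fun f \is d.-homog;
  gm_irrelevant : forall q : projPt K m,
    exists d f, [/\ (0 < d)%N, f \is d.-homog & ~ q (gm_fun f)] }.

Section ProjMap.
Variables (k K : fieldType) (n m : nat) (t : gradedMor k K n m).

Lemma gm_pihomog d f : t (pihomog mdeg d f) =
  pihomog mdeg d (t f).
Proof.
pose c i := pihomog mdeg i f; rewrite -/(c d).
have hf i : t (c i) \is i.-homog by apply: gm_homog; exact: pihomogP.
have dn : (d < maxn (msize f) d.+1)%N by rewrite leq_max ltnSn orbT.
have -> : f = \sum_(i < maxn (msize f) d.+1) c i.
  by apply: pihomog_partitionE; rewrite leq_maxl.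
clearbody c; rewrite (raddf_sum t) [RHS]raddf_sum (bigD1 (Ordinal dn)) //=.
rewrite big1 ?addr0; first by rewrite (pihomog_dE (hf d)).
by move=> i ne; exact: pihomog_ne0 ne (hf i).
Qed.

Lemma proj_map_pt_subproof (q : projPt K m) : is_projPt (fun f => q (t f)).
Proof.
case: q (gm_irrelevant t q) => q [q0 qD qM q1 qp qh qi] /= irr; split=> //=.
- by rewrite rmorph0.
- by move=> f g qf qg; rewrite rmorphD; exact: qD.
- by move=> f g qg; rewrite rmorphM; exact: qM.
- by rewrite rmorph1.
- by move=> f g; rewrite rmorphM; exact: qp.
- by move=> d f qf; rewrite gm_pihomog; exact: qh.
Qed.

Definition proj_map_pt (q : projPt K m) : projPt k n :=
  ProjPt (proj_map_pt_subproof q).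

Lemma proj_map_open (U : set (projPt k n)) : open U -> open (proj_map_pt @^-1` U).
Proof.
move/zariskiP => hU; apply/zariskiP => q /hU [f [[d fh] qf fU]].
exists (t f); split=> //; first by exists d; exact: gm_homog.
by move=> r rf; exact: fU.
Qed.

Section Pull.
Variable U : opens (projPt k n).
Local Notation V := (preim_open proj_map_open U).

Definition proj_map_sub (y : sval V) : sval U :=
  exist _ (proj_map_pt (val y)) (mem_set (set_valP y : sval U (proj_map_pt (val y)))).

Lemma proj_pull_section (s : projSec U) :
  (fun y : sval V => frac_map t (s (proj_map_sub y))) \in @section_pred K m V.
Proof.
apply/asboolP => x.
have /asboolP /(_ (proj_map_sub x)) [W [oW Wx] [d [a [b [ha hb sab]]]]] :=
  projSec_section s.
exists (proj_map_pt @^-1` W); first by split=> //; exact: proj_map_open.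
exists d, (t a), (t b); split; try exact: gm_homog.
move=> y Wy; have [yb sy] := sab (proj_map_sub y) Wy; split=> //.
rewrite sy frac_mapE //; first exact: gm_inj.
by have := frac_neq0 yb; rewrite tofrac_eq0.
Qed.

Definition proj_pull (s : projSec U) : projSec V := ProjSec (proj_pull_section s).

Lemma proj_pull_zmod : zmod_morphism proj_pull.
Proof.
by move=> s r; apply: projSec_ext => x; rewrite /= (frac_map_zmod (@gm_inj _ _ _ _ t)).
Qed.

Lemma proj_pull_monoid : monoid_morphism proj_pull.
Proof.
have [f1 fM] := frac_map_monoid (@gm_inj _ _ _ _ t).
by split=> [|s r]; apply: projSec_ext => x; rewrite /= ?f1 ?fM.
Qed.

HB.instance Definition _ :=
  GRing.isZmodMorphism.Build (projSec U) (projSec V) proj_pull proj_pull_zmod.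
HB.instance Definition _ :=
  GRing.isMonoidMorphism.Build (projSec U) (projSec V) proj_pull proj_pull_monoid.

End Pull.

Lemma proj_pullE (U : opens (projPt k n)) (s : projSec U) (W : opens (projPt K m))
  (h : sval W `<=` proj_map_pt @^-1` sval U) (q : sval W)
  (Uq : sval U (proj_map_pt (val q))) :
  @proj_res _ _ (preim_open proj_map_open U) W h (proj_pull s) q =
  frac_map t (s (exist _ (proj_map_pt (val q)) (mem_set Uq))).
Proof. by rewrite /=; congr (frac_map _ (s _)); exact: set_type_inj. Qed.

Lemma proj_map_local (q : proj K m) (U : opens (proj k n)) (s : @sec (proj k n) U) :
  sval U (proj_map_pt q) ->
  @germ_unit (proj K m) q (preim_open proj_map_open U) (proj_pull s) ->
  germ_unit (proj_map_pt q : proj k n) s.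
Proof.
move=> Uq [W [h [Wq [r sr]]]].
pose fq : sval U := exist _ (proj_map_pt q) (mem_set Uq).
have /asboolP /(_ fq) := projSec_section s.
move=> [V [oV Vx] [d [a [b [ha hb sab]]]]].
apply: (proj_germ_unit oV Vx ha hb) => // qa.
pose q' : sval W := exist _ q (mem_set Wq).
have /asboolP /(_ q') [T [oT Tq] [e [c [f [hc hf rcf]]]]] := projSec_section r.
have [qf rq] := rcf q' Tq.
have {}sr : frac_map t (s fq) * r q' = 1.
  have := congr1 (fun z : projSec W => z q') sr.
  by rewrite -(proj_pullE s h (q := q') Uq).
have [qb sq] := sab fq Vx.
have b0 : b != 0 by have := frac_neq0 qb; rewrite tofrac_eq0.
have tb0 : t b != 0 by rewrite (raddf_eq0 _ (@gm_inj _ _ _ _ t)).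
move: sr; rewrite sq frac_mapE ?rq //; last exact: gm_inj.
rewrite mulf_div -!tofracM => /eqP.
have bf0 : tofrac (t b * f) != 0.
  by rewrite tofracM mulf_neq0 //; [rewrite tofrac_eq0|exact: frac_neq0 qf].
rewrite -[1]divr1 eqr_div ?oner_neq0 // mulr1 mul1r tofrac_eq => /eqP e1.
apply: (projPt_nM (p := q) qb qf).
rewrite -e1 mulrC; exact: projPt_M (pt_ideal_proj q) _ _ qa.
Qed.

Lemma proj_map_res (U V : opens (proj k n)) (h : sval V `<=` sval U)
  (h' : sval (preim_open proj_map_open V) `<=` sval (preim_open proj_map_open U))
  (s : @sec (proj k n) U) :
  @proj_res K m _ _ h' (proj_pull s) = proj_pull (proj_res h s).
Proof.
by apply: projSec_ext => x /=; congr (frac_map _ (s _)); exact: set_type_inj.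
Qed.

(* [Proj(t)]: the point [q] goes to the preimage of [q] under [t], and [t] acts
   on fractions. *)
Definition proj_map : lrMor (proj K m) (proj k n) :=
  @LRMor (proj K m) (proj k n) proj_map_pt proj_map_open
    (fun U => @proj_pull U) proj_map_res proj_map_local.

End ProjMap.

Lemma projPt_ext (k : fieldType) (n : nat) (p q : projPt k n) :
  (forall f, p f <-> q f) -> p = q.
Proof.
case: p => p pP; case: q => q qP /= pq.
have e : p = q by apply: funext => f; apply: propext.
by case: _ / e in qP *; rewrite (Prop_irrelevance pP qP).
Qed.

Lemma frac_map_comp (R S T : idomainType) (f : {rmorphism R -> S})
  (g : {rmorphism S -> T}) (h : {rmorphism R -> T}) :
  injective f -> injective g -> (forall x, h x = g (f x)) ->
  forall x, frac_map h x = frac_map g (frac_map f x).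
Proof.
move=> fi gi hE x; have d0 := denom_ratioP (repr x).
rewrite [in RHS](frac_repr x) frac_mapE // frac_mapE //.
  by rewrite /frac_map !hE.
by rewrite (raddf_eq0 _ fi).
Qed.

Lemma proj_map_comp (k K L : fieldType) (n m l : nat) (t : gradedMor k K n m)
  (t' : gradedMor K L m l) (u : gradedMor k L n l) :
  (forall f, u f = t' (t f)) ->
  lr_comp (proj_map t) (proj_map t') = proj_map u.
Proof.
move=> uE.
have ptE (q : projPt L l) : proj_map_pt t (proj_map_pt t' q) = proj_map_pt u q.
  by apply: projPt_ext => f /=; rewrite uE.
apply: lrMor_ext => // U s W hf hg; apply: projSec_ext => x /=.
rewrite -(frac_map_comp (@gm_inj _ _ _ _ t) (@gm_inj _ _ _ _ t') uE).
by congr (frac_map _ (s _)); apply: set_type_inj; exact: ptE.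
Qed.

Lemma proj_map_id (k : fieldType) (n : nat) (t : gradedMor k k n n) :
  (forall f, t f = f) -> proj_map t = lr_id (proj k n).
Proof.
move=> tE.
have ptE (q : projPt k n) : proj_map_pt t q = q.
  by apply: projPt_ext => f /=; rewrite tE.
apply: lrMor_ext => // U s W hf hg; apply: projSec_ext => x /=.
rewrite {1}/frac_map !tE -frac_repr.
by congr (s _); apply: set_type_inj; exact: ptE.
Qed.

Lemma proj_map_kMor (k : fieldType) (n m : nat) (t : gradedMor k k n m) :
  (forall c, t c%:MP = c%:MP) -> is_kMor (proj_map t).
Proof.
move=> tC U c; apply: projSec_ext => x /=.
rewrite -[X in frac_map _ X]divr1 -tofrac1 frac_mapE ?oner_neq0 //; last exact: gm_inj.
by rewrite tC rmorph1 tofrac1 divr1.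
Qed.

(** * The projective space of a vector space *)

Section VectorSpace.
Variables (k : fieldType) (V : vectType k).
Local Notation n := (\dim {:V}).

(* The symmetric algebra of [V] is identified with [{mpoly k[\dim {:V}]}] by
   means of the basis [vbasis {:V}], and likewise the symmetric algebra over
   [K] of the scalar extension of [V]; [lform iota v] is the image of [v] in
   degree 1 of the latter. *)
Definition lform (K : fieldType) (iota : {rmorphism k -> K}) (v : V) :
    {mpoly K[\dim {:V}]} :=
  \sum_(i < \dim {:V}) iota (coord (vbasis {:V}) i v) *: 'X_i.

Definition projSpace : kSpace k := proj k (\dim {:V}).

Lemma lformD (K : fieldType) (iota : {rmorphism k -> K}) u v :
  lform iota (u + v) = lform iota u + lform iota v.
Proof.
by rewrite -big_split; apply: eq_bigr => i _; rewrite /= linearD rmorphD scalerDl.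
Qed.

Lemma lformZ (K : fieldType) (iota : {rmorphism k -> K}) c v :
  lform iota (c *: v) = iota c *: lform iota v.
Proof.
by rewrite scaler_sumr; apply: eq_bigr => i _; rewrite /= linearZ rmorphM scalerA.
Qed.

Lemma lform0 (K : fieldType) (iota : {rmorphism k -> K}) : lform iota 0 = 0.
Proof. by apply: big1 => i _; rewrite linear0 rmorph0 scale0r. Qed.

Lemma lform_homog (K : fieldType) (iota : {rmorphism k -> K}) v : lform iota v \is 1.-homog.
Proof.
apply: rpred_sum => i _; apply: rpredZ.
by rewrite dhomogX; apply/eqP; exact: mdeg1.
Qed.

Lemma lform_basis (K : fieldType) (iota : {rmorphism k -> K}) i :
  lform iota (vbasis {:V})`_i = if insub i is Some j then 'X_(j : 'I_n) else 0.
Proof.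
case: insubP => [j _ <-|ni]; last first.
  rewrite nth_default; last by rewrite size_tuple leqNgt.
  by apply: big1 => j _; rewrite linear0 rmorph0 scale0r.
rewrite /lform (bigD1 j) //= big1 ?addr0.
  by rewrite coord_free ?eqxx ?rmorph1 ?scale1r // (basis_free (vbasisP _)).
move=> l lj; rewrite coord_free ?(basis_free (vbasisP _)) //.
by rewrite eq_sym (negbTE lj) rmorph0 scale0r.
Qed.

Local Notation Fid := [the {rmorphism k -> k} of idfun].

(* The endomorphism of the symmetric algebra that extends [g]. *)
Definition sym (g : 'End(V)) : {rmorphism {mpoly k[n]} -> {mpoly k[n]}} :=
  comp_mpoly [tuple lform Fid (g (vbasis {:V})`_i) | i < n].

Lemma symX g (i : 'I_n) : sym g 'X_i = lform Fid (g (vbasis {:V})`_i).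
Proof. by rewrite [LHS]comp_mpolyXU -tnth_nth tnth_mktuple. Qed.

Lemma symC g c : sym g c%:MP = c%:MP.
Proof. exact: comp_mpolyC. Qed.

Lemma symZ g c f : sym g (c *: f) = c *: sym g f.
Proof. exact: comp_mpolyZ. Qed.

Lemma sym_lform g v : sym g (lform Fid v) = lform Fid (g v).
Proof.
rewrite /lform raddf_sum /=.
have -> : g v = \sum_(i < n) coord (vbasis {:V}) i v *: g (vbasis {:V})`_i.
  rewrite {1}(coord_vbasis (memvf v)) linear_sum; apply: eq_bigr => i _.
  by rewrite linearZ.
rewrite [RHS](big_morph (lform Fid) (lformD Fid) (lform0 Fid)).
by apply: eq_bigr => i _; rewrite symZ symX lformZ.
Qed.

Lemma rmor_mpoly_eq (f g : {rmorphism {mpoly k[n]} -> {mpoly k[n]}}) :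
  (forall c, f c%:MP = g c%:MP) -> (forall i, f 'X_i = g 'X_i) ->
  forall p, f p = g p.
Proof.
move=> hC hX p; rewrite [p]mpolyE (rmorph_sum f) (rmorph_sum g); apply: eq_bigr => m _.
rewrite -mul_mpolyC (rmorphM f) (rmorphM g) hC; congr (_ * _).
rewrite mpolyXE_id (rmorph_prod f) (rmorph_prod g); apply: eq_bigr => i _.
by rewrite (rmorphXn f) (rmorphXn g) hX.
Qed.

Lemma sym_comp g h f : sym g (sym h f) = sym (g \o h)%VF f.
Proof.
apply: (@rmor_mpoly_eq [the {rmorphism _ -> _} of sym g \o sym h]) => [c|i].
  by transitivity (sym g (sym h c%:MP)) => //; rewrite !symC.
by transitivity (sym g (sym h 'X_i)) => //; rewrite !symX sym_lform lfunE.
Qed.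

Lemma sym_id f : sym \1%VF f = f.
Proof.
apply: (@rmor_mpoly_eq (sym \1%VF) [the {rmorphism _ -> _} of idfun]) => [c|i].
  exact: symC.
by rewrite symX lfunE /= lform_basis valK.
Qed.

Lemma sym_homog g d f : f \is d.-homog -> sym g f \is d.-homog.
Proof.
move=> /dhomogP fh; rewrite [f]mpolyE (rmorph_sum (sym g)) big_seq.
apply: rpred_sum => m mf; have <- : mdeg m = d by exact: fh.
rewrite symZ; apply: rpredZ.
rewrite mpolyXE_id (rmorph_prod (sym g)) mdegE.
apply: (@big_rec2 _ _ (fun p e => p \is e.-homog)); first exact: dhomog1.
move=> i p e _ ph; apply: dhomogM ph; rewrite (rmorphXn (sym g)) symX.
by have := dhomogMn (m i) (lform_homog Fid (g (vbasis {:V})`_i)); rewrite mul1n.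
Qed.

Definition GL := {g : 'End(V) | lker g == 0%VS}.

Lemma GL_comp_subproof (g h : GL) : lker (sval g \o sval h)%VF == 0%VS.
Proof.
have /lker0P gi := svalP g; have /lker0P hi := svalP h.
by apply/lker0P => u v; rewrite !lfunE /= => /gi /hi.
Qed.

Definition GL_comp (g h : GL) : GL := exist (fun f => is_true (lker f == 0%VS)) _ (GL_comp_subproof g h).

Lemma GL_inv_subproof (g : GL) : lker (sval g)^-1%VF == 0%VS.
Proof.
by apply/lker0P; exact: can_inj (lker0_lfunVK (svalP g)).
Qed.

Definition GL_inv (g : GL) : GL := exist (fun f => is_true (lker f == 0%VS)) _ (GL_inv_subproof g).

Lemma GL_mulVg (g : GL) : ((sval g)^-1 \o sval g = \1)%VF.
Proof. exact: lker0_compVf (svalP g). Qed.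

Lemma GL_mulgV (g : GL) : (sval g \o (sval g)^-1 = \1)%VF.
Proof. exact: lker0_compfV (svalP g). Qed.

Lemma symK (g : GL) f : sym (sval g)^-1%VF (sym (sval g) f) = f.
Proof. by rewrite sym_comp GL_mulVg sym_id. Qed.

Lemma symVK (g : GL) f : sym (sval g) (sym (sval g)^-1%VF f) = f.
Proof. by rewrite sym_comp GL_mulgV sym_id. Qed.

Lemma sym_irrelevant (g : GL) (q : projPt k n) :
  exists d f, [/\ (0 < d)%N, f \is d.-homog & ~ q (sym (sval g) f)].
Proof.
have [d [f [d0 fh qf]]] := projPt_irrelevant (pt_ideal_proj q).
exists d, (sym (sval g)^-1%VF f); split=> //; first exact: sym_homog.
by rewrite symVK.
Qed.

Definition sym_gm (g : GL) : gradedMor k k n n :=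
  GradedMor (can_inj (symK g)) (@sym_homog (sval g)) (sym_irrelevant g).

Lemma linear_kAut_subproof (g : GL) : @is_kAut k projSpace (proj_map (sym_gm (GL_inv g))).
Proof.
split; first by apply: proj_map_kMor => c; exact: symC.
exists (proj_map (sym_gm g)); split.
  rewrite (proj_map_comp (u := sym_gm (GL_comp g (GL_inv g)))).
    by apply: proj_map_id => f /=; rewrite -[LHS]/(sym _ f) GL_mulgV sym_id.
  by move=> f; rewrite /= -[LHS]/(sym _ f) -sym_comp.
rewrite (proj_map_comp (u := sym_gm (GL_comp (GL_inv g) g))).
  by apply: proj_map_id => f /=; rewrite -[LHS]/(sym _ f) GL_mulVg sym_id.
by move=> f; rewrite /= -[LHS]/(sym _ f) -sym_comp.
Qed.

(* The automorphism of [P(V)] defined by [g]. [Proj] is contravariant, so it is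
   [Proj] of [Sym(g^-1)]. *)
Definition linear_kAut (g : GL) : kAut projSpace := exist _ _ (linear_kAut_subproof g).

(* [F] induces an isomorphism from [PGL(V) = GL(V) / k^*] to the automorphism
   group of [X]. *)
Definition PGL_iso (K : comPzRingType) (X : kSpace K) (F : GL -> kAut X) : Prop :=
  [/\ forall g h, F (GL_comp g h) = kAut_comp (F g) (F h),
      forall g h, F g = F h <-> exists2 c : k, c != 0 & sval g = c *: sval h &
      forall f, exists g, F g = f].

End VectorSpace.

Section ScalarExtension.
Variables (k K : fieldType) (n : nat) (iota : {rmorphism k -> K}).

Lemma map_mpoly_inj : injective (map_mpoly iota : {mpoly k[n]} -> {mpoly K[n]}).
Proof.
move=> f g e; apply/mpolyP => m; apply: (fmorph_inj iota).
by rewrite -!mcoeff_map_mpoly e.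
Qed.

Lemma map_mpoly_homog d (f : {mpoly k[n]}) :
  f \is d.-homog -> map_mpoly iota f \is d.-homog.
Proof.
move=> /dhomogP fh; apply/dhomogP => m.
by rewrite (perm_mem (msupp_map_mpoly f (fmorph_inj iota))); exact: fh.
Qed.

Lemma map_mpoly_irrelevant (q : projPt K n) :
  exists d (f : {mpoly k[n]}), [/\ (0 < d)%N, f \is d.-homog & ~ q (map_mpoly iota f)].
Proof.
have [d [f [d0 /dhomogP fh qf]]] := projPt_irrelevant (pt_ideal_proj q).
apply: contrapT => nex; apply: qf; rewrite [f]mpolyE big_seq.
have [q0 qD] := (projPt_0 (pt_ideal_proj q), @projPt_D _ _ _ (pt_ideal_proj q)).
apply: (big_ind (fun g => q g)) => // m /fh dm.
rewrite -mul_mpolyC; apply: projPt_M (pt_ideal_proj q) _ _ _.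
apply: contrapT => qm; apply: nex; exists d, 'X_[m]; split=> //.
  by rewrite dhomogX; apply/eqP.
by rewrite map_mpolyX.
Qed.

Definition map_mpoly_gm : gradedMor k K n n :=
  @GradedMor k K n n (map_mpoly iota) map_mpoly_inj map_mpoly_homog
    map_mpoly_irrelevant.

End ScalarExtension.

Section Omega.
Variables (k : finFieldType) (V : vectType k).
Local Notation n := (\dim {:V}).

Section OmegaK.
Variables (K : fieldType) (iota : {rmorphism k -> K}).

(* The image of [P((V/W) (x) K)] in [P(V (x) K)]: the kernel of the surjection
   of symmetric algebras is the ideal generated by [W]. *)
Definition hyperplane (W : {vspace V}) : set (proj K n) :=
  [set p : projPt K n | forall w, w \in W -> p (lform iota w)].

Definition Omega_set : set (proj K n) :=
  ~` \bigcup_(W in [set W : {vspace V} | \dim W = 1%N]) hyperplane W.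

Definition vec_of (r : 'rV[k]_n) : V := \sum_(i < n) r 0 i *: (vbasis {:V})`_i.

Lemma vec_of_coord v : vec_of (\row_i coord (vbasis {:V}) i v) = v.
Proof.
rewrite [RHS](coord_vbasis (memvf v)); apply: eq_bigr => i _; by rewrite mxE.
Qed.

Definition rat_forms_prod : {mpoly K[n]} := \prod_(r : 'rV[k]_n | vec_of r != 0) lform iota (vec_of r).

Lemma rat_forms_prod_homog : homogeneous rat_forms_prod.
Proof.
apply: (big_ind (@homogeneous K n)); first by exists 0%N; exact: dhomog1.
  by move=> f g [d fh] [e gh]; exists (d + e)%N; exact: dhomogM.
by move=> r _; exists 1%N; exact: lform_homog.
Qed.

Lemma Omega_open : open Omega_set.
Proof.
apply/zariskiP => p Op; exists rat_forms_prod; split.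
- exact: rat_forms_prod_homog.
- apply: (big_ind (fun f => ~ p f)).
  + exact: projPt_1 (pt_ideal_proj p).
  + by move=> f g pf pg; exact: projPt_nM.
  + move=> r r0 pr; apply: Op; exists <[vec_of r]>%VS; first by rewrite /= dim_vline r0.
    move=> w /vlineP [c ->]; rewrite lformZ -mul_mpolyC.
    exact: projPt_M (pt_ideal_proj p) _ _ pr.
- move=> q qF [W /= W1 qW]; apply: qF.
  have w0 : vpick W != 0 by rewrite vpick0 -dimv_eq0 W1.
  rewrite /rat_forms_prod (bigD1 (\row_i coord (vbasis {:V}) i (vpick W))) ?vec_of_coord //=.
  rewrite mulrC; apply: projPt_M (pt_ideal_proj q) _ _ _.
  by apply: qW; exact: memv_pick.
Qed.

Definition Omega_opens : opens (proj K n) := exist _ _ Omega_open.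

Definition OmegaK : kSpace K := osub_k Omega_opens.

End OmegaK.

Definition Omega : kSpace k := OmegaK [the {rmorphism k -> k} of idfun].

Definition Omega_incl : lrMor Omega (projSpace V) := osub_incl _.

Lemma Omega_proj_subproof (K : fieldType) (iota : {rmorphism k -> K}) :
  sval (Omega_opens iota) `<=` proj_map (map_mpoly_gm n iota) @^-1`
    sval (Omega_opens [the {rmorphism k -> k} of idfun]).
Proof.
move=> p Op [W W1 pW]; apply: Op; exists W => // w /pW /=.
suff -> : map_mpoly iota (lform [the {rmorphism k -> k} of idfun] w) = lform iota w by [].
rewrite /lform (rmorph_sum (map_mpoly iota)); apply: eq_bigr => i _.
by rewrite [LHS]map_mpolyZ map_mpolyX.
Qed.

(* The first projection of the base change of [Omega(V)] to [K], induced by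
   the inclusion of [Sym(V)] in [Sym(V (x) K)]. *)
Definition Omega_proj (K : fieldType) (iota : {rmorphism k -> K}) :
    lrMor (OmegaK iota) Omega :=
  lr_restrict (@Omega_proj_subproof K iota).

End Omega.

(* Main.v *)
Require Import Defs.
From HB Require Import structures.
From mathcomp Require Import all_boot all_order all_algebra fraction.
From mathcomp Require Import boolp classical_sets functions topology_structure.
From mathcomp Require Import mpoly ring zify.

Set Implicit Arguments.
Unset Strict Implicit.
Unset Printing Implicit Defensive.

Import GRing.Theory.

Local Open Scope classical_set_scope.
Local Open Scope ring_scope.

(** Write [n] for the dimension of [V], so that [P(V)] is [Proj] of the
    polynomial ring in [n] variables, and let [K] be an extension of [k]; let
    [q] be the number of elements of [k].

    Morphisms are tuples of forms. The polynomial ring is factorial, and a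
    section over an open subset of [Proj] is the same element of the fraction
    field at all points, because every nonempty open set contains the point
    [(0)]. Pulling back the coordinate functions and clearing denominators
    therefore describes a [K]-morphism from an open subspace to projective
    space by a tuple [F] of forms of one degree without common prime factor
    ([given_by_ex]); [F] is determined up to proportion and determines the
    morphism ([given_by_prop], [given_by_uniq]), and composition is
    substitution ([given_by_comp]). If an automorphism and its inverse have
    the tuples [F] and [G], then [G_i(F) = D X_i] with a form [D]
    ([comp_tuple]). If [n] is at most 1, two [K]-morphisms to projective space
    are always equal ([small_uniq]), so let [n] be at least 2; then a
    homogeneous prime [p] generates a point.

    For projective space itself, a prime factor of [D] would be a point whose
    image is a common zero of [G]; hence [D] is constant and [F] has degree 1
    ([proj_degree1]).

    For [Omega_K] let [F_v] be the linear extension of [F] to the vectors [v]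
    of [k^n]. For [v] nonzero it has no zero on [Omega_K], so by unique
    factorization it is a constant times a product of [k]-rational linear
    forms, indexed by a list [s v] ([lin_ext_factor]). The degree is seen to
    be 1 by means of norms on [k^n], here functions [r] to the natural numbers
    with [r (c v) = r v] and [r (u + v) >= min (r u) (r v)]. A norm is
    diagonal in an adapted basis ([adapted_basis]), so it extends to a
    monomial valuation of the polynomial ring ([norm_weight]). Transporting
    this valuation along [F] shows that [push s r v], the sum of [r m] over
    [m] in [s v], is again a norm ([push_norm]), and that [push s'] for the
    inverse automorphism undoes [push s] up to an additive constant
    ([push_comp]). So the automorphism acts on the polyhedral complex of norms
    modulo constants, and this action is additive whenever the sum of two
    norms is a norm.

    Such an action must permute the lines, that is the indicator functions of
    the one-dimensional subspaces ([push_line]). Let [u] be the image of the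
    line of [l], and split [u = W + Q] where [W] is the indicator of the set
    on which [u] is maximal. Then [push s' W + push s' Q] is the line of [l]
    up to a constant. Two norms have a common minimum point ([common_min]), so
    one of these two summands is constant; it is not [push s' W], because [W]
    is not constant, so [push s' W] is the line of [l] up to a constant. For
    [z] in the subspace [W] also [W + line z] is a norm, which is only
    possible if [push s' (line z)] is maximal at [l]. If [W] contained two
    different lines, their images would have a common minimum [v]. The sum of
    [line z] over the nonzero [z] in [W] is [(q - 1) W]. From [v] to [l], its
    image rises by [q - 1], while the [q - 1] nonzero vectors of each of
    the two lines contribute at least [q - 1] to the rise. So [W] is a line.
    It follows that [s v] has length 1 ([rigid]), which excludes Cremona
    transformations.

    Finally, an invertible linear tuple over [K] that sends every vector of
    [V] to a multiple of a vector of [V] is a multiple of a matrix over [k]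
    ([rational_ratio], [omega_rational]). Consequently every automorphism of
    [P(V)] and of [Omega_K] is induced by [GL(V)] ([proj_aut_lin],
    [Omega_aut_lin]), two linear maps induce the same automorphism exactly if
    they differ by a scalar ([lin_map_incl_inj]), and a [K]-morphism to
    projective space is determined by its projection to [P(V)]
    ([base_map_mono]). *)

(** * Unique factorization *)

Section Divisibility.
Variable R : idomainType.
Implicit Types (a b c d p u : R) (s : seq R).

Definition dvd a b := exists c, b = a * c.

Definition prime_elt p := [/\ p != 0, ~ dvd p 1 &
  forall a b, dvd p (a * b) -> dvd p a \/ dvd p b].

Definition factorial := forall a, a != 0 -> exists u s,
  [/\ dvd u 1, forall p, p \in s -> prime_elt p & a = u * \prod_(p <- s) p].

Definition primitive (I : Type) (a : I -> R) :=
  forall p, prime_elt p -> exists i, ~ dvd p (a i).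

Lemma dvd_refl a : dvd a a. Proof. by exists 1; rewrite mulr1. Qed.

Lemma dvd0 a : dvd a 0. Proof. by exists 0; rewrite mulr0. Qed.

Lemma dvd_trans a b c : dvd a b -> dvd b c -> dvd a c.
Proof. by case=> x -> [y ->]; exists (x * y); rewrite mulrA. Qed.

Lemma dvd_mulr a b c : dvd a b -> dvd a (b * c).
Proof. by move=> ab; apply: dvd_trans ab _; exists c. Qed.

Lemma dvd_mull a b c : dvd a b -> dvd a (c * b).
Proof. by rewrite mulrC; exact: dvd_mulr. Qed.

Lemma dvd_add a b c : dvd a b -> dvd a c -> dvd a (b + c).
Proof. by case=> x -> [y ->]; exists (x + y); rewrite mulrDr. Qed.

Lemma dvd_opp a b : dvd a b -> dvd a (- b).
Proof. by case=> x ->; exists (- x); rewrite mulrN. Qed.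

Lemma dvd_sum (I : Type) (r : seq I) (P : pred I) (F : I -> R) a :
  (forall i, P i -> dvd a (F i)) -> dvd a (\sum_(i <- r | P i) F i).
Proof. by move=> h; elim/big_rec: _ => [|i x /h]; [exact: dvd0|exact: dvd_add]. Qed.

Lemma dvd_unitl u a b : dvd u 1 -> dvd a (u * b) -> dvd a b.
Proof.
by case=> v uv [c e]; exists (c * v); rewrite mulrA -e mulrAC -uv mul1r.
Qed.

Lemma prime_prod p s : prime_elt p -> dvd p (\prod_(q <- s) q) ->
  exists2 q, q \in s & dvd p q.
Proof.
move=> pp; elim: s => [|q s IH]; first by rewrite big_nil => p1; case: pp.
rewrite big_cons => /(proj2 (let: And3 _ a b := pp in conj a b)) [pq|/IH [r rs pr]].
  by exists q; rewrite ?mem_head.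
by exists r => //; rewrite in_cons rs orbT.
Qed.

Lemma prime_dvd_prime p q : prime_elt p -> prime_elt q -> dvd p q -> dvd q p.
Proof.
move=> [p0 p1 _] [q0 q1 qP] [c e].
have /qP [//|[d dE]] : dvd q (p * c) by rewrite -e; exact: dvd_refl.
case: p1; exists d; apply: (mulfI q0).
by rewrite mulr1 mulrCA -dE -e.
Qed.

(** Gauss cancellation: the prime factors of [d] are removed from [c] one at a
    time, since each of them fails to divide some member of the family. *)
Lemma primitive_mul (I : Type) (a : I -> R) (fR : factorial) d c :
  primitive a -> d != 0 -> (forall i, dvd d (c * a i)) -> dvd d c.
Proof.
move=> pa d0; have [u [s [u1 ps dE]]] := fR _ d0.
rewrite {}dE => {d0} h; suff [x ->] : dvd (\prod_(p <- s) p) c.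
  have [v uv] := u1; exists (x * v).
  by rewrite (mulrC x) mulrACA -uv mul1r.
have {h} h i : dvd (\prod_(p <- s) p) (c * a i).
  by apply: dvd_trans (h i); exact/dvd_mull/dvd_refl.
elim: s ps c h => [|p s IH] ps c h; first by exists c; rewrite big_nil mul1r.
have pp := ps p (mem_head _ _); have [i pai] := pa p pp.
have [p0 _ pP] := pp.
have [//|[c' cE]] : dvd p (a i) \/ dvd p c.
  apply/or_comm/pP/(dvd_trans _ (h i)); rewrite big_cons; exact/dvd_mulr/dvd_refl.
rewrite cE big_cons; suff [x ->] : dvd (\prod_(p <- s) p) c'.
  by exists x; rewrite mulrA.
apply: IH => [q qs|j]; first by apply: ps; rewrite in_cons qs orbT.
have [x e] := h j; exists x; apply: (mulfI p0).
by rewrite mulrA -cE e big_cons mulrA.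
Qed.

(** Only the finitely many prime factors of one nonzero member can be common
    factors; dividing out those that are leaves a primitive family, which may
    be infinite. *)
Lemma primitive_part (fR : factorial) (I : Type) (a : I -> R) i0 : a i0 != 0 ->
  exists (g : R) (a' : I -> R), [/\ g != 0, forall i, a i = g * a' i & primitive a'].
Proof.
move=> a0; have [u [s [u1 ps aE]]] := fR _ a0.
(* The primes in [s] are still to be tested; those in [t] do not divide the
whole family. *)
suff H t : (forall p, p \in t -> prime_elt p /\ exists i, ~ dvd p (a i)) ->
    a i0 = u * (\prod_(p <- s) p * \prod_(p <- t) p) ->
    exists (g : R) (a' : I -> R), [/\ g != 0, forall i, a i = g * a' i & primitive a'].
  by apply: (H [::]) => //; rewrite big_nil mulr1.
elim: s ps a a0 {aE} t => [|p s IH] ps a a0 t pt.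
  rewrite big_nil mul1r => aE; exists 1, a; split=> [||p pp].
  - exact: oner_neq0.
  - by move=> i; rewrite mul1r.
  apply: contrapT => np.
  have pa i : dvd p (a i) by apply: contrapT => npi; apply: np; exists i.
  have := pa i0; rewrite aE => /(dvd_unitl u1) /(prime_prod pp) [q qt pq].
  have [qq [i qi]] := pt q qt; apply: qi.
  exact: dvd_trans (prime_dvd_prime pp qq pq) (pa i).
have pp := ps p (mem_head _ _); have p0 : p != 0 by case: pp.
have {}ps q : q \in s -> prime_elt q by move=> qs; apply: ps; rewrite in_cons qs orbT.
rewrite big_cons => aE; have [np|np] := pselect (exists i, ~ dvd p (a i)).
  apply: (IH ps a a0 (p :: t)); last by rewrite aE big_cons; congr (_ * _); rewrite mulrCA mulrA.
  by move=> q; rewrite in_cons => /orP [/eqP ->|/pt] //; split.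
have pa i : {b | a i = p * b}.
  by apply: cid; apply: contrapT => npi; apply: np; exists i.
pose b i := sval (pa i); have bE i : a i = p * b i by exact: (svalP (pa i)).
have b0 : b i0 != 0 by apply: contraNneq a0 => b0; rewrite bE b0 mulr0.
have [||g [c [g0 bc cP]]] := IH ps b b0 t.
- move=> q /pt [qq [i qi]]; split=> //; exists i => qb; apply: qi; rewrite bE.
  exact: dvd_mull.
- by apply: (mulfI p0); rewrite -bE aE -mulrA mulrCA.
exists (p * g), c; split=> //; first by rewrite mulf_neq0.
by move=> i; rewrite bE bc mulrA.
Qed.
End Divisibility.

Lemma first_fail (P : nat -> Prop) : ~ (forall i, P i) ->
  exists2 i, ~ P i & forall j, (j < i)%N -> P j.
Proof.
move=> nP; have ex : exists i, ~~ `[< P i >].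
  apply: contrapT => h; apply: nP => i; apply/asboolP; apply: contrapT => /negP ni.
  by apply: h; exists i.
case: (ex_minnP ex) => i /asboolPn Pi imin; exists i => // j ji.
apply: contrapT => /asboolPn /imin; by rewrite leqNgt ji.
Qed.

Section PolyFactorial.
Variable R : idomainType.
Implicit Types (p : R) (f g h : {poly R}).

Lemma dvd_polyC p f : dvd p%:P f <-> forall i, dvd p f`_i.
Proof.
split=> [[g ->] i|h]; first by rewrite mul_polyC coefZ; exists g`_i.
have {}h i : {c | f`_i = p * c} by apply: cid; exact: h.
exists (\poly_(i < size f) sval (h i)); rewrite mul_polyC; apply/polyP => i.
rewrite coefZ coef_poly; case: ltnP => [_|fi]; first exact: (svalP (h i)).
by rewrite mulr0 nth_default.
Qed.

(** If [p] divides neither [f] nor [g], the product of their first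
    coefficients that [p] does not divide occurs in [f * g] together with multiples of
    [p] only. *)
Lemma prime_polyC p : prime_elt p -> prime_elt p%:P.
Proof.
move=> [p0 p1 pP]; split; first by rewrite polyC_eq0.
  by move/dvd_polyC/(_ 0%N); rewrite coefC.
move=> f g /dvd_polyC pfg; apply: contrapT => /not_orP [].
move=> nf ng; have [|i nfi hi] := @first_fail (fun i => dvd p f`_i).
  by move/dvd_polyC.
have [|j ngj hj] := @first_fail (fun i => dvd p g`_i); first by move/dvd_polyC.
have := pfg (i + j)%N; rewrite coefM.
have lt : (i < (i + j).+1)%N by rewrite ltnS leq_addr.
rewrite (bigD1 (Ordinal lt)) //= addKn => h.
suff /pP [] : dvd p (f`_i * g`_j) by [].
rewrite -[_ * _](addrK (\sum_(l < (i + j).+1 | l != Ordinal lt) f`_l * g`_(i + j - l))).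
apply: dvd_add => //; apply/dvd_opp/dvd_sum => l li.
have [lti|] := ltnP l i; first exact/dvd_mulr/hi.
rewrite leq_eqVlt => /orP [/eqP e|il].
  by case/eqP: li; apply: val_inj.
apply/dvd_mull/hj; have := ltn_ord l; rewrite ltnS => lij; rewrite ltn_subLR // ltn_add2r //.
Qed.

Hypothesis fR : factorial R.

Lemma primitive_polyC p f : primitive (fun i => f`_i) -> prime_elt p -> ~ dvd p%:P f.
Proof. by move=> pf /pf [i ni] /dvd_polyC. Qed.

(** Divisibility over the fraction field, which is what pseudo-division
    tests, gives divisibility over [R] for a primitive divisor. *)
Lemma primitive_cancel c f h g : primitive (fun i => g`_i) -> c != 0 ->
  c *: f = h * g -> dvd g f.
Proof.
move=> pg c0 e; have [u [s [[v uv] ps cE]]] := fR c0.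
suff [x hE] : dvd (\prod_(p <- s) p)%:P h.
  exists (v *: x); have s0 : \prod_(p <- s) p != 0.
    by apply: contraNneq c0 => s0; rewrite cE s0 mulr0.
  have u0 : u != 0 by apply: contraNneq c0 => u0; rewrite cE u0 mul0r.
  have c0' : c%:P != 0 by rewrite polyC_eq0.
  apply: (mulfI c0'); rewrite mul_polyC e hE cE -[v *: x]mul_polyC polyCM.
  move: (\prod_(p <- s) p)%:P => P; rewrite (_ : P * x * g = (u * v)%:P * (P * x * g)).
    by rewrite polyCM; ring.
  by rewrite -uv mul1r.
have {e}: dvd (\prod_(p <- s) p)%:P (h * g).
  by rewrite -e cE -mul_polyC polyCM; exact/dvd_mulr/dvd_mull/dvd_refl.
elim: s ps h {c0 cE f} => [|p s IH] ps h; first by exists h; rewrite big_nil mul1r.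
have pp := ps p (mem_head _ _); have p0 : p%:P != 0 by rewrite polyC_eq0; case: pp.
rewrite big_cons polyCM => -[x e].
have [_ _ pP] := prime_polyC pp.
have /pP [] : dvd p%:P (h * g) by rewrite e -mulrA; exact/dvd_mulr/dvd_refl.
  case=> y hE; suff [z zE] : dvd (\prod_(p <- s) p)%:P y.
    by rewrite hE zE mulrA; exists z.
  apply: IH => [q qs|]; first by apply: ps; rewrite in_cons qs orbT.
  by exists x; apply: (mulfI p0); rewrite !mulrA -hE.
by move/(primitive_polyC pg pp).
Qed.

(** Irreducibility is meant over the fraction field, where Gauss's lemma for
    coprime polynomials applies; primitivity brings the quotient back to
    [R]. *)
Lemma primitive_irr_prime g : primitive (fun i => g`_i) -> irreducible_poly g ->
  prime_elt g.
Proof.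
move=> pg gi; have g0 := irredp_neq0 gi; split=> //.
  case=> x e; have := gi.1; rewrite ltnNge.
  have x0 : x != 0 by apply: contra_eq_neq e => ->; rewrite mulr0 oner_neq0.
  have := size_mul g0 x0; rewrite -e size_poly1.
  move: x0; rewrite -size_poly_gt0; case: (size x) => // m _.
  by rewrite addnS /= => sz; rewrite [X in (_ <= X)%N]sz leq_addr.
have H a : (g %| a)%R -> dvd g a.
  by case/Pdiv.Idomain.dvdpP => -[c q] /= c0 e; exact: primitive_cancel e.
move=> a b [x e]; have gab : (g %| a * b)%R.
  by rewrite e; exact: Pdiv.Idomain.dvdp_mulr.
have [/eqP ga|ga] := boolP (size (gcdp g a) == 1%N).
  right; apply: H; have cga : coprimep g a by rewrite /coprimep ga.
  by rewrite -(Pdiv.Idomain.Gauss_dvdpr b cga).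
left; apply: H; have := gi.2 _ ga (Pdiv.Idomain.dvdp_gcdl g a).
move/Pdiv.Idomain.eqp_dvdl <-; exact: Pdiv.Idomain.dvdp_gcdr.
Qed.

(** A nonconstant divisor of least degree. *)
Lemma irreducible_factor f : (1 < size f)%N ->
  exists2 g, irreducible_poly g & (g %| f)%R.
Proof.
move=> sf; pose P m := `[< exists g, [/\ (1 < size g)%N, size g = m & (g %| f)%R] >].
have ex : exists m, P m by exists (size f); apply/asboolP; exists f; rewrite Pdiv.Idomain.dvdpp.
case: (ex_minnP ex) => m /asboolP [g [sg gm gf]] mmin; exists g => //; split=> // q q1 qg.
have g0 : g != 0 by rewrite -size_poly_gt0 ltnW.
have q0 : q != 0 by apply: contraTneq qg => ->; rewrite Pdiv.Idomain.dvd0p.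
rewrite -Pdiv.Idomain.dvdp_size_eqp // eqn_leq Pdiv.Idomain.dvdp_leq //= gm.
apply: mmin; apply/asboolP; exists q; split=> //; last exact: Pdiv.Idomain.dvdp_trans gf.
by rewrite ltn_neqAle eq_sym q1 size_poly_gt0.
Qed.

(** Gauss's theorem, by induction on the degree: an irreducible factor over the
    fraction field is made primitive and split off. *)
Lemma poly_factorial : factorial {poly R}.
Proof.
move=> f; elim: {f}(size f) {-2}f (leqnn (size f)) => [|m IH] f sf f0.
  by rewrite -size_poly_eq0 -leqn0 sf in f0.
have [sf1|sf1] := leqP (size f) 1.
  have [c fE] : exists c, f = c%:P by exists f`_0; exact: size1_polyC.
  have c0 : c != 0 by rewrite fE polyC_eq0 in f0.
  have [u [s [[v uv] ps cE]]] := fR c0.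
  exists u%:P, [seq p%:P | p <- s]; split.
  - by exists v%:P; rewrite -polyCM -uv.
  - by move=> _ /mapP [p /ps pp ->]; exact: prime_polyC.
  - by rewrite big_map fE cE polyCM rmorph_prod.
have [g gi /Pdiv.Idomain.dvdpP [[c q] /= c0 fg]] := irreducible_factor sf1.
have g0 := irredp_neq0 gi.
have lg0 : g`_(size g).-1 != 0 by rewrite -/(lead_coef g) lead_coef_eq0.
have [d [a [d0 ga aP]]] := primitive_part fR (a := fun i => g`_i) lg0.
set g' : {poly R} := \poly_(i < size g) a i.
have gE : g = d *: g'.
  apply/polyP => i; rewrite coefZ coef_poly; case: ltnP => // gi'.
  by rewrite mulr0 nth_default.
have g'P : primitive (fun i => g'`_i).
  move=> p pp; have [i ni] := aP p pp; exists i; rewrite coef_poly; case: ltnP => // gi'.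
  case: ni; suff -> : a i = 0 by exact: dvd0.
  by apply: (mulfI d0); rewrite -ga mulr0 nth_default.
have [x xE] : dvd g' f.
  by apply: (primitive_cancel g'P c0 (h := d *: q)); rewrite fg {1}gE -scalerAr -scalerAl.
have sg' : size g' = size g by rewrite gE size_scale.
have g'i : irreducible_poly g'.
  split; first by rewrite sg' gi.1.
  have gg' : (g %= g')%R by rewrite gE; exact: Pdiv.Idomain.eqp_scale.
  move=> r r1 rg; rewrite -(Pdiv.Idomain.eqp_rtrans gg'); apply: gi.2 => //.
  by rewrite (Pdiv.Idomain.eqp_dvdr _ gg').
have x0 : x != 0 by apply: contraNneq f0 => x0; rewrite xE x0 mulr0.
have sx : (size x <= m)%N.
  move: sf; rewrite xE (size_mul (irredp_neq0 g'i) x0); have := g'i.1.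
  by case: (size g') => [|[|l]] //= _; rewrite addSn /= ltnS; exact: leq_trans (leq_addl _ _).
have [u [s [u1 ps xs]]] := IH x sx x0.
exists u, (g' :: s); split=> //; last by rewrite big_cons xE xs mulrCA.
move=> p; rewrite in_cons => /orP [/eqP ->|/ps //].
exact: primitive_irr_prime.
Qed.
End PolyFactorial.

Lemma factorial_iso (R S : idomainType) (f : {rmorphism R -> S}) (g : {rmorphism S -> R}) :
  cancel f g -> cancel g f -> factorial R -> factorial S.
Proof.
move=> fK gK fR a a0.
have fdvd x y : dvd (f x) (f y) <-> dvd x y.
  split=> -[c e]; last by exists (f c); rewrite e rmorphM.
  by exists (g c); apply: (can_inj fK); rewrite rmorphM gK.
have fprime p : prime_elt p -> prime_elt (f p).
  move=> [p0 p1 pP]; split.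
  - by rewrite (raddf_eq0 _ (can_inj fK)).
  - by rewrite -(rmorph1 f) => /fdvd.
  - by move=> b c; rewrite -(gK b) -(gK c) -rmorphM => /fdvd/pP [] /fdvd; [left|right].
have ga0 : g a != 0 by rewrite (raddf_eq0 _ (can_inj gK)).
have [u [s [u1 ps e]]] := fR _ ga0; exists (f u), (map f s); split.
- by rewrite -(rmorph1 f); apply/fdvd.
- by move=> _ /mapP [p /ps /fprime pp ->].
- by rewrite big_map -rmorph_prod -rmorphM -e gK.
Qed.

Section MpolyPoly.
Variables (K : fieldType) (n : nat).

(** The last variable is split off, so that factoriality passes from [n] to
    [n + 1] variables. *)
Definition poly_mpoly (p : {poly {mpoly K[n]}}) : {mpoly K[n.+1]} :=
  (map_poly (@mwiden n K) p).['X_ord_max].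

Lemma poly_mpoly_zmod : zmod_morphism poly_mpoly.
Proof. by move=> p q; rewrite /poly_mpoly rmorphB /= hornerD hornerN. Qed.

Lemma poly_mpoly_monoid : monoid_morphism poly_mpoly.
Proof.
by split=> [|p q]; rewrite /poly_mpoly ?rmorph1 ?hornerC // rmorphM /= hornerM.
Qed.

HB.instance Definition _ := GRing.isZmodMorphism.Build _ _ poly_mpoly poly_mpoly_zmod.
HB.instance Definition _ := GRing.isMonoidMorphism.Build _ _ poly_mpoly poly_mpoly_monoid.
End MpolyPoly.

Lemma rmor_mpoly_ext (R : comNzRingType) (S : comPzRingType) (n : nat) (f g : {rmorphism {mpoly R[n]} -> S}) :
  (forall c, f c%:MP = g c%:MP) -> (forall i, f 'X_i = g 'X_i) ->
  forall p, f p = g p.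
Proof.
move=> hC hX p; rewrite [p]mpolyE (rmorph_sum f) (rmorph_sum g); apply: eq_bigr => m _.
rewrite -mul_mpolyC (rmorphM f) (rmorphM g) hC; congr (_ * _).
rewrite mpolyXE_id (rmorph_prod f) (rmorph_prod g); apply: eq_bigr => i _.
by rewrite (rmorphXn f) (rmorphXn g) hX.
Qed.

Definition mpoly_poly_X (K : fieldType) n (i : 'I_n.+1) : {poly {mpoly K[n]}} :=
  if unlift ord_max i is Some j then ('X_j)%:P else 'X.

Definition mpoly_poly (K : fieldType) n : {rmorphism {mpoly K[n.+1]} -> {poly {mpoly K[n]}}} :=
  mmap (polyC \o @mpolyC n K) (@mpoly_poly_X K n).

Lemma mpoly_polyK (K : fieldType) n : cancel (@mpoly_poly K n) (@poly_mpoly K n).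
Proof.
move=> p; apply: (@rmor_mpoly_ext _ _ _
  [the {rmorphism _ -> _} of @poly_mpoly K n \o @mpoly_poly K n]
  [the {rmorphism _ -> _} of idfun]) => [c|i] /=.
  by rewrite mmapC /= /poly_mpoly map_polyC hornerC /= mwidenC.
rewrite mmapX mmap1U /mpoly_poly_X; case: unliftP => [j ->|->].
  rewrite /poly_mpoly map_polyC hornerC /= mwidenX mnmwiden1; congr 'X_[U_(_)].
  by apply: val_inj; rewrite /= /bump leqNgt ltn_ord.
by rewrite /poly_mpoly map_polyX hornerX.
Qed.

Lemma poly_mpolyK (K : fieldType) n : cancel (@poly_mpoly K n) (@mpoly_poly K n).
Proof.
have H c : mpoly_poly K n (mwiden c) = c%:P.
  apply: (@rmor_mpoly_ext _ _ _
    [the {rmorphism _ -> _} of @mpoly_poly K n \o @mwiden n K]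
    [the {rmorphism _ -> _} of @polyC {mpoly K[n]}]) => [a|i] /=.
    by rewrite mwidenC mmapC.
  rewrite mwidenX mnmwiden1 mmapX mmap1U /mpoly_poly_X.
  by case: unliftP => [j /(congr1 val)|/(congr1 val)] /=; rewrite ?/bump ?(leqNgt n) ?ltn_ord => e;
    [congr ('X_ _)%:P; apply: val_inj|have := ltn_ord i; rewrite e ltnn].
move=> p; rewrite /poly_mpoly; elim/poly_ind: p => [|p c IH].
  by rewrite rmorph0 horner0 rmorph0.
rewrite rmorphD rmorphM /= map_polyX map_polyC hornerD hornerMX hornerC rmorphD rmorphM IH /= H.
by rewrite mmapX mmap1U /mpoly_poly_X unlift_none.
Qed.

Lemma mpoly_factorial (K : fieldType) n : factorial {mpoly K[n]}.
Proof.
elim: n => [|n IH]; last first.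
  exact: factorial_iso (@poly_mpolyK K n) (@mpoly_polyK K n) (poly_factorial IH).
move=> p p0; exists p, [::]; split=> //; last by rewrite big_nil mulr1.
rewrite (nvar0_mpolyC p) mpolyC_eq0 in p0 *.
by exists (p@_0)^-1%:MP; rewrite -mpolyCM mulfV.
Qed.

(** * Factors of homogeneous polynomials *)

Section Homogeneous.
Variables (K : fieldType) (n : nat).
Local Notation S := {mpoly K[n]}.
Implicit Types (f g a b : S).

(** The substitution of [X_i t] for [X_i]. The homogeneous components become
    the coefficients of the powers of [t]. *)
Definition grade_map : {rmorphism S -> {poly S}} :=
  mmap (polyC \o @mpolyC n K) (fun i => 'X_i *: 'X).

Lemma coef_grade_map f d : (grade_map f)`_d = pihomog mdeg d f.
Proof.
rewrite [f in LHS]mpolyE (rmorph_sum grade_map) coef_sum /pihomog [RHS]big_mkcond.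
apply: eq_bigr => m _; rewrite -mul_mpolyC (rmorphM grade_map) /= mmapC mmapX.
have -> : mmap1 (fun i : 'I_n => 'X_i *: 'X : {poly S}) m = 'X_[m] *: 'X^(mdeg m).
  rewrite /mmap1 mdegE -prodrXr mpolyXE_id -mul_polyC rmorph_prod -big_split.
  by apply: eq_bigr => i _; rewrite exprZn rmorphXn /= -mul_polyC rmorphXn.
rewrite /= mul_polyC coefZ coefZ coefXn eq_sym; case: eqVneq => _.
  by rewrite mulr1 mul_mpolyC.
by rewrite !mulr0.
Qed.

Lemma grade_map_homog f d : f \is d.-homog -> grade_map f = f *: 'X^d.
Proof.
move=> fd; apply/polyP => i; rewrite coef_grade_map coefZ coefXn.
case: eqVneq => [->|ne]; first by rewrite mulr1 pihomog_dE.
by rewrite mulr0 (pihomog_ne0 _ fd) // eq_sym.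
Qed.

(** A divisor of a form maps under [grade_map] to a divisor of [f t^d], and
    over the fraction field the divisors of [t^d] are monomials in [t]. *)
Lemma dvd_homog (a f : S) (d : nat) : f \is d.-homog -> f != 0 -> dvd a f ->
  exists e : nat, a \is e.-homog.
Proof.
move=> fd f0 [b fE].
have : (grade_map a %| 'X^d)%R.
  apply/Pdiv.Idomain.dvdpP; exists (f, grade_map b); first exact: f0.
  have e := grade_map_homog fd; rewrite fE (rmorphM grade_map) -fE in e.
  by rewrite /= -e; exact: mulrC.
rewrite -['X]subr0 -polyC0 => /Pdiv.Idomain.dvdp_exp_XsubCP [e _].
rewrite polyC0 subr0 => /Pdiv.Idomain.eqpP [[c1 c2] /andP [/= c10 c20] e1].
exists e; rewrite homog_piE; apply/eqP; apply/mpolyP => m.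
have H i : i != e -> pihomog mdeg i a = 0.
  move=> ie; have /eqP := congr1 (fun p : {poly S} => p`_i) e1.
  rewrite !coefZ coefXn (negbTE ie) mulr0 coef_grade_map mulf_eq0 (negbTE c10).
  by move/eqP.
have en : (e < maxn (msize a) e.+1)%N by rewrite leq_max ltnSn orbT.
rewrite [a in RHS](pihomog_partitionE (leq_maxl (msize a) e.+1)).
rewrite (bigD1 (Ordinal en)) //= [X in _ + X]big1 ?addr0 // => i ie.
by apply: H.
Qed.

Lemma homog0_const f : f \is 0.-homog -> f = (f@_0)%:MP.
Proof.
move=> /dhomogP h; apply/mpolyP => m; rewrite mcoeffC.
have [->|m0] := eqVneq m 0%MM; first by rewrite mulr1.
rewrite mulr0; apply: memN_msupp_eq0; apply: contra m0 => /h /eqP.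
by rewrite mdeg_eq0.
Qed.

Lemma const_homog (c : K) : (c%:MP : S) \is 0.-homog.
Proof. by rewrite -[c%:MP]mulr1 mul_mpolyC; apply: rpredZ; exact: dhomog1. Qed.

Lemma dvd_const (c : K) : c != 0 -> dvd (c%:MP : S) 1.
Proof. by move=> c0; exists c^-1%:MP; rewrite -mpolyCM mulfV. Qed.

Lemma dvd1_const f : dvd f 1 -> exists2 c, c != 0 & f = c%:MP.
Proof.
case=> g e; have f0 : f != 0 by apply: contra_eq_neq e => ->; rewrite mul0r oner_neq0.
have g0 : g != 0 by apply: contra_eq_neq e => ->; rewrite mulr0 oner_neq0.
have := msizeM f0 g0; rewrite -e msize1 => sz; apply/msize_poly1P.
rewrite -msize_poly_eq0 in f0; rewrite -msize_poly_eq0 in g0.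
move: f0 g0 sz; case: (mmeasure _ f) => [|[|x]] //.
all: by case: (mmeasure _ g) => [|[|y]] //; rewrite !addSn ?addnS.
Qed.

Lemma var_homog i : ('X_i : S) \is 1.-homog.
Proof. by rewrite dhomogX; apply/eqP; exact: mdeg1. Qed.

Lemma homog_unit f d : f \is d.-homog -> dvd f 1 -> d = 0%N.
Proof.
move=> fd /dvd1_const [c c0 fE]; apply: (dhomog_uniq _ fd).
  by rewrite fE mpolyC_eq0.
by rewrite fE const_homog.
Qed.

Lemma homog_factor f d a b : f \is d.-homog -> f != 0 -> f = a * b ->
  exists e1 e2, [/\ a \is e1.-homog, b \is e2.-homog & d = (e1 + e2)%N].
Proof.
move=> fd f0 fE.
have [e1 h1] : exists e : nat, a \is e.-homog by apply: dvd_homog fd f0 _; exists b.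
have [e2 h2] : exists e : nat, b \is e.-homog.
  by apply: dvd_homog fd f0 _; exists a; rewrite mulrC.
by exists e1, e2; split=> //; apply: (dhomog_uniq f0 fd); rewrite fE dhomogM.
Qed.

Lemma homog_not_unit f d : f \is d.-homog -> f != 0 -> ~ dvd f 1 -> (0 < d)%N.
Proof.
move=> fd f0 f1; case: d fd => // fd; case: f1.
by rewrite (homog0_const fd); apply: dvd_const; rewrite -(mpolyC_eq0 n) -homog0_const.
Qed.

Lemma prime_factor f : f != 0 -> ~ dvd f 1 -> exists2 p, prime_elt p & dvd p f.
Proof.
move=> f0 f1; have [u [[|p s] [u1 ps fE]]] := mpoly_factorial f0.
  by rewrite big_nil mulr1 in fE; case: f1; rewrite fE.
exists p; first exact/ps/mem_head.
by rewrite fE big_cons; exact/dvd_mull/dvd_mulr/dvd_refl.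
Qed.

(** The degrees of the factors add up to 1, so a prime factor of a linear form
    is associated to it. *)
Lemma homog1_prime f : f \is 1.-homog -> f != 0 -> prime_elt f.
Proof.
move=> fh f0; have f1 : ~ dvd f 1 by move/(homog_unit fh).
have [p pp [c fE]] := prime_factor f0 f1.
have [e1 [e2 [h1 h2 e]]] := homog_factor fh f0 fE.
have p0 : p != 0 by case: pp.
have p1 : ~ dvd p 1 by case: pp.
have := homog_not_unit h1 p0 p1; case: e1 e h1 => // e1 [] /esym/eqP.
rewrite addn_eq0 => /andP [_ /eqP e20] _ _.
rewrite e20 in h2; have c0 : c != 0 by apply: contraNneq f0 => c0; rewrite fE c0 mulr0.
have [d dE] : dvd c 1.
  by rewrite (homog0_const h2); apply: dvd_const; rewrite -(mpolyC_eq0 n) -homog0_const.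
split=> // a b [x e]; have [_ _ pP] := pp.
have H y : dvd p y -> dvd f y.
  by case=> z ->; exists (d * z); rewrite fE -mulrA (mulrA c) -dE mul1r.
by case: (pP a b) => [||]; [exists (c * x); rewrite e fE mulrA|left; exact: H|right; exact: H].
Qed.

Lemma dvd_prime_assoc (p q : S) : prime_elt p -> prime_elt q -> dvd p q ->
  exists2 c : K, c != 0 & p = c *: q.
Proof.
move=> pp qq pq; have [d dE] := prime_dvd_prime pp qq pq; have [c cE] := pq.
have q0 : q != 0 by case: qq.
have [|x x0 xE] := @dvd1_const d; last by exists x => //; rewrite dE xE mulrC mul_mpolyC.
by exists c; apply: (mulfI q0); rewrite mulr1 mulrA -dE.
Qed.

Lemma var_prime i : prime_elt ('X_i : S).
Proof.
apply: homog1_prime (var_homog i) _.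
by apply/eqP => /(congr1 (mcoeff U_(i)%MM)) /eqP; rewrite mcoeffX eqxx mcoeff0 oner_eq0.
Qed.

Lemma var_ndvd (i j : 'I_n) : i != j -> ~ dvd ('X_i : S) 'X_j.
Proof.
move=> ij [c /(congr1 (meval (fun l => (l == j)%:R)))].
by rewrite mevalM !mevalXU eqxx (negbTE ij) mul0r => /eqP; rewrite oner_eq0.
Qed.

(** Multiplication by a form of degree [d] shifts the coefficients of
    [grade_map] by [d]. *)
Lemma pihomog_mul_homog (p f : S) d e : p \is d.-homog ->
  pihomog mdeg e (p * f) = if (e < d)%N then 0 else p * pihomog mdeg (e - d) f.
Proof.
move=> pd; rewrite -coef_grade_map rmorphM /= (grade_map_homog pd) -scalerAl coefZ.
by rewrite coefXnM; case: ltnP => _; rewrite ?mulr0 // coef_grade_map.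
Qed.

(** A second variable is what makes [(p)] relevant: a prime cannot divide both
    [X_i] and [X_j]. *)
Lemma prime_projPt (i j : 'I_n) (p : S) d : i != j -> prime_elt p -> p \is d.-homog ->
  exists x : projPt K n, forall f, x f <-> dvd p f.
Proof.
move=> ij pp ph; have [p0 p1 pP] := pp.
suff H : is_projPt (dvd p) by exists (ProjPt H).
split=> //.
- exact: dvd0.
- by move=> f g; exact: dvd_add.
- by move=> f g; exact: dvd_mull.
- move=> e f [c ->]; rewrite (pihomog_mul_homog _ _ ph); case: ifP => _.
    exact: dvd0.
  exact/dvd_mulr/dvd_refl.
- have [pi|npi] := pselect (dvd p 'X_i); last first.
    by exists 1%N, 'X_i; split=> //; exact: var_homog.
  exists 1%N, 'X_j; split=> // [|pj]; first exact: var_homog.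
  exact: (var_ndvd ij (dvd_trans (prime_dvd_prime pp (var_prime i) pi) pj)).
Qed.
End Homogeneous.

(** * Norms on a vector space over a finite field *)

Section Norms.
Variables (k : finFieldType) (n : nat).
Local Notation E := 'rV[k]_n.
Implicit Types (r p q : E -> nat) (u v x y z : E) (c : k) (s : E -> seq E).
Local Open Scope nat_scope.

(** The value at the zero vector, which would be infinite, is left out. A norm
    is a descending filtration of the vector space by subspaces, indexed by the
    natural numbers. *)
Definition is_norm r := (forall c v, c != 0%R -> r (c *: v)%R = r v) /\
  forall u v, u != 0%R -> v != 0%R -> (u + v)%R != 0%R ->
    minn (r u) (r v) <= r (u + v)%R.

Definition colin y x := [exists c : k, (c != 0%R) && (x == c *: y)%R].

Definition line y x : nat := colin y x.

Lemma colinP y x : reflect (exists2 c, c != 0%R & x = c *: y)%R (colin y x).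
Proof.
apply: (iffP existsP) => [[c /andP [c0 /eqP xE]]|[c c0 xE]]; first by exists c.
by exists c; rewrite c0 xE eqxx.
Qed.

Lemma colin_refl x : colin x x.
Proof. by apply/colinP; exists 1%R; rewrite ?oner_neq0 ?scale1r. Qed.

Lemma colin_sym x y : colin x y = colin y x.
Proof.
suff H u v : colin u v -> colin v u by apply/idP/idP; exact: H.
move/colinP => [c c0 ->]; apply/colinP; exists c^-1%R; rewrite ?invr_eq0 //.
by rewrite scalerA mulVf // scale1r.
Qed.

Lemma colin_trans x y z : colin x y -> colin y z -> colin x z.
Proof.
move/colinP => [c c0 ->] /colinP [d d0 ->]; apply/colinP; exists (d * c)%R.
  by rewrite mulf_neq0.
by rewrite scalerA.
Qed.

Lemma colin_eq x y z : colin x y -> colin x z = colin y z.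
Proof.
move=> xy; apply/idP/idP; last exact: colin_trans.
by apply: colin_trans; rewrite colin_sym.
Qed.

Lemma norm_colin r x y : is_norm r -> colin x y -> r y = r x.
Proof. by move=> [rZ _] /colinP [c c0 ->]; rewrite rZ. Qed.

Lemma normN r x : is_norm r -> r (- x)%R = r x.
Proof. by case=> rZ _; rewrite -scaleN1r rZ // oppr_eq0 oner_neq0. Qed.

Lemma norm_ext r q : is_norm r -> (forall v, v != 0%R -> q v = r v) -> is_norm q.
Proof.
move=> [rZ rD] qr; split=> [c v c0|u v u0 v0 uv]; last by rewrite !qr //; exact: rD.
have [->|v0] := eqVneq v 0%R; first by rewrite scaler0.
by rewrite !qr ?rZ // scaler_eq0 negb_or c0.
Qed.

Lemma norm_shift (b : nat) r : is_norm (fun v => b + r v) -> is_norm r.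
Proof.
move=> [rZ rD]; split=> [c v c1|u v u0 v0 uv]; first by have := rZ c v c1; lia.
by have := rD u v u0 v0 uv; lia.
Qed.

Lemma norm_minn r t : is_norm r -> is_norm (fun v => minn (r v) t).
Proof.
move=> [rZ rD]; split=> [c v c1|u v u0 v0 uv]; first by rewrite rZ.
by have := rD u v u0 v0 uv; lia.
Qed.

Lemma norm_thr r t : is_norm r -> is_norm (fun v => t <= r v : nat).
Proof.
move=> [rZ rD]; split=> [c v c1|u v u0 v0 uv]; first by rewrite rZ.
by have := rD u v u0 v0 uv; lia.
Qed.

Lemma colinZ c y x : c != 0%R -> colin y (c *: x)%R = colin y x.
Proof.
move=> c0; apply/idP/idP => [h|h]; apply: colin_trans h _; last first.
  by apply/colinP; exists c.
by rewrite colin_sym; apply/colinP; exists c.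
Qed.

Lemma colinD y u v : (u + v)%R != 0%R -> colin y u -> colin y v -> colin y (u + v)%R.
Proof.
move=> uv /colinP [c _ uE] /colinP [d _ vE]; apply/colinP; exists (c + d)%R.
  by apply: contraNneq uv => cd; rewrite uE vE -scalerDl cd scale0r.
by rewrite uE vE scalerDl.
Qed.

Lemma norm_line y : is_norm (line y).
Proof.
split=> [c v c0|u v u0 v0 uv]; first by rewrite /line colinZ.
rewrite /line; have := @colinD y u v uv.
by case: (colin y u); case: (colin y v) => // ->.
Qed.

(** The indicator of the subspace on which [r] is maximal, with a line of
    that subspace added on top of it, is a flag of two subspaces. *)
Lemma norm_thr_line r y : is_norm r -> y != 0%R -> (forall v, v != 0%R -> r v <= r y) ->
  is_norm (fun v => (r y <= r v) + line y v).
Proof.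
move=> rn y0 rmax; have [rZ rD] := rn; split=> [c v c0|u v u0 v0 uv].
  by rewrite rZ // /line colinZ.
have := rD u v u0 v0 uv; rewrite /line; have := @colinD y u v uv.
have H w : colin y w -> r w = r y by exact: norm_colin.
move: (H u) (H v) (rmax _ u0) (rmax _ v0) (rmax _ uv).
case: (colin y u); case: (colin y v); case: (colin y (u + v)%R) => Hu Hv ? ? ? // h.
all: try (have := h isT isT); try (have := Hu isT); try (have := Hv isT); lia.
Qed.

(** The ultrametric inequality is an equality when the values differ. *)
Lemma norm_add_lt r x y : is_norm r -> x != 0%R -> y != 0%R -> r x < r y ->
  (x + y)%R != 0%R /\ r (x + y)%R = r x.
Proof.
move=> rn x0 y0 xy; have [rZ rD] := rn.
have xy0 : (x + y)%R != 0%R.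
  apply: contraTneq xy => /eqP; rewrite addr_eq0 => /eqP ->.
  by rewrite (normN _ rn) ltnn.
split=> //; have := rD _ _ x0 y0 xy0.
have := rD (x + y)%R (- y)%R xy0; rewrite oppr_eq0 addrK (normN _ rn).
by move/(_ y0 x0); lia.
Qed.

Lemma norm_min r x : x != 0%R -> exists2 y, y != 0%R & forall v, v != 0%R -> r y <= r v.
Proof.
move=> x0; case: (@arg_minnP _ x (fun v => v != 0%R) r) => //= y y0 ymin.
by exists y.
Qed.

Lemma norm_max r x : x != 0%R -> exists2 y, y != 0%R & forall v, v != 0%R -> r v <= r y.
Proof.
move=> x0; case: (@arg_maxnP _ x (fun v => v != 0%R) r) => //= y y0 ymin.
by exists y.
Qed.

(** If [y] minimizes [p], [z] minimizes [q], and neither minimizes both, then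
    [y + z] does, by the ultrametric equality. *)
Lemma common_min p q x : is_norm p -> is_norm q -> x != 0%R ->
  exists2 y, y != 0%R & forall v, v != 0%R -> p y <= p v /\ q y <= q v.
Proof.
move=> pn qn x0; have [y y0 ymin] := norm_min p x0; have [z z0 zmin] := norm_min q x0.
have [e1|e1] := eqVneq (p z) (p y).
  by exists z => // v v0; rewrite e1; split; [exact: ymin|exact: zmin].
have [e2|e2] := eqVneq (q y) (q z).
  by exists y => // v v0; rewrite e2; split; [exact: ymin|exact: zmin].
have lp : p y < p z by rewrite ltn_neqAle eq_sym e1 ymin.
have lq : q z < q y by rewrite ltn_neqAle eq_sym e2 zmin.
have [yz0 e3] := norm_add_lt pn y0 z0 lp; have [_ e4] := norm_add_lt qn z0 y0 lq.
exists (y + z)%R => // v v0; rewrite e3 addrC e4; split; [exact: ymin|exact: zmin].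
Qed.

(** The value at [v] of the valuation extending [r] on the product of the
    linear forms listed in [s v]. *)
Definition push s r v := \sum_(m <- s v) r m.

Lemma pushD s r q v : push s (fun x => r x + q x) v = push s r v + push s q v.
Proof. exact: big_split. Qed.

Lemma push_ext s r q v : v != 0%R -> (forall x m, x != 0%R -> m \in s x -> m != 0%R) ->
  (forall x, x != 0%R -> r x = q x) -> push s r v = push s q v.
Proof.
move=> v0 s0 rq; rewrite /push big_seq [RHS]big_seq; apply: eq_bigr => m mv.
exact/rq/(s0 v).
Qed.

(** Each line is counted once for each of its nonzero vectors. *)
Lemma sum_line_colin r y : is_norm r -> y != 0%R -> r y = 1 ->
  \sum_(a | (a != 0%R) && (r a == 1)) line y a = #|[pred c : k | c != 0%R]|.
Proof.
move=> rn y0 ry; rewrite -(card_image (f := fun c : k => (c *: y)%R)); last first.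
  by move=> c c' /eqP; rewrite -subr_eq0 -scalerBl scaler_eq0 (negbTE y0) orbF subr_eq0 => /eqP.
rewrite -sum1_card big_mkcond [RHS]big_mkcond; apply: eq_bigr => a _.
have -> : (a \in [seq (c *: y)%R | c in [pred c : k | c != 0%R]]) = colin y a.
  by apply/fintype.imageP/colinP => -[c]; rewrite ?inE => c0 aE; exists c; rewrite ?inE.
rewrite /line; case: (boolP (colin y a)) => [ya|_]; last by case: ifP.
rewrite (norm_colin rn ya) ry eqxx andbT; case: eqVneq => // a0.
have [c c0 aE] := colinP _ _ ya; move: a0; rewrite aE => /eqP.
by rewrite scaler_eq0 (negbTE c0) (negbTE y0).
Qed.

Lemma sum_line r x : is_norm r -> (forall a, r a <= 1) -> x != 0%R ->
  \sum_(a | (a != 0%R) && (r a == 1)) line a x = #|[pred c : k | c != 0%R]| * r x.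
Proof.
move=> rn r1 x0; have [rx|rx] := eqVneq (r x) 1.
  rewrite rx muln1 -(sum_line_colin rn x0 rx); apply: eq_bigr => a _.
  by rewrite /line colin_sym.
have -> : r x = 0 by have := r1 x; lia.
rewrite muln0; apply: big1 => a /andP [_ /eqP ra]; rewrite /line.
by case: (boolP (colin a x)) => // /(norm_colin rn) e; rewrite e ra eqxx in rx.
Qed.

Lemma push_line_colin s v y a : colin y a -> push s (line y) v = push s (line a) v.
Proof. by move=> ya; apply: eq_bigr => m _; rewrite /line (colin_eq _ ya). Qed.

Section Rigid.
Variables (s s' : E -> seq E) (d d' : nat).
(* The lists [s v] and [s' v] stand for the factorizations of the linear
extensions of the tuples of two inverse automorphisms. Taken together, [ss']
and [s's] say that [push s] and [push s'] are inverse up to constants; [sp]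
and [sp'] say that the factors of the [s v] have nothing in common. *)
Hypotheses (s0 : forall x m, x != 0%R -> m \in s x -> m != 0%R)
  (s0' : forall x m, x != 0%R -> m \in s' x -> m != 0%R)
  (sd : forall x, x != 0%R -> size (s x) = d)
  (sd' : forall x, x != 0%R -> size (s' x) = d')
  (sn : forall r, is_norm r -> is_norm (push s r))
  (sn' : forall r, is_norm r -> is_norm (push s' r))
  (ss' : forall r, is_norm r -> forall x y, x != 0%R -> y != 0%R ->
     push s' (push s r) x + r y = push s' (push s r) y + r x)
  (s's : forall r, is_norm r -> forall x y, x != 0%R -> y != 0%R ->
     push s (push s' r) x + r y = push s (push s' r) y + r x)
  (sp : forall l, l != 0%R -> exists2 v, v != 0%R & push s (line l) v = 0)
  (sp' : forall l, l != 0%R -> exists2 v, v != 0%R & push s' (line l) v = 0)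
  (nc : forall l : E, l != 0%R -> exists2 v, v != 0%R & ~~ colin l v).

Lemma push_const (b : nat) v : v != 0%R -> push s (fun=> b) v = d * b.
Proof. by move=> v0; rewrite /push big_const_seq count_predT iter_addn_0 sd // mulnC. Qed.

Lemma push_const' (b : nat) v : v != 0%R -> push s' (fun=> b) v = d' * b.
Proof. by move=> v0; rewrite /push big_const_seq count_predT iter_addn_0 sd' // mulnC. Qed.

(** Apply [push s], which recovers [r] up to a constant. *)
Lemma push'_const_inv r (b : nat) : is_norm r ->
  (forall v, v != 0%R -> push s' r v = b) ->
  forall x y, x != 0%R -> y != 0%R -> r x = r y.
Proof.
move=> rn rb x y x0 y0; have := s's rn x0 y0.
rewrite (push_ext (q := fun=> b) x0 s0 rb) (push_ext (q := fun=> b) y0 s0 rb).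
by rewrite !push_const //; lia.
Qed.

Lemma line0 l v : ~~ colin l v -> line l v = 0.
Proof. by rewrite /line => /negbTE ->. Qed.

Lemma line1 l v : colin l v -> line l v = 1.
Proof. by rewrite /line => ->. Qed.

(** If [r v > r l], then the sum takes the value [r l] at [l + v], which is
    less than its values at [l] and at [v]. *)
Lemma line_add_max l r : l != 0%R -> is_norm r -> is_norm (fun v => line l v + r v) ->
  forall v, v != 0%R -> r v <= r l.
Proof.
move=> l0 rn lrn v v0; rewrite leqNgt; apply/negP => lt.
have nlv : ~~ colin l v.
  by apply/negP => /(norm_colin rn) e; rewrite e ltnn in lt.
have [lv0 e] := norm_add_lt rn l0 v0 lt.
have := lrn.2 _ _ l0 v0 lv0; rewrite (line1 (colin_refl l)) (line0 nlv) e line0; first lia.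
apply: contra nlv => h; have := @colinD l (l + v)%R (- l)%R.
rewrite addrAC subrr add0r; apply=> //.
by apply/colinP; exists (-1)%R; rewrite ?oppr_eq0 ?oner_neq0 // scaleN1r.
Qed.

(** The image [u] of a line has as its top layer [W] a subspace that the inverse
    sends back to the line [l] up to a constant; the images of two independent
    vectors of [W] would add up to too much at [l]. *)
Lemma push_line l : l != 0%R -> exists2 y, y != 0%R &
  forall v, v != 0%R -> push s (line l) v = line y v.
Proof.
move=> l0; set u := push s (line l); have un : is_norm u by exact/sn/norm_line.
have [y y0 ymax] := norm_max u l0.
(* [u = W + Q], where [W] is the indicator of the set of maximal points. *)
pose W v := (u y <= u v : nat); have Wn : is_norm W by exact: norm_thr.
pose Q v := minn (u v) (u y).-1; have Qn : is_norm Q by exact: norm_minn.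
have [v1 v10 uv1] := sp l0; have [w w0 nlw] := nc l0.
have uW v : v != 0%R -> 0 < u y -> u v = W v + Q v.
  by move=> v0; have := ymax _ v0; rewrite /W /Q; lia.
have pu x z : x != 0%R -> z != 0%R -> push s' u x + line l z = push s' u z + line l x.
  by move=> x0 z0; exact: ss' (norm_line l) _ _ x0 z0.
have uy : 0 < u y.
  rewrite lt0n; apply/eqP => uy0; have u0 v : v != 0%R -> u v = 0.
    by move=> v0; have := ymax _ v0; lia.
  have := pu _ _ l0 w0; rewrite !(push_ext (q := fun=> 0) _ s0' u0) //.
  by rewrite !push_const' // (line0 nlw) (line1 (colin_refl l)); lia.
have pWn : is_norm (push s' W) by exact: sn'.
(* At the common minimum [x] neither summand can be larger than elsewhere, so
off [l] both are constant, and exactly one of them rises by 1 on [l]. *)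
have [x x0 xmin] := common_min pWn (sn' Qn) l0.
have pWQ v : v != 0%R -> push s' u v = push s' W v + push s' Q v.
  by move=> v0; rewrite -pushD; apply: push_ext => // z z0; exact: uW z0 uy.
have nlx : line l x = 0.
  apply: line0; apply/negP => lx; have := pu _ _ x0 w0; have [] := xmin _ w0.
  by rewrite !pWQ // line0 // line1 //; lia.
have pW v : v != 0%R -> push s' W v = push s' W x + line l v.
  move=> v0.
  have H z : z != 0%R -> push s' W z + push s' Q z = push s' W x + push s' Q x + line l z.
    by move=> z0; rewrite -!pWQ //; have := pu _ _ z0 x0; rewrite nlx; clear; lia.
  have [nlv|lv] := boolP (colin l v); last first.
    by have := H _ v0; have := xmin _ v0; rewrite (line0 lv); clear; lia.
  (* If the rise came from [Q], then [push s' W] and hence [W] would be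
  constant; but [W] vanishes at [v1]. *)
  have [e|ne] := eqVneq (push s' W v) (push s' W x); last first.
    by move: ne; have := H _ v0; have := xmin _ v0; rewrite (line1 nlv); clear; lia.
  have WE z : z != 0%R -> push s' W z = push s' W x.
    move=> z0; have [lz|nlz] := boolP (colin l z).
      have vz : colin v z by rewrite -(colin_eq _ nlv).
      by rewrite (norm_colin pWn vz).
    by have := H _ z0; have := xmin _ z0; rewrite (line0 nlz); clear; lia.
  have := push'_const_inv Wn WE y0 v10; rewrite /W leqnn; move: uy uv1.
  by rewrite -/u => uy ->; rewrite leqNgt uy.
(* [W + line z] is a norm, and so is its image, the line of [l] plus
[push s' (line z)] up to a constant. *)
have wmax z v : z != 0%R -> W z = 1 -> v != 0%R ->
    push s' (line z) v <= push s' (line z) l.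
  move=> z0 Wz; have uz : u z = u y by have := ymax _ z0; move: Wz; rewrite /W; lia.
  apply: line_add_max => //; first exact/sn'/norm_line.
  apply: (@norm_shift (push s' W x)).
  have : is_norm (push s' (fun v => W v + line z v)).
    apply/sn'; rewrite /W -uz; apply: norm_thr_line => // v' v'0.
    by rewrite uz; exact: ymax.
  by move/norm_ext; apply=> v' v'0; rewrite pushD (pW v' v'0) addnA.
(* Otherwise [push s' (line z)] would be constant. *)
have wlt z v : z != 0%R -> W z = 1 -> v != 0%R ->
    (forall v', v' != 0%R -> push s' (line z) v <= push s' (line z) v') ->
    push s' (line z) v < push s' (line z) l.
  move=> z0 Wz v0 vmin; rewrite ltn_neqAle wmax // andbT; apply/eqP => e.
  have zE v' : v' != 0%R -> push s' (line z) v' = push s' (line z) l.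
    by move=> v'0; have := vmin _ v'0; have := wmax z v' z0 Wz v'0; rewrite e; clear; lia.
  have [v' v'0 nzv'] := nc z0.
  have := push'_const_inv (norm_line z) zE z0 v'0.
  by rewrite line1 ?colin_refl // line0.
have Wy : W y = 1 by rewrite /W leqnn.
have Wline z : z != 0%R -> W z = line y z.
  move=> z0; have [yz|nyz] := boolP (colin y z).
    by rewrite line1 // -Wy; exact: norm_colin.
  rewrite line0 //; apply/eqP; apply: contraT => Wz.
  have {}Wz : W z = 1 by move: Wz; rewrite /W; case: (_ <= _).
  have yn := sn' (norm_line y); have zn := sn' (norm_line z).
  have [v v0 vmin] := common_min yn zn l0.
  have lty := wlt _ _ y0 Wy v0 (fun a a0 => (vmin a a0).1).
  have ltz := wlt _ _ z0 Wz v0 (fun a a0 => (vmin a a0).2).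
  have nlv : ~~ colin l v by apply/negP => /(norm_colin yn) e; rewrite e ltnn in lty.
  (* Suppose that [W] contains the independent vectors [y] and [z]. Their images
  have a common minimum [v]. From [v] to [l] the image of the sum of all [line a]
  rises by [q - 1], but the multiples of [y] and of [z] raise it by at least
  [2 (q - 1)]. *)
  pose P a := (a != 0%R) && (W a == 1).
  have sumW b : b != 0%R ->
      \sum_(a | P a) push s' (line a) b = #|[pred c : k | c != 0%R]| * push s' W b.
    move=> b0; rewrite /push exchange_big big_distrr /= big_seq [RHS]big_seq.
    by apply: eq_bigr => m mb; apply: sum_line Wn _ (s0' b0 mb) => a; exact: leq_b1.
  have := sumW _ l0; rewrite (pW _ l0) (line1 (colin_refl l)).
  have := sumW _ v0; rewrite (pW _ v0) (line0 nlv) addn0 addn1 mulnS => <-.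
  have : \sum_(a | P a) (push s' (line a) v + (line y a + line z a)) <=
         \sum_(a | P a) push s' (line a) l.
    apply: leq_sum => a /andP [a0 /eqP Wa].
    have [ya|nya] := boolP (colin y a).
      rewrite (line1 ya) line0; last by apply: contra nyz => za; rewrite (colin_trans ya) // colin_sym.
      by rewrite addn0 addn1 -!(push_line_colin _ _ ya).
    rewrite (line0 nya); have [za|nza] := boolP (colin z a).
      by rewrite (line1 za) add0n addn1 -!(push_line_colin _ _ za).
    by rewrite (line0 nza) !addn0; exact: wmax a0 Wa v0.
  have k0 : 0 < #|[pred c : k | c != 0%R]|.
    by apply/card_gt0P; exists 1%R; rewrite inE oner_neq0.
  rewrite big_split big_split /=.
  rewrite (sum_line_colin Wn y0 Wy) (sum_line_colin Wn z0 Wz) => h e.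
  by move: k0 h e; clear; lia.
have wl v : v != 0%R -> push s' (line y) v = push s' W x + line l v.
  by move=> v0; rewrite -pW //; apply: push_ext => // z z0; rewrite Wline.
(* The constant is 0, since [push s' (line y)] vanishes somewhere. *)
have wl' v : v != 0%R -> push s' (line y) v = line l v.
  move=> v0; have [v2 v20 e] := sp' y0; have := wl _ v20; rewrite e wl //; clear; lia.
have uE v : v != 0%R -> u v + line y v1 = line y v.
  move=> v0; have := s's (norm_line y) v0 v10.
  by rewrite !(push_ext (q := line l) _ s0 wl') // uv1 -/(u v); clear; lia.
exists y => // v v0.
have [v2 v20 nyv2] := nc y0.
have := uE _ v0; have := uE _ v20; rewrite (line0 nyv2) -/(u v); clear; lia.
Qed.

(** Each factor [m] of the form at [v] contributes to [push s (line m)], which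
    is the line through [v]. So two factors have lines with equal images, are
    collinear, and both are counted in a value that is 1. *)
Lemma rigid v : 0 < d -> v != 0%R -> size (s v) = 1.
Proof.
move=> d0 v0; have := sd v0; case e : (s v) => [|m t]; first by move=> dE; rewrite -dE in d0.
move=> _; have mv : m \in s v by rewrite e mem_head.
have m0 := s0 v0 mv; have [y y0 yE] := push_line m0.
have H m' : m' \in s v -> colin m m'.
  move=> m'v; have m'0 := s0 v0 m'v; have [y' y'0 yE'] := push_line m'0.
  have L z x : z \in s v -> (forall v, v != 0%R -> push s (line z) v = line x v) -> colin x v.
    move=> zv /(_ _ v0); rewrite /push (big_rem z) //= (line1 (colin_refl z)) /line.
    by case: (colin x v).
  have yv := L _ _ mv yE; have y'v := L _ _ m'v yE'.
  have yy' x : line y x = line y' x.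
    by rewrite /line (colin_eq _ yv) (colin_eq _ y'v).
  have E x : x != 0%R -> push s (line m) x = push s (line m') x.
    by move=> x0; rewrite yE // yE' // yy'.
  have := ss' (norm_line m) m0 m'0; have := ss' (norm_line m') m0 m'0.
  rewrite !(push_ext (r := push s (line m)) _ s0' E) //.
  rewrite (line1 (colin_refl m)) (line1 (colin_refl m')) /line.
  by case: (colin m m') => //; case: (colin m' m); clear; lia.
have := yE _ v0; rewrite /push e big_cons (line1 (colin_refl m)).
case: t e => [//|m' t] e; rewrite big_cons.
have : colin m m' by apply: H; rewrite e !inE eqxx orbT.
by move/line1 => ->; rewrite /line; case: (colin y v).
Qed.
End Rigid.

End Norms.

(** * Linear forms and the weight of a norm *)

Section LinearForms.
Variables (k K : fieldType) (n : nat) (iota : {rmorphism k -> K}).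
Local Notation S := {mpoly K[n]}.
Implicit Types (u v : 'rV[k]_n).

Definition linform v : S := \sum_(i < n) iota (v 0 i) *: 'X_i.
(* Row vectors over [k] are used as coordinates of the vectors of [V]. *)
Local Notation lf := linform.

Lemma lfD u v : lf (u + v) = lf u + lf v.
Proof.
by rewrite -big_split; apply: eq_bigr => i _; rewrite mxE rmorphD scalerDl.
Qed.

Lemma lfZ c v : lf (c *: v) = iota c *: lf v.
Proof.
by rewrite scaler_sumr; apply: eq_bigr => i _; rewrite mxE rmorphM scalerA.
Qed.

Lemma lf_delta i : lf (delta_mx 0 i) = 'X_i.
Proof.
rewrite /linform (bigD1 i) //= mxE !eqxx rmorph1 scale1r big1 ?addr0 // => j ji.
by rewrite mxE eqxx (negbTE ji) rmorph0 scale0r.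
Qed.

Lemma delta_neq0 i : delta_mx 0 i != 0 :> 'rV[k]_n.
Proof. by apply/eqP => /rowP /(_ i) /eqP; rewrite !mxE !eqxx oner_eq0. Qed.

Lemma lf_homog v : lf v \is 1.-homog.
Proof.
by apply: rpred_sum => i _; apply: rpredZ; exact: var_homog.
Qed.

Lemma mcoeff_lin (a : 'I_n -> K) i : (\sum_(j < n) a j *: 'X_j : S)@_U_(i) = a i.
Proof.
rewrite raddf_sum /= (bigD1 i) //= mcoeffZ mcoeffX eqxx mulr1 big1 ?addr0 // => j ji.
rewrite mcoeffZ mcoeffX; case: eqP => [/(congr1 (fun m : 'X_{1..n} => m i))|]; last by rewrite mulr0.
by rewrite !mnm1E eqxx (negbTE ji).
Qed.

Lemma lf_eq0 v : (lf v == 0) = (v == 0).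
Proof.
apply/eqP/eqP => [v0|->]; last by apply: big1 => i _; rewrite mxE rmorph0 scale0r.
apply/rowP => i; rewrite mxE; apply: (fmorph_inj iota).
by rewrite -(mcoeff_lin (fun i => iota (v 0 i))) -/(linform v) v0 mcoeff0 rmorph0.
Qed.

Lemma lf_prime v : v != 0 -> prime_elt (lf v).
Proof. by move=> v0; apply: homog1_prime; [exact: lf_homog|rewrite lf_eq0]. Qed.
End LinearForms.

Section AdaptedBasis.
Variables (k : finFieldType) (n : nat) (r : 'rV[k]_n -> nat).
Hypothesis rn : is_norm r.

Lemma norm_sum_ge (I : Type) (s : seq I) (P : pred I) (F : I -> 'rV[k]_n) t :
  (forall i, P i -> F i != 0 -> (t <= r (F i))%N) ->
  \sum_(i <- s | P i) F i != 0 -> (t <= r (\sum_(i <- s | P i) F i))%N.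
Proof.
move=> h; elim/big_rec: _ => [|i x Pi IH]; first by rewrite eqxx.
have [->|Fi0] := eqVneq (F i) 0; first by rewrite add0r.
have [->|x0] := eqVneq x 0; first by rewrite addr0 => _; exact: h.
move=> ix; apply: leq_trans (rn.2 _ _ Fi0 x0 ix).
by rewrite leq_min h // IH.
Qed.

(** A basis with the largest sum of norms works: if a vector [v] had a larger
    norm than a basis vector that occurs in it, replacing the latter by [v]
    would increase the sum. *)
Lemma adapted_basis : exists2 B : 'M[k]_n, B \in unitmx &
  forall v, v != 0 ->
    (forall j, (v *m invmx B) 0 j != 0 -> (r v <= r (row j B))%N) /\
    exists2 j, (v *m invmx B) 0 j != 0 & r v = r (row j B).
Proof.
case: (@arg_maxnP _ (1%:M : 'M[k]_n) (fun B => B \in unitmx)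
  (fun B => \sum_j r (row j B))%N) => [|B Bu Bmax]; first exact: unitmx1.
exists B => // v v0; set a := v *m invmx B.
have vE : v = \sum_j a 0 j *: row j B by rewrite -mulmx_sum_row mulmxKV.
have le j : a 0 j != 0 -> (r v <= r (row j B))%N.
  move=> aj; rewrite leqNgt; apply/negP => lt.
  pose B' := \matrix_i (if i == j then v else row i B).
  have rowB' i : row i B' = if i == j then v else row i B by rewrite rowK.
  have B'u : B' \in unitmx.
    rewrite -row_full_unit -sub1mx; apply: submx_trans (_ : (B <= B')%MS).
      by rewrite sub1mx row_full_unit.
    apply/row_subP => i; have [->|ij] := eqVneq i j; last first.
      by rewrite (_ : row i B = row i B') ?row_sub // rowB' (negbTE ij).
    have -> : row j B = (a 0 j)^-1 *: (v - \sum_(i < n | i != j) a 0 i *: row i B).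
      by rewrite {1}vE (bigD1 j) //= addrK scalerA mulVf // scale1r.
    apply: scalemx_sub; apply: addmx_sub.
      by rewrite (_ : v = row j B') ?row_sub // rowB' eqxx.
    rewrite eqmx_opp; apply: summx_sub => i' i'j; apply: scalemx_sub.
    by rewrite (_ : row i' B = row i' B') ?row_sub // rowB' (negbTE i'j).
  have := Bmax _ B'u; rewrite /= (bigD1 j) // [X in (_ <= X)%N](bigD1 j) //= rowB' eqxx.
  rewrite [X in (_ + X <= _)%N](eq_bigr (fun i => r (row i B))); first by rewrite leq_add2r leqNgt lt.
  by move=> i ij; rewrite rowB' (negbTE ij).
split=> //; apply: contrapT => nex.
have lt : (r v < r v)%N; last by rewrite ltnn in lt.
rewrite [X in (_ < r X)%N]vE; apply: norm_sum_ge; last by rewrite -vE.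
move=> j _; rewrite scaler_eq0 negb_or => /andP [aj _]; rewrite rn.1 // ltn_neqAle le //.
by rewrite andbT; apply/eqP => e; apply: nex; exists j.
Qed.
End AdaptedBasis.

Section Weights.
Variables (k : finFieldType) (K : fieldType) (n : nat) (iota : {rmorphism k -> K}).
Local Notation S := {mpoly K[n]}.
Local Notation lf := (linform iota).

(** The degree in [t], for polynomials whose coefficients are polynomials in
    the [X_i]. *)
Definition wdeg (p : {poly S}) := (size p).-1.

Lemma wdegM (p q : {poly S}) : p != 0 -> q != 0 -> wdeg (p * q) = (wdeg p + wdeg q)%N.
Proof.
move=> p0 q0; rewrite /wdeg size_mul //.
by move: p0 q0; rewrite -!size_poly_gt0; case: (size p) (size q) => [|x] [|y]; lia.
Qed.

Lemma wdegD (p q : {poly S}) : (wdeg (p + q)%R <= maxn (wdeg p) (wdeg q))%N.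
Proof. by rewrite /wdeg; have := size_polyD p q; lia. Qed.

(** In the coordinates of an adapted basis [b], multiply the [j]-th coordinate
    form by [t^(C - r b_j)]. Then the degree in [t] of the image of a linear
    form is [C] minus the least [r b_j] that occurs, which is its norm. The
    constant [C] only keeps exponents natural. *)
Lemma norm_weight (r : 'rV[k]_n -> nat) : is_norm r ->
  exists (w : {rmorphism S -> {poly S}}) (C : nat),
    (forall c, w c%:MP = c%:MP%:P) /\
    forall v, v != 0 -> w (lf v) != 0 /\ (wdeg (w (lf v)) + r v = C)%N.
Proof.
move=> rn; have [B Bu BP] := adapted_basis rn.
pose C := (\sum_j r (row j B))%N.
pose w : {rmorphism S -> {poly S}} := mmap (polyC \o @mpolyC n K)
  (fun i => \sum_j (iota (invmx B i j) *: 'X_j) *: 'X^(C - r (row j B))).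
exists w, C; split=> [c|v v0]; first by rewrite /w /= mmapC.
have [le [j0 aj0 rv]] := BP v v0; set a := v *m invmx B in le aj0.
have wE : w (lf v) = \sum_j (iota (a 0 j) *: 'X_j) *: 'X^(C - r (row j B)).
  rewrite /linform (rmorph_sum w).
  transitivity (\sum_(i < n) \sum_j (iota (v 0 i * invmx B i j) *: 'X_j : S) *: 'X^(C - r (row j B))).
    apply: eq_bigr => i _; rewrite -mul_mpolyC (rmorphM w) /w /= mmapC mmapX mmap1U.
    rewrite mul_polyC scaler_sumr; apply: eq_bigr => j _.
    by rewrite scalerA mul_mpolyC scalerA -rmorphM.
  rewrite exchange_big; apply: eq_bigr => j _.
  by rewrite -scaler_suml -scaler_suml -rmorph_sum /a mxE.
have rC j : (r (row j B) <= C)%N by rewrite /C (bigD1 j) //= leq_addr.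
(* No cancellation: the forms [X_j] of distinct [j] are independent. *)
have c0 : (w (lf v))`_(C - r v) != 0.
  rewrite wE coef_sum; apply/eqP => /(congr1 (mcoeff U_(j0)%MM)) /eqP.
  rewrite (eq_bigr (fun j => ((C - r v == C - r (row j B))%N%:R * iota (a 0 j)) *: 'X_j)).
    by rewrite mcoeff_lin rv eqxx mul1r mcoeff0 fmorph_eq0 (negbTE aj0).
  by move=> j _; rewrite coefZ coefXn; case: eqP => _; rewrite ?mulr1 ?mul1r // mul0r mulr0 scale0r.
have w0 : w (lf v) != 0 by apply: contraNneq c0 => ->; rewrite coef0.
split=> //; have rvC : (r v <= C)%N by rewrite rv.
suff -> : wdeg (w (lf v)) = (C - r v)%N by rewrite subnK.
apply/eqP; rewrite eqn_leq; apply/andP; split; last first.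
  rewrite /wdeg; have : (C - r v < size (w (lf v)))%N; last lia.
  by rewrite ltnNge; apply: contra c0 => /(nth_default 0) ->.
suff : (size (w (lf v)) <= (C - r v).+1)%N by rewrite /wdeg; lia.
rewrite wE; apply: leq_trans (size_sum _ _ _) _; apply/bigmax_leqP => j _.
have [->|aj] := eqVneq (a 0 j) 0; first by rewrite rmorph0 !scale0r size_poly0.
apply: leq_trans (size_scale_leq _ _) _; rewrite size_polyXn ltnS.
exact/leq_sub2l/le.
Qed.

Definition lf_product (F : S) (t : seq 'rV[k]_n) := exists2 c : K, c != 0 &
  F = c *: \prod_(m <- t) lf m.

Lemma wdeg_product (r : 'rV[k]_n -> nat) (w : {rmorphism S -> {poly S}}) C F t :
  (forall c, w c%:MP = c%:MP%:P) ->
  (forall v, v != 0 -> w (lf v) != 0 /\ (wdeg (w (lf v)) + r v = C)%N) ->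
  (forall m, m \in t -> m != 0) -> lf_product F t ->
  w F != 0 /\ (wdeg (w F) + \sum_(m <- t) r m = size t * C)%N.
Proof.
move=> wC wr t0 [c c0 ->].
have -> : w (c *: \prod_(m <- t) lf m) = c%:MP%:P * \prod_(m <- t) w (lf m).
  by rewrite -mul_mpolyC (rmorphM w) wC rmorph_prod.
have cc : c%:MP%:P != 0 :> {poly S} by rewrite polyC_eq0 mpolyC_eq0.
suff [p0 e] : \prod_(m <- t) w (lf m) != 0 /\
    (wdeg (\prod_(m <- t) w (lf m)) + \sum_(m <- t) r m = size t * C)%N.
  rewrite mulf_neq0 // wdegM // -addnA e {1}/wdeg size_polyC -(mpolyC_eq0 n) in c0 *.
  by split=> //; case: (_ != 0); lia.
elim: t t0 => [|m t IH] t0; first by rewrite !big_nil oner_neq0 /wdeg size_poly1.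
have [m0 e0] := wr m (t0 m (mem_head _ _)).
have [|t1 e1] := IH _; first by move=> m' m't; apply: t0; rewrite in_cons m't orbT.
by rewrite !big_cons mulf_neq0 // wdegM // mulSn -e1 -e0 addnACA.
Qed.

Variables (F : 'rV[k]_n -> S) (s : 'rV[k]_n -> seq 'rV[k]_n) (d : nat).
Hypotheses (FD : forall u v, F (u + v) = F u + F v)
  (FZ : forall c v, F (c *: v) = iota c *: F v)
  (Fs : forall v, v != 0 -> lf_product (F v) (s v))
  (s0 : forall x m, x != 0 -> m \in s x -> m != 0)
  (sd : forall x, x != 0 -> size (s x) = d).

(** The degree of the image of [F v] is [d C - push s r v], and degrees satisfy
    [deg (f + g) <= max (deg f) (deg g)]. *)
Lemma push_norm r : is_norm r -> is_norm (push s r).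
Proof.
move=> rn; have [w [C [wC wr]]] := norm_weight rn.
have H v : v != 0 -> (wdeg (w (F v)) + push s r v = d * C)%N.
  move=> v0; rewrite -(sd v0).
  by have [] := wdeg_product wC wr (fun m => @s0 v m v0) (Fs v0).
split=> [c v c0|u v u0 v0 uv].
  have [->|v0] := eqVneq v 0; first by rewrite scaler0.
  have cv : c *: v != 0 by rewrite scaler_eq0 negb_or c0.
  have := H _ cv; have := H _ v0; rewrite FZ -mul_mpolyC (rmorphM w) wC.
  have ic : iota c%R != 0 by rewrite fmorph_eq0.
  by rewrite /wdeg mul_polyC size_scale ?mpolyC_eq0 // => <- /addnI.
have wD : (wdeg (w (F (u + v)%R)) <= maxn (wdeg (w (F u))) (wdeg (w (F v))))%N.
  by rewrite FD (rmorphD w); exact: wdegD.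
by have := H _ uv; have := H _ v0; have := H _ u0; lia.
Qed.

(** The weight of [push s r] is realized by [w \o phi]. Compute the degree of
    [w (phi (G v))] once through the factors of [G v] and once as the degree
    of [w (D * lf v)]. *)
Lemma push_comp (phi : {rmorphism S -> S}) (G : 'rV[k]_n -> S) s' d' (D : S) :
  (forall v, phi (lf v) = F v) -> (forall c, phi c%:MP = c%:MP) ->
  (forall v, v != 0 -> lf_product (G v) (s' v)) ->
  (forall x m, x != 0 -> m \in s' x -> m != 0) ->
  (forall x, x != 0 -> size (s' x) = d') ->
  (forall v, phi (G v) = D * lf v) ->
  forall r, is_norm r -> forall x y, x != 0 -> y != 0 ->
    (push s' (push s r) x + r y = push s' (push s r) y + r x)%N.
Proof.
move=> pF pC Gs s0' sd' pG r rn; have [w [C [wC wr]]] := norm_weight rn.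
have wr' v : v != 0 -> w (phi (lf v)) != 0 /\ (wdeg (w (phi (lf v))) + push s r v = d * C)%N.
  move=> v0; rewrite pF -(sd v0).
  exact: wdeg_product wC wr (fun m => @s0 v m v0) (Fs v0).
suff H v : v != 0 -> (wdeg (w D) + C + push s' (push s r) v = d' * (d * C) + r v)%N.
  by move=> x y x0 y0; have := H x x0; have := H y y0; lia.
move=> v0.
have [|w0 e] := @wdeg_product (push s r) [the {rmorphism _ -> _} of w \o phi] (d * C)
  (G v) (s' v) _ wr' (fun m => @s0' v m v0) (Gs v v0).
  by move=> c /=; rewrite pC.
move: w0 e; rewrite /= pG (rmorphM w) sd' // -/(push s' (push s r) v) mulf_eq0 negb_or => /andP [w0 w1].
by rewrite wdegM //; have [_] := wr v v0; lia.
Qed.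
End Weights.

(** * Morphisms of locally ringed spaces *)

Section Morphisms.

Lemma pull_congr (X Y : lrSpace) (f g : lrMor X Y) (e : f = g) (U : opens Y)
  (s : sec U) (W : opens X) (hf : sval W `<=` f @^-1` sval U)
  (hg : sval W `<=` g @^-1` sval U) :
  @res _ (preim_open (lr_open f) U) W hf (pull f U s) =
  @res _ (preim_open (lr_open g) U) W hg (pull g U s).
Proof. by case: _ / e hg => hg; exact: res_irr. Qed.

Lemma kMor_comp (k : comPzRingType) (X Y Z : kSpace k) (f : lrMor Y Z) (g : lrMor X Y) :
  is_kMor f -> is_kMor g -> @is_kMor k X Z (lr_comp f g).
Proof. by move=> kf kg U c /=; rewrite kf kg. Qed.

(** Constants are pulled back to constants by [f]; pull this back once more
    by [g]. *)
Lemma kMor_inv (k : comPzRingType) (X Y : kSpace k) (f : lrMor X Y) (g : lrMor Y X) :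
  is_kMor f -> lr_comp f g = lr_id Y -> lr_comp g f = lr_id X -> is_kMor g.
Proof.
move=> kf fg gf U c; pose P := preim_open (lr_open g) U; pose Q := preim_open (lr_open f) P.
have gfE x : g (f x) = x by exact: (congr1 (fun h : lrMor X X => h x) gf).
have fgE x : f (g x) = x by exact: (congr1 (fun h : lrMor Y Y => h x) fg).
have hUQ : sval U `<=` sval Q by move=> x Ux; rewrite /Q /= gfE.
have hQU : sval Q `<=` sval U by move=> x; rewrite /Q /= gfE.
have h' : sval P `<=` sval (preim_open (lr_open g) Q) by move=> x Px; exact: hUQ.
rewrite -(kstr_res hUQ c) -(pull_res hUQ h') -kf.
have hid : sval P `<=` lr_id Y @^-1` sval P by [].
have := @pull_congr _ _ (lr_comp f g) _ fg P (kstr P c) P h' hid.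
by rewrite /= /lr_id_pull resE kstr_res.
Qed.

(** Sections over an open subset of [U] are sections of [Y] over its image, so
    pulling back by a morphism to [U] can be computed in [Y]. *)
Lemma pull_incl (X Y : lrSpace) (U : opens Y) (f : lrMor X (osub U))
  (P : opens (osub U)) (s : @sec (osub U) P) (W : opens X)
  (h1 : sval W `<=` f @^-1` sval P)
  (h2 : sval W `<=` lr_comp (osub_incl U) f @^-1` sval (img P)) :
  @res _ (preim_open (lr_open f) P) W h1 (pull f P s) =
  @res _ (preim_open (lr_open (lr_comp (osub_incl U) f)) (img P)) W h2
    (pull (lr_comp (osub_incl U) f) (img P) s).
Proof.
pose P' := preim_open (lr_open (osub_incl U)) (img P).
have h : sval P' `<=` sval P.
  by move=> y [z Pz] /= zy; rewrite -(val_inj zy).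
have h' : sval (preim_open (lr_open f) P') `<=` sval (preim_open (lr_open f) P).
  by move=> y; exact: h.
transitivity (@res _ (preim_open (lr_open f) P') W h2 (pull f P' (res h s))).
  by rewrite -(pull_res h h') resE; exact: res_irr.
congr (res _ (pull f P' _)).
exact: (@res_irr Y (img P) (img P') (img_sub h) (@osub_incl_sub Y U (img P)) s).
Qed.

Lemma osub_incl_mono (X Y : lrSpace) (U : opens Y) (f g : lrMor X (osub U)) :
  lr_comp (osub_incl U) f = lr_comp (osub_incl U) g -> f = g.
Proof.
move=> e; have pt x : f x = g x.
  by apply: val_inj; exact: (congr1 (fun h : lrMor X Y => h x) e).
apply: lrMor_ext => // P s W hf hg.
have h1 : sval W `<=` lr_comp (osub_incl U) f @^-1` sval (img P).
  by move=> x /hf Px; exists (f x).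
have h2 : sval W `<=` lr_comp (osub_incl U) g @^-1` sval (img P).
  by move=> x /hg Px; exists (g x).
by rewrite (pull_incl s hf h1) (pull_incl s hg h2); exact: pull_congr.
Qed.

Lemma restrict_incl (X Y : lrSpace) (f : lrMor X Y) (U : opens X) (V : opens Y)
  (fUV : sval U `<=` f @^-1` sval V) :
  lr_comp (osub_incl V) (lr_restrict fUV) = lr_comp f (osub_incl U).
Proof.
apply: lrMor_ext => // O s W hf hg /=; rewrite !resE.
have hh : sval (preim_open (lr_open f) (img (preim_open (lr_open (osub_incl V)) O))) `<=`
  sval (preim_open (lr_open f) O) by move=> x [y Oy] /= <-.
by rewrite -(pull_res (@osub_incl_sub _ V O) hh) !resE; exact: res_irr.
Qed.

Lemma osub_incl_kMor (k : comPzRingType) (X : kSpace k) (U : opens X) :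
  @is_kMor k (osub_k U) X (osub_incl U).
Proof. by move=> V c; exact: (kstr_res (@osub_incl_sub X U V) c). Qed.

Lemma restrict_kMor (k : comPzRingType) (X Y : kSpace k) (f : lrMor X Y) (U : opens X) (V : opens Y)
  (fUV : sval U `<=` f @^-1` sval V) :
  is_kMor f -> @is_kMor k (osub_k U) (osub_k V) (lr_restrict fUV).
Proof. by move=> fk W c /=; rewrite fk kstr_res. Qed.
End Morphisms.

(** * Points and sections of Proj *)

Section Points.
Variables (K : fieldType) (n : nat).
Local Notation S := {mpoly K[n]}.
Implicit Types (x y : projPt K n) (f g a b : S).

Lemma projPt_sum x (I : Type) (r : seq I) (P : pred I) (F : I -> S) :
  (forall i, P i -> x (F i)) -> x (\sum_(i <- r | P i) F i).
Proof.
move=> h; apply: (big_ind (fun f => x f)) => //; first exact: projPt_0 (pt_ideal_proj x).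
by move=> f g; exact: projPt_D (pt_ideal_proj x) f g.
Qed.

Lemma projPt_mulr x f g : x f -> x (f * g).
Proof. by rewrite mulrC; exact: projPt_M (pt_ideal_proj x) g f. Qed.

Lemma projPt_nexp x f d : ~ x f -> ~ x (f ^+ d).
Proof.
move=> xf; elim: d => [|d IH]; first exact: projPt_1 (pt_ideal_proj _).
by rewrite exprS; exact: projPt_nM.
Qed.

Lemma projPt_homog_ext x y :
  (forall d f, f \is d.-homog -> x f <-> y f) -> x = y.
Proof.
move=> h; apply: projPt_ext => f; rewrite [f](pihomog_partitionE (leqnn (msize f))).
have H (z z' : projPt K n) : (forall d f, f \is d.-homog -> z f -> z' f) ->
    forall f, z f -> z' (\sum_(d < msize f) pihomog mdeg d f).
  move=> zz g zg; apply: projPt_sum => d _; apply: zz (pihomogP _ _ _) _.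
  exact: projPt_homog (pt_ideal_proj z) d g zg.
rewrite -[X in x X](pihomog_partitionE (leqnn (msize f))).
rewrite -[X in _ <-> y X](pihomog_partitionE (leqnn (msize f))).
by split=> /H hf; rewrite [f](pihomog_partitionE (leqnn (msize f))); apply: hf => d g /h [].
Qed.

Lemma projPt_var x : exists i, ~ x 'X_i.
Proof.
have [d [f [d0 fd xf]]] := projPt_irrelevant (pt_ideal_proj x).
apply: contrapT => nex; apply: xf; rewrite [f]mpolyE big_seq.
apply: projPt_sum => m mf; rewrite -mul_mpolyC mulrC; apply: projPt_mulr.
have [i mi] : exists i, (0 < m i)%N.
  apply: contrapT => nm; have dE : mdeg m = d by exact: dhomogP _ _ _ fd m mf.
  suff m0 : m = 0%MM by rewrite -dE m0 mdeg0 in d0.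
  apply/mnmP => i; rewrite mnm0E; apply/eqP; rewrite -leqn0 leqNgt; apply/negP => mi.
  by apply: nm; exists i.
rewrite mpolyXE_id (bigD1 i) //=; apply: projPt_mulr.
rewrite -(prednK mi) exprS; apply: projPt_mulr.
by apply: contrapT => xi; apply: nex; exists i.
Qed.

(** The generic point. *)
Lemma zero_is_projPt : (0 < n)%N -> is_projPt (fun f : S => f = 0).
Proof.
move=> n0; split=> //.
- by move=> f g -> ->; rewrite addr0.
- by move=> f g ->; rewrite mulr0.
- by apply/eqP; exact: oner_neq0.
- by move=> f g /eqP; rewrite mulf_eq0 => /orP [] /eqP; [left|right].
- by move=> d f ->; rewrite pihomog0.
- exists 1%N, 'X_(Ordinal n0); split=> //; first exact: var_homog.
  by have [/eqP] := var_prime K (Ordinal n0).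
Qed.

Lemma projPt_dim x : (0 < n)%N.
Proof. by have [i _] := projPt_var x; exact: leq_ltn_trans (ltn_ord i). Qed.

Definition generic_pt x : projPt K n := ProjPt (zero_is_projPt (projPt_dim x)).

(** Opens are unions of complements of zero sets of forms, and 0 is contained
    in every ideal. *)
Lemma generic_open x y (U : set (projPt K n)) : open U -> U x -> U (generic_pt y).
Proof.
move/zariskiP => h /h [f [_ xf fU]]; apply: fU => /= f0; apply: xf; rewrite f0.
exact: projPt_0 (pt_ideal_proj x).
Qed.

(** A germ at [x] is an element of the fraction field. *)
Definition ev (U : opens (proj K n)) x (Ux : sval U x) (s : @sec (proj K n) U) :
  {fraction S} := (s : projSec U) (exist _ x (mem_set Ux)).

Section Ev.
Variables (U : opens (proj K n)) (x : projPt K n) (Ux : sval U x).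

Lemma ev_zmod : zmod_morphism (ev Ux). Proof. by []. Qed.
Lemma ev_monoid : monoid_morphism (ev Ux). Proof. by []. Qed.
HB.instance Definition _ := GRing.isZmodMorphism.Build _ _ (ev Ux) ev_zmod.
HB.instance Definition _ := GRing.isMonoidMorphism.Build _ _ (ev Ux) ev_monoid.

Lemma ev_rep (s : @sec (proj K n) U) : exists (d : nat) (a b : S),
  [/\ a \is d.-homog, b \is d.-homog, ~ x b & ev Ux s = tofrac a / tofrac b].
Proof.
have /asboolP /(_ (exist _ x (mem_set Ux))) := projSec_section s.
move=> [W [oW Wx] [d [a [b [ha hb sab]]]]].
by exists d, a, b; have [] := sab _ Wx.
Qed.

Lemma evM (s t : @sec (proj K n) U) : ev Ux (s * t) = ev Ux s * ev Ux t.
Proof. by []. Qed.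

Lemma ev1 : ev Ux 1 = 1. Proof. by []. Qed.

End Ev.

(** A section is given by one fraction near [x], and this neighbourhood contains
    the generic point. *)
Lemma ev_const (U : opens (proj K n)) x y (Ux : sval U x) (Uy : sval U y)
  (s : @sec (proj K n) U) : ev Ux s = ev Uy s.
Proof.
have oU : open (sval U) by exact: proj2_sig.
have Ug := generic_open x oU Ux.
suff H z (Uz : sval U z) : ev Uz s = ev Ug s by rewrite (H x) (H y).
have /asboolP /(_ (exist _ z (mem_set Uz))) := projSec_section s.
move=> [W [oW Wz] [d [a [b [ha hb sab]]]]].
have Wg := generic_open x oW Wz.
have [_ e1] := sab _ Wz; have [_ e2] := sab (exist _ (generic_pt x) (mem_set Ug)) Wg.
by rewrite /ev e1 e2.
Qed.

Lemma ev_res (U V : opens (proj K n)) x (Ux : sval U x) (Vx : sval V x)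
  (h : sval V `<=` sval U) (s : @sec (proj K n) U) : ev Vx (res h s) = ev Ux s.
Proof. by rewrite /ev /=; congr (projSec_fun s _); exact: set_type_inj. Qed.

Lemma sec_ext (U : opens (proj K n)) (s t : @sec (proj K n) U) :
  (forall x (Ux : sval U x), ev Ux s = ev Ux t) -> s = t.
Proof.
move=> h; apply: projSec_ext => x; have := h _ (set_valP x).
by rewrite /ev (_ : exist _ _ _ = x) //; exact: set_type_inj.
Qed.

Lemma cst_section (U : opens (proj K n)) d (a b : S) : a \is d.-homog -> b \is d.-homog ->
  (forall x : projPt K n, sval U x -> ~ x b) ->
  (fun=> tofrac a / tofrac b) \in @section_pred K n U.
Proof.
move=> ha hb Ub; apply/asboolP => x; exists setT; first by split=> //; exact: openT.
by exists d, a, b; split=> // y _; split=> //; apply: Ub; exact: set_valP.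
Qed.

Lemma frac_mem x (a b c e : S) : ~ x b -> ~ x e ->
  tofrac a / tofrac b = tofrac c / tofrac e -> x a -> x c.
Proof.
move=> xb xe /eqP; rewrite eqr_div; [|exact: frac_neq0 xb|exact: frac_neq0 xe].
rewrite -!tofracM tofrac_eq => /eqP e1 xa.
have := projPt_mulr e xa; rewrite e1.
by case/(projPt_prime (pt_ideal_proj x)).
Qed.

(** If [a] vanishes at [x], a fraction that is defined at [x] cannot be an
    inverse of [a / b]; otherwise [b / a] is one near [x]. *)
Lemma germ_unit_ev (U : opens (proj K n)) x (Ux : sval U x) s d a b :
  a \is d.-homog -> b \is d.-homog -> ~ x b -> ev Ux s = tofrac a / tofrac b ->
  @germ_unit (proj K n) x U s <-> ~ x a.
Proof.
move=> ha hb xb e; split.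
  case=> W [h [Wx [t st]]] xa; have := congr1 (ev Wx) st.
  rewrite evM (ev_res Ux) e ev1.
  have [d' [c [c' [_ _ xc ->]]]] := ev_rep Wx t.
  rewrite mulf_div -!tofracM -[1]divr1 -tofrac1 => e1.
  apply: (projPt_1 (pt_ideal_proj x)); apply: (frac_mem _ _ e1).
  - exact: projPt_nM.
  - exact: projPt_1 (pt_ideal_proj x).
  - exact: projPt_mulr.
move=> xa; pose D : set (projPt K n) := [set y | ~ y b].
have oD : open D by apply/zariskiP => y yb; exists b; split=> //; exists d.
apply: (proj_germ_unit (W := D) (d := d) (a := a) (b := b)) => // y Dy; split=> //.
rewrite -e; transitivity (ev (set_valP y) s); last exact: ev_const.
by rewrite /ev; congr (projSec_fun s _); exact: set_type_inj.
Qed.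

End Points.

Section OpenPoints.
Variables (K : fieldType) (n : nat) (U : opens (proj K n)).
Local Notation S := {mpoly K[n]}.
Local Notation X := (osub_k U).
Implicit Types (x y : osub U).

Definition opt x : projPt K n := set_val x.

Lemma optP x : sval U (opt x). Proof. exact: set_valP. Qed.

Lemma opt_inj : injective opt. Proof. exact: val_inj. Qed.

Lemma img_pt (W : opens (osub U)) x : sval W x -> sval (img W) (opt x).
Proof. by exists x. Qed.

Definition evo (W : opens (osub U)) x (Wx : sval W x) (s : @sec (osub U) W) :
  {fraction S} := ev (img_pt Wx) s.

Section Evo.
Variables (W : opens (osub U)) (x : osub U) (Wx : sval W x).

Lemma evoM (s t : @sec (osub U) W) : evo Wx (s * t) = evo Wx s * evo Wx t.
Proof. by []. Qed.
Lemma evo_zmod : zmod_morphism (evo Wx). Proof. by []. Qed.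
Lemma evo_monoid : monoid_morphism (evo Wx). Proof. by []. Qed.
HB.instance Definition _ := GRing.isZmodMorphism.Build _ _ (evo Wx) evo_zmod.
HB.instance Definition _ := GRing.isMonoidMorphism.Build _ _ (evo Wx) evo_monoid.

Lemma evo_rep (s : @sec (osub U) W) : exists (d : nat) (a b : S),
  [/\ a \is d.-homog, b \is d.-homog, ~ opt x b & evo Wx s = tofrac a / tofrac b].
Proof. exact: ev_rep. Qed.

Lemma evo_kstr (c : K) : evo Wx (@kstr K X W c) = tofrac c%:MP.
Proof. by []. Qed.
End Evo.

Lemma evo_const (W : opens (osub U)) x y (Wx : sval W x) (Wy : sval W y)
  (s : @sec (osub U) W) : evo Wx s = evo Wy s.
Proof. exact: ev_const. Qed.

Lemma evo_res (V W : opens (osub U)) x (Vx : sval V x) (Wx : sval W x)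
  (h : sval W `<=` sval V) (s : @sec (osub U) V) : evo Wx (res h s) = evo Vx s.
Proof. exact: ev_res. Qed.

Lemma evo_ext (W : opens (osub U)) (s t : @sec (osub U) W) :
  (forall x (Wx : sval W x), evo Wx s = evo Wx t) -> s = t.
Proof.
move=> h; apply: sec_ext => p Wp; have [x Wx xp] := Wp.
have Wx' := img_pt Wx; have e := h x Wx.
case: _ / xp in Wp *; transitivity (evo Wx s); first exact: ev_const.
by rewrite e; exact: ev_const.
Qed.

Lemma germ_unit_evo (W : opens (osub U)) x (Wx : sval W x) s d a b :
  a \is d.-homog -> b \is d.-homog -> ~ opt x b -> evo Wx s = tofrac a / tofrac b ->
  @germ_unit (osub U) x W s <-> ~ opt x a.
Proof.
move=> ha hb xb e; rewrite -(germ_unit_ev ha hb xb e); split; last exact: osub_germ.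
by case=> V [h [Vx [t st]]]; exists (img V), (img_sub h); split; [exists x|exists t].
Qed.

Lemma osub_generic x : exists g : osub U, forall f, opt g f <-> f = 0.
Proof.
have Ug := generic_open (opt x) (proj2_sig U) (optP x).
by exists (exist _ (generic_pt (opt x)) (mem_set Ug)).
Qed.

(** The generic point lies in every nonempty open subset. *)
Lemma osub_open_generic x g (W : set (osub U)) : (forall f, opt g f <-> f = 0) ->
  open W -> W x -> W g.
Proof.
move=> gE oW Wx; pose W' : opens (osub U) := exist _ _ oW.
have oI : open (sval (img W')) by exact: proj2_sig.
have := generic_open (opt x) oI (img_pt (W := W') Wx).
case=> y Wy yE; suff -> : g = y by [].
apply: opt_inj; apply: projPt_ext => f; rewrite gE -[opt y]/(set_val y) yE; done.
Qed.
End OpenPoints.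

(** * Morphisms to projective space given by forms *)

Section GivenBy.
Variables (K : fieldType) (n m : nat) (U : opens (proj K n)).
Local Notation S := {mpoly K[n]}.
Local Notation T := {mpoly K[m]}.

(** The substitution is packed behind an opaque existence proof, so that
    unification never expands it into sums over monomials. *)
Lemma psubst_subproof (F : 'I_m -> S) :
  {phi : {rmorphism T -> S} | forall a, phi a = mmap (@mpolyC n K) F a}.
Proof. by exists (mmap (@mpolyC n K) F). Qed.

Definition psubst F : {rmorphism T -> S} := sval (psubst_subproof F).

Lemma psubstE F a : psubst F a = mmap (@mpolyC n K) F a.
Proof. exact: (svalP (psubst_subproof F)). Qed.

Lemma psubstC F c : psubst F c%:MP = c%:MP. Proof. by rewrite psubstE; exact: mmapC. Qed.
Lemma psubstX F i : psubst F 'X_i = F i. Proof. by rewrite psubstE [LHS]mmapX mmap1U. Qed.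

Lemma psubst_homog F e d (a : T) : (forall i, F i \is e.-homog) -> a \is d.-homog ->
  psubst F a \is (e * d).-homog.
Proof.
move=> Fe /dhomogP ha; rewrite psubstE /= /mmap big_seq; apply: rpred_sum => i ia.
rewrite mul_mpolyC; apply: rpredZ; have <- : mdeg i = d by exact: ha.
rewrite mdegE big_distrr /= /mmap1.
apply: (@big_rec2 _ _ (fun (p : S) l => p \is l.-homog)); first exact: dhomog1.
by move=> j p l _ pl; apply: dhomogM pl; exact: dhomogMn.
Qed.

(** Evaluation in a commutative ring that may be zero, as rings of sections
    are. It commutes with restriction, with pull-back and with passage to
    the fraction field. *)
Definition mev (R : comPzRingType) (c : K -> R) (h : 'I_m -> R) (a : T) : R :=
  \sum_(i <- msupp a) c a@_i * \prod_j h j ^+ i j.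

Lemma rmorph_mev (R R' : comPzRingType) (g : {rmorphism R -> R'}) c h a :
  g (mev c h a) = mev (g \o c) (g \o h) a.
Proof.
rewrite /mev rmorph_sum; apply: eq_bigr => i _; rewrite rmorphM rmorph_prod.
by congr (_ * _); apply: eq_bigr => j _; rewrite rmorphXn.
Qed.

Lemma mev_ext (R : comPzRingType) (c c' : K -> R) (h h' : 'I_m -> R) a :
  (forall x, c x = c' x) -> (forall i, h i = h' i) -> mev c h a = mev c' h' a.
Proof.
move=> cc hh; apply: eq_bigr => i _; rewrite cc; congr (_ * _).
by apply: eq_bigr => j _; rewrite hh.
Qed.

(** Substituting [F_i / t] in a form [a] of degree [d] gives [a(F) / t^d]. *)
Lemma mev_frac (F : 'I_m -> S) (t : {fraction S}) d (a : T) : t != 0 -> a \is d.-homog ->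
  mev (fun c => tofrac (c%:MP : S)) (fun i => tofrac (F i) / t) a = tofrac (psubst F a) / t ^+ d.
Proof.
move=> t0 /dhomogP ha; rewrite psubstE /= /mmap raddf_sum mulr_suml /mev !big_seq.
apply: eq_bigr => i ia /=; rewrite rmorphM /= -mulrA; congr (_ * _).
have <- : mdeg i = d by exact: ha.
rewrite /mmap1 mdegE -prodrXr rmorph_prod -prodf_div; apply: eq_bigr => j _.
by rewrite rmorphXn /= expr_div_n.
Qed.

(** In terms of points, [f] sends [x] to the ideal of all [a] with [a(F)] in
    [x]; on sections, it is the substitution of [F] in fractions. The tuple may
    have common factors as long as these do not vanish on [U]. *)
Definition given_by (f : lrMor (osub U) (proj K m)) (F : 'I_m -> S) :=
  [/\ exists e, forall i, F i \is e.-homog,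
      forall x d a, a \is d.-homog -> (f x : projPt K m) a <-> opt x (psubst F a) &
      forall x (O : opens (proj K m)) (Ox : sval O (f x)) (s : @sec (proj K m) O) d a b,
        a \is d.-homog -> b \is d.-homog -> ~ (f x : projPt K m) b ->
        ev Ox s = tofrac a / tofrac b ->
        @evo _ _ _ (preim_open (lr_open f) O) x Ox (pull f O s) =
          tofrac (psubst F a) / tofrac (psubst F b)].
End GivenBy.

Section Pullback.
Variables (K : fieldType) (n m : nat) (U : opens (proj K n)).
Local Notation S := {mpoly K[n]}.
Local Notation T := {mpoly K[m]}.
Variable f : lrMor (osub U) (proj K m).
Hypothesis fk : @is_kMor K (osub_k U) (proj K m) f.

Lemma psubst_id (a : T) : psubst (fun i => 'X_i) a = a.
Proof.
by apply: (@rmor_mpoly_ext _ _ _ _ [the {rmorphism _ -> _} of idfun]) => [c|i];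
  rewrite ?psubstC ?psubstX.
Qed.

Lemma Dvar_open (l : 'I_m) : open [set y : projPt K m | ~ y 'X_l].
Proof.
by apply/zariskiP => y yl; exists 'X_l; split=> //; exists 1%N; exact: var_homog.
Qed.

Definition Dvar (l : 'I_m) : opens (proj K m) := exist _ _ (Dvar_open l).

(** The regular function [X_i / X_l] on the set where [X_l] does not vanish. *)
Definition coord_sec (l i : 'I_m) : @sec (proj K m) (Dvar l) :=
  ProjSec (cst_section (var_homog K i) (var_homog K l) (fun x (Ux : sval (Dvar l) x) => Ux)).

Lemma ev_coord l i y (Dy : sval (Dvar l) y) :
  ev Dy (coord_sec l i) = tofrac ('X_i : T) / tofrac ('X_l : T).
Proof. by []. Qed.

Lemma ev_mev_coord l d (a : T) y (Dy : sval (Dvar l) y) : a \is d.-homog ->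
  ev Dy (mev (kstr (Dvar l)) (coord_sec l) a) = tofrac a / tofrac ('X_l : T) ^+ d.
Proof.
move=> ha; transitivity (mev (fun c => tofrac (c%:MP : T))
  (fun i => tofrac ('X_i : T) / tofrac ('X_l : T)) a).
  exact: (rmorph_mev [the {rmorphism _ -> _} of ev Dy]).
by rewrite (mev_frac _ _ ha) ?psubst_id //; exact: frac_neq0 Dy.
Qed.

Local Notation pre := (preim_open (lr_open f)).

Lemma evo_pull_res (O V : opens (proj K m)) x (Ox : sval O (f x)) (Vx : sval V (f x))
  (h : sval V `<=` sval O) s :
  @evo _ _ _ (pre V) x Vx (pull f V (res h s)) = @evo _ _ _ (pre O) x Ox (pull f O s).
Proof.
have h' : sval (pre V) `<=` sval (pre O) by move=> y; exact: h.
rewrite -(pull_res h h') (evo_res (V := pre O) Ox); done.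
Qed.

Lemma evo_pull_mev (O : opens (proj K m)) x (Ox : sval O (f x)) (h : 'I_m -> sec O) a :
  @evo _ _ _ (pre O) x Ox (pull f O (mev (kstr O) h a)) =
  mev (fun c => tofrac (c%:MP : S)) (fun i => @evo _ _ _ (pre O) x Ox (pull f O (h i))) a.
Proof.
rewrite (rmorph_mev (pull f O)).
transitivity (mev (@evo _ _ _ (pre O) x Ox \o (pull f O \o kstr O))
  (@evo _ _ _ (pre O) x Ox \o (pull f O \o h)) a).
  exact: (rmorph_mev [the {rmorphism _ -> _} of @evo _ _ _ (pre O) x Ox]).
by apply: mev_ext => // c /=; rewrite fk evo_kstr.
Qed.

Lemma common_denominator (x : projPt K n) (I : finType) (z : I -> {fraction S}) :
  (forall i, exists d a b, [/\ a \is d.-homog, b \is d.-homog, ~ x b &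
     z i = tofrac (a : S) / tofrac b]) ->
  exists d (a : I -> S) b, [/\ forall i, a i \is d.-homog, b \is d.-homog, ~ x b &
     forall i, z i = tofrac (a i) / tofrac b].
Proof.
move=> h; have {}h i : exists t : nat * S * S, [/\ t.1.2 \is t.1.1.-homog,
    t.2 \is t.1.1.-homog, ~ x t.2 & z i = tofrac t.1.2 / tofrac t.2].
  by have [d [a [b]]] := h i; exists (d, a, b).
have [t tP] := choice h.
have th (P : pred I) : \prod_(i | P i) (t i).2 \is (\sum_(i | P i) (t i).1.1).-homog.
  apply: (big_rec2 (fun (p : S) e => p \is e.-homog)); first exact: dhomog1.
  by move=> i e p _ ph; apply: dhomogM ph; have [] := tP i.
exists (\sum_i (t i).1.1)%N, (fun i => (t i).1.2 * \prod_(l | l != i) (t l).2),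
  (\prod_i (t i).2); split=> //.
- move=> i; have [ha _ _ _] := tP i; rewrite [d in d.-homog](bigD1 i) //=.
  exact: dhomogM ha (th (fun l => l != i)).
- apply: (big_ind (fun p : S => ~ x p)); first exact: projPt_1 (pt_ideal_proj x).
    by move=> a b; exact: projPt_nM.
  by move=> i _; have [] := tP i.
- move=> i; rewrite [X in _ / tofrac X](bigD1 i) //= !tofracM -mulf_div divff ?mulr1; last first.
    rewrite tofrac_eq0; apply/prodf_neq0 => l _.
    by rewrite -tofrac_eq0; apply: (frac_neq0 (p := x)); have [] := tP l.
  by have [] := tP i.
Qed.

Lemma germ_unit_pull (O : opens (proj K m)) x (Ox : sval O (f x)) s :
  @germ_unit (osub U) x (pre O) (pull f O s) <-> @germ_unit (proj K m) (f x) O s.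
Proof.
split; first exact: pull_local.
case=> W [h [Wx [t st]]].
have h' : sval (pre W) `<=` sval (pre O) by move=> y; exact: h.
exists (pre W), h'; split=> //; exists (pull f W t).
by rewrite (pull_res h h') -rmorphM st rmorph1.
Qed.

Section Construction.
Variables (g : osub U) (j : 'I_m) (z : 'I_m -> {fraction S}).
(* The coordinates [z i] of the image of the generic point [g], normalized by
[z j = 1]. *)
Hypotheses (gE : forall h, opt g h <-> h = 0) (gj : ~ (f g : projPt K m) 'X_j)
  (zP : forall i, z i = @evo _ _ _ (pre (Dvar j)) g gj (pull f (Dvar j) (coord_sec j i))).

(** The relation [X_i / X_l * X_l / X_j = X_i / X_j] is pulled back to the
    generic point. *)
Lemma coord_change x l (xl : ~ (f x : projPt K m) 'X_l) i :
  @evo _ _ _ (pre (Dvar l)) x xl (pull f (Dvar l) (coord_sec l i)) * z l = z i.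
Proof.
have gl : sval (pre (Dvar l)) g.
  by apply: (osub_open_generic gE _ (x := x) xl); exact: proj2_sig.
rewrite (evo_const _ (gl : sval (pre (Dvar l)) g)) {xl x}.
have oV : open (sval (Dvar l) `&` sval (Dvar j)).
  by apply: openI; exact: proj2_sig.
pose V : opens (proj K m) := exist _ _ oV.
have Vg : sval V (f g) by split.
have hl : sval V `<=` sval (Dvar l) by move=> y [].
have hj : sval V `<=` sval (Dvar j) by move=> y [].
rewrite !zP -(evo_pull_res gl Vg hl) -!(evo_pull_res (gj : sval (Dvar j) (f g)) Vg hj).
rewrite -evoM -rmorphM; congr (evo _ (pull f V _)).
apply: sec_ext => y Vy; have [yl yj] := Vy.
rewrite evM (ev_res (yl : sval (Dvar l) y)) !(ev_res (yj : sval (Dvar j) y)) !ev_coord.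
rewrite mulrA divfK //; exact: frac_neq0 yl.
Qed.

Lemma coord_self : z j = 1.
Proof.
rewrite zP (_ : coord_sec j j = 1) ?rmorph1 //.
apply: sec_ext => y Dy; rewrite ev_coord ev1 divff //; exact: frac_neq0 Dy.
Qed.

(** Clear denominators and remove the common factor. Homogeneity survives,
    because the factors of a form are forms. *)
Lemma coord_tuple : exists F : 'I_m -> S, [/\ exists e, forall i, F i \is e.-homog,
  primitive F, F j != 0 & forall i, z i = tofrac (F i) / tofrac (F j)].
Proof.
have [d [A [B [Ah Bh gB zE]]]] := common_denominator (fun i =>
  evo_rep (gj : sval (pre (Dvar j)) g) (pull f (Dvar j) (coord_sec j i))).
have B0 : B != 0 by apply/eqP => B0; apply: gB; apply/gE.
have Aj : A j = B.
  have := zE j; rewrite -zP coord_self => /esym /divr1_eq /eqP.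
  by rewrite tofrac_eq => /eqP.
have Aj0 : A j != 0 by rewrite Aj.
have [G [F [G0 AE Fp]]] := primitive_part (@mpoly_factorial K n) Aj0.
have Fj0 : F j != 0 by apply: contraNneq Aj0 => Fj0; rewrite AE Fj0 mulr0.
exists F; split=> //.
  have [e1 [_ [Ge1 _ _]]] := homog_factor (Ah j) Aj0 (AE j).
  exists (d - e1)%N => i; have [->|Fi0] := eqVneq (F i) 0; first exact: rpred0.
  have Ai0 : A i != 0 by rewrite AE mulf_neq0.
  have [e1' [e2 [Ge1' Fe2 ->]]] := homog_factor (Ah i) Ai0 (AE i).
  by rewrite (dhomog_uniq G0 Ge1 Ge1') addKn.
move=> i; rewrite zP zE -Aj !AE !tofracM -mulf_div divff ?mul1r //.
by rewrite tofrac_eq0.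
Qed.

(** The point to check is that the [F i] have no common zero on [U]: if [X_l]
    does not vanish at [f x], the functions [F i / F l] are regular at [x], so
    [F l] divides their common denominator, because [F] is primitive
    ([primitive_mul]). The rest follows by expressing forms through coordinate
    functions. *)
Lemma coord_given_by F : (exists e, forall i, F i \is e.-homog) ->
  primitive F -> F j != 0 -> (forall i, z i = tofrac (F i) / tofrac (F j)) -> given_by f F.
Proof.
move=> [e Fh] Fp Fj0 zE.
have wE x l (xl : ~ (f x : projPt K m) 'X_l) : F l != 0 /\ forall i,
    @evo _ _ _ (pre (Dvar l)) x xl (pull f (Dvar l) (coord_sec l i)) = tofrac (F i) / tofrac (F l).
  have tj : tofrac (F j) != 0 by rewrite tofrac_eq0.
  have Fl0 : F l != 0.
    apply/eqP => Fl0; have := coord_change xl j; rewrite coord_self zE Fl0.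
    by rewrite tofrac0 mul0r mulr0 => /esym /eqP; rewrite oner_eq0.
  have tl : tofrac (F l) != 0 by rewrite tofrac_eq0.
  split; first exact: Fl0.
  move=> i.
  have zl0 : z l != 0.
    rewrite zE.
    exact: (mulf_neq0 tl (invr_neq0 tj)).
  apply: (mulIf zl0).
  rewrite (coord_change xl i).
  rewrite (zE i) (zE l).
  rewrite mulrA.
  by rewrite (divfK tl).
have xF x l : ~ (f x : projPt K m) 'X_l -> ~ opt x (F l).
  move=> xl; have [Fl0 w] := wE x l xl.
  have [d [A [B [Ah Bh xB AE]]]] := common_denominator (fun i =>
    evo_rep (xl : sval (pre (Dvar l)) x) (pull f (Dvar l) (coord_sec l i))).
  have [c Bc] : dvd (F l) B.
    apply: (primitive_mul (@mpoly_factorial K n) Fp) => // i.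
    have /eqP := AE i; rewrite w eqr_div ?tofrac_eq0 //; last first.
      by rewrite -tofrac_eq0; exact: frac_neq0 xB.
    by rewrite -!tofracM tofrac_eq => /eqP e1; exists (A i); rewrite mulrC e1 mulrC.
  by move=> xl'; apply: xB; rewrite Bc; exact: projPt_mulr.
have mevE x l (xl : ~ (f x : projPt K m) 'X_l) d a : a \is d.-homog ->
    @evo _ _ _ (pre (Dvar l)) x xl (pull f (Dvar l) (mev (kstr (Dvar l)) (coord_sec l) a)) =
    tofrac (psubst F a) / tofrac (F l ^+ d).
  move=> ha; have [Fl0 w] := wE x l xl.
  rewrite evo_pull_mev rmorphXn -(mev_frac _ _ ha) ?tofrac_eq0 //.
  exact: mev_ext.
have Xl_d (x : osub U) l d : ~ (f x : projPt K m) 'X_l -> ~ (f x : projPt K m) ('X_l ^+ d).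
  exact: projPt_nexp.
have Fl_d (x : osub U) l d : ~ (f x : projPt K m) 'X_l -> ~ opt x (F l ^+ d).
  by move=> /xF; exact: projPt_nexp.
have pts x d a : a \is d.-homog -> (f x : projPt K m) a <-> opt x (psubst F a).
  move=> ha; have [l xl] := projPt_var (f x : projPt K m).
  have h1 := germ_unit_ev (Ux := xl : sval (Dvar l) (f x)) ha _ (Xl_d x l d xl).
  have h2 := germ_unit_evo (Wx := xl : sval (pre (Dvar l)) x) (psubst_homog Fh ha)
    (dhomogMn d (Fh l)) (Fl_d x l d xl) (mevE x l xl d a ha).
  have := germ_unit_pull (xl : sval (Dvar l) (f x)) (mev (kstr (Dvar l)) (coord_sec l) a).
  rewrite h2 h1; first by move=> [i1 i2]; split=> h; apply: contrapT; tauto.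
    by have := dhomogMn d (var_homog K l); rewrite mul1n.
  by rewrite rmorphXn; exact: ev_mev_coord.
split=> //; first by exists e.
move=> x O Ox s d a b ha hb xb sE.
have [l xl] := projPt_var (f x : projPt K m).
have oV : open (sval O `&` sval (Dvar l)) by apply: openI; exact: proj2_sig.
pose V : opens (proj K m) := exist _ _ oV.
have Vx : sval V (f x) by split.
have hO : sval V `<=` sval O by move=> y [].
have hl : sval V `<=` sval (Dvar l) by move=> y [].
have tb : tofrac b != 0 by exact: frac_neq0 xb.
pose M := mev (kstr (Dvar l)) (coord_sec l).
(* [M a] is the function [a / X_l ^ d]. The identity [s * M b = M a] of
functions near [f x] is pulled back to [x]. *)
have eq1 : res hO s * res hl (M b) = res hl (M a).
  apply: sec_ext => y Vy; have [yO yl] := Vy.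
  rewrite evM (ev_res yO) !(ev_res (yl : sval (Dvar l) y)) (ev_const _ Ox) sE.
  by rewrite (ev_mev_coord _ ha) (ev_mev_coord _ hb) mulrA divfK.
have := congr1 (fun t => @evo _ _ _ (pre V) x Vx (pull f V t)) eq1.
rewrite rmorphM evoM (evo_pull_res Ox) !(evo_pull_res (xl : sval (Dvar l) (f x))).
rewrite (mevE x l xl d a ha) (mevE x l xl d b hb).
have tF : tofrac (F l ^+ d) != 0 by exact: frac_neq0 (Fl_d x l d xl).
have tcb : tofrac (psubst F b) != 0.
  by apply: (@frac_neq0 _ _ (opt x)); rewrite -(pts x d b hb).
by rewrite mulrA => /(mulIf (invr_neq0 tF)) <-; rewrite mulfK.
Qed.
End Construction.

(** Since [U] contains [x0], it contains the generic point, and a primitive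
    tuple that describes the image of the generic point describes [f]. *)
Lemma given_by_ex (x0 : osub U) : exists F : 'I_m -> S, given_by f F /\ primitive F.
Proof.
have [g gE] := osub_generic x0; have [j gj] := projPt_var (f g : projPt K m).
have zP i := erefl (@evo _ _ _ (pre (Dvar j)) g gj (pull f (Dvar j) (coord_sec j i))).
have [F [Fh Fp Fj Fz]] := coord_tuple gE zP.
by exists F; split=> //; exact: (coord_given_by gE zP Fh Fp Fj Fz).
Qed.
End Pullback.

(** * Uniqueness and composition of tuples *)

Lemma tofrac_div_eq (R : idomainType) (a b c d : R) : b != 0 -> d != 0 ->
  tofrac a / tofrac b = tofrac c / tofrac d <-> a * d = c * b.
Proof.
move=> b0 d0; have tb : tofrac b != 0 by rewrite tofrac_eq0.
have td : tofrac d != 0 by rewrite tofrac_eq0.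
split=> [/eqP|e]; last apply/eqP; rewrite (eqr_div _ _ tb td) -!tofracM.
  by rewrite tofrac_eq => /eqP.
by rewrite e.
Qed.

Lemma cross_cancel (R : idomainType) (x x' y y' c c' : R) : c != 0 -> c' != 0 ->
  x * c = x' * c' -> y * c = y' * c' -> x * y' = x' * y.
Proof.
move=> c0 c0' ex ey; apply: (mulIf (mulf_neq0 c0 c0')).
by rewrite mulrACA ex -ey; ring.
Qed.

Section Uniqueness.
Variables (K : fieldType) (n m : nat) (U : opens (proj K n)).
Local Notation S := {mpoly K[n]}.
Local Notation T := {mpoly K[m]}.

Definition proportional (F F' : 'I_m -> S) := forall i j, F i * F' j = F j * F' i.

(** The value of the form [a] at [F / F l] depends only on the ratios of the [F i]. *)
Lemma psubst_prop (F F' : 'I_m -> S) l d (a : T) : proportional F F' -> F l != 0 ->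
  F' l != 0 -> a \is d.-homog -> psubst F a * F' l ^+ d = psubst F' a * F l ^+ d.
Proof.
move=> FF' Fl F'l ha.
have tl : tofrac (F l) != 0 by rewrite tofrac_eq0.
have tl' : tofrac (F' l) != 0 by rewrite tofrac_eq0.
apply/(tofrac_div_eq _ _ (expf_neq0 d Fl) (expf_neq0 d F'l)).
rewrite (tofracXn d (F l)) (tofracXn d (F' l)).
rewrite -(mev_frac F tl ha) -(mev_frac F' tl' ha); apply: mev_ext; first by [].
by move=> i; apply/(tofrac_div_eq _ _ Fl F'l); rewrite FF' mulrC.
Qed.

Lemma given_by_nvar (f : lrMor (osub U) (proj K m)) F x l :
  given_by f F -> ~ (f x : projPt K m) 'X_l <-> ~ opt x (F l).
Proof.
by case=> _ h _; rewrite (h x 1%N 'X_l) ?psubstX //; exact: var_homog.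
Qed.

(** At each point a coordinate that does not vanish for [F] nor for [F']
    provides factors by which [a(F)] and [a(F')] agree. *)
Lemma given_by_uniq (f f' : lrMor (osub U) (proj K m)) F F' :
  given_by f F -> given_by f' F' -> proportional F F' -> f = f'.
Proof.
move=> fF fF' FF'.
have F0 (x : osub U) : exists l, ~ opt x (F l) /\ ~ opt x (F' l).
  have [l /(given_by_nvar _ _ fF) xl] := projPt_var (f x : projPt K m).
  have [l' /(given_by_nvar _ _ fF') xl'] := projPt_var (f' x : projPt K m).
  exists l; split=> // xl2; have := projPt_nM xl xl'; rewrite FF'; apply.
  exact: projPt_M (pt_ideal_proj _) _ _ xl2.
have nz (x : osub U) a : ~ opt x a -> a != 0.
  by move=> xa; apply/eqP => a0; apply: xa; rewrite a0; exact: projPt_0 (pt_ideal_proj _).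
have C (x : osub U) d : exists c c', [/\ ~ opt x c, ~ opt x c' &
    forall a, a \is d.-homog -> psubst F a * c = psubst F' a * c'].
  have [l [xl xl']] := F0 x; exists (F' l ^+ d), (F l ^+ d).
  split; [exact: projPt_nexp|exact: projPt_nexp|].
  by move=> a; apply: psubst_prop => //; [exact: nz xl|exact: nz xl'].
have [_ h hs] := fF; have [_ h' hs'] := fF'.
have pt x : f x = f' x.
  apply: projPt_homog_ext => d a ha; rewrite (h x d a ha) (h' x d a ha).
  have [c [c' [xc xc' /(_ a ha) e]]] := C x d.
  split=> /projPt_mulr.
    by move/(_ c); rewrite e => /(projPt_prime (pt_ideal_proj _)) [].
  by move/(_ c'); rewrite -e => /(projPt_prime (pt_ideal_proj _)) [].
apply: (@lrMor_ext (osub U) (proj K m)) => // O s W hf hg.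
apply: evo_ext => x Wx; have Ox := hf x Wx; have Ox' := hg x Wx.
rewrite (evo_res (V := preim_open (lr_open f) O) Ox) (evo_res (V := preim_open (lr_open f') O) Ox').
have [d [a [b [ha hb xb e]]]] := ev_rep (Ox : sval O (f x)) s.
rewrite (hs x O Ox s d a b ha hb xb e).
have xb' : ~ (f' x : projPt K m) b by rewrite -pt.
have e' : ev (Ox' : sval O (f' x)) s = tofrac a / tofrac b by rewrite -e; exact: ev_const.
rewrite (hs' x O Ox' s d a b ha hb xb' e').
have [c [c' [xc xc' H]]] := C x d.
have Fb : psubst F b != 0 by apply: (nz x); rewrite -(h x d b hb).
have F'b : psubst F' b != 0 by apply: (nz x); rewrite -(h' x d b hb).
have c0 := nz _ _ xc; have c0' := nz _ _ xc'.
apply/(tofrac_div_eq _ _ Fb F'b).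
exact: cross_cancel c0 c0' (H a ha) (H b hb).
Qed.

(** Compare the pull-backs of the functions [X_i / X_l] at one point. *)
Lemma given_by_prop (f : lrMor (osub U) (proj K m)) F F' (x : osub U) :
  given_by f F -> given_by f F' -> proportional F F'.
Proof.
move=> fF fF'; have [l xl] := projPt_var (f x : projPt K m).
have [_ _ h] := fF; have [_ _ h'] := fF'.
have nz a : ~ opt x a -> a != 0.
  by move=> xa; apply/eqP => a0; apply: xa; rewrite a0; exact: projPt_0 (pt_ideal_proj _).
have Fl := nz _ ((given_by_nvar x l fF).1 xl).
have Fl' := nz _ ((given_by_nvar x l fF').1 xl).
have e i : F i * F' l = F' i * F l.
  apply/(tofrac_div_eq _ _ Fl Fl').
  have ei := ev_coord i (xl : sval (Dvar K l) (f x)).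
  have := h x (Dvar K l) xl _ _ _ _ (var_homog K i) (var_homog K l) xl ei.
  rewrite (h' x (Dvar K l) xl _ _ _ _ (var_homog K i) (var_homog K l) xl ei).
  by rewrite (psubstX F i) (psubstX F l) (psubstX F' i) (psubstX F' l) => E; exact: esym E.
by move=> i j; rewrite [RHS]mulrC; exact: cross_cancel Fl' Fl (e i) (e j).
Qed.
End Uniqueness.

Section Composition.
Variables (K : fieldType).

Lemma psubst_comp n m p (F : 'I_m -> {mpoly K[n]}) (G : 'I_p -> {mpoly K[m]}) a :
  psubst F (psubst G a) = psubst (fun i => psubst F (G i)) a.
Proof.
apply: (@rmor_mpoly_ext _ _ _ [the {rmorphism _ -> _} of psubst F \o psubst G]) => [c|i] /=.
  by rewrite !psubstC.
by rewrite !psubstX.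
Qed.

Lemma pull_osub_incl n m (U : opens (proj K n)) (U' : opens (proj K m))
  (f : lrMor (osub U) (osub U')) (P : opens (osub U')) (s : @sec (osub U') P)
  x (Px : sval P (f x)) (Px' : sval (img P) (osub_incl U' (f x))) :
  @evo _ _ _ (preim_open (lr_open f) P) x Px (pull f P s) =
  @evo _ _ _ (preim_open (lr_open (lr_comp (osub_incl U') f)) (img P)) x Px'
    (pull (lr_comp (osub_incl U') f) (img P) s).
Proof.
pose W := preim_open (lr_open f) P.
have h1 : sval W `<=` f @^-1` sval P by [].
have h2 : sval W `<=` lr_comp (osub_incl U') f @^-1` sval (img P).
  by move=> y Py; exists (f y).
have := congr1 (evo (Px : sval W x)) (pull_incl s h1 h2).
by rewrite (evo_res (V := W) Px) (evo_res (V := preim_open (lr_open (lr_comp (osub_incl U') f)) (img P)) Px').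
Qed.

Lemma given_by_comp n m p (U : opens (proj K n)) (U' : opens (proj K m))
  (f : lrMor (osub U) (osub U')) (g : lrMor (osub U') (proj K p)) F G :
  given_by (lr_comp (osub_incl U') f) F -> given_by g G ->
  given_by (lr_comp g f) (fun i => psubst F (G i)).
Proof.
move=> [[e Fh] Fp Fs] [[e' Gh] Gp Gs]; split.
- by exists (e * e')%N => i; exact: psubst_homog.
- move=> x d a ha; rewrite -psubst_comp -(Fp x _ _ (psubst_homog Gh ha)).
  exact: Gp (f x) d a ha.
- move=> x O Ox s d a b ha hb xb E; rewrite -!psubst_comp.
  pose P := preim_open (lr_open g) O.
  have Px : sval (img P) (osub_incl U' (f x)) by exists (f x).
  have e1 := Gs (f x) O Ox s d a b ha hb xb E.
  have xb' : ~ opt (f x) (psubst G b) by rewrite -(Gp (f x) d b hb).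
  have E2 : ev (Px : sval (img P) (lr_comp (osub_incl U') f x)) (pull g O s : @sec (proj K m) (img P)) =
      tofrac (psubst G a) / tofrac (psubst G b).
    by rewrite -e1; exact: ev_const.
  have E3 := Fs x (img P) Px (pull g O s) _ _ _ (psubst_homog Gh ha) (psubst_homog Gh hb) xb' E2.
  rewrite -E3.
  exact: (@pull_osub_incl _ _ _ _ f P (pull g O s) x Ox Px).
Qed.

Lemma given_by_incl n (U : opens (proj K n)) : given_by (osub_incl U) (fun i => 'X_i).
Proof.
split; first by exists 1%N => i; exact: var_homog.
  by move=> x d a ha; rewrite psubst_id.
move=> x O Ox s d a b ha hb xb E; rewrite !psubst_id -E.
transitivity (ev (Ox : sval O (osub_incl U x)) s); last by [].
exact: ev_res.
Qed.

Lemma given_by_proj_map n (U : opens (proj K n)) m (t : gradedMor K K m n) :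
  (forall c, t c%:MP = c%:MP) ->
  given_by (lr_comp (proj_map t) (osub_incl U)) (fun i => t 'X_i).
Proof.
move=> tC; have tE a : psubst (fun i => t 'X_i) a = t a.
  by apply: (@rmor_mpoly_ext _ _ _ _ (gm_fun t)) => [c|i]; rewrite ?psubstC ?psubstX ?tC.
split; first by exists 1%N => i; apply: gm_homog; exact: var_homog.
  by move=> x d a ha; rewrite tE.
move=> x O Ox s d a b ha hb xb E; rewrite !tE.
pose V := preim_open (lr_open (proj_map t)) O.
transitivity (ev (Ox : sval V (opt x)) (proj_pull t s)).
  exact: ev_res.
rewrite -(frac_mapE (@gm_inj _ _ _ _ t)); last by have := frac_neq0 xb; rewrite tofrac_eq0.
rewrite -E /ev /=; congr (frac_map _ (projSec_fun s _)); exact: set_type_inj.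
Qed.
End Composition.

(** * Tuples of mutually inverse automorphisms *)

Section AutTuples.
Variables (K : fieldType) (n : nat) (U : opens (proj K n)).
Local Notation S := {mpoly K[n]}.

Lemma empty_uniq (Y : lrSpace) (f g : lrMor (osub U) Y) :
  ~ (exists x : osub U, True) -> f = g.
Proof.
move=> nx; apply: lrMor_ext => [x|O s W hf hg]; first by case: nx; exists x.
by apply: evo_ext => x; case: nx; exists x.
Qed.

(** Proj of a polynomial ring in one variable is a single reduced point, and
    tuples with one entry are always proportional. *)
Lemma small_uniq m (f g : lrMor (osub U) (proj K m)) : (m <= 1)%N ->
  @is_kMor K (osub_k U) (proj K m) f -> @is_kMor K (osub_k U) (proj K m) g -> f = g.
Proof.
move=> m1 fk gk; have [[x _]|] := pselect (exists x : osub U, True); last exact: empty_uniq.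
have [F [fF _]] := given_by_ex fk x; have [G [gG _]] := given_by_ex gk x.
apply: given_by_uniq fF gG _ => i j.
suff -> : i = j by [].
by apply: val_inj; case: i j => [[|i] /= ip] [[|j] /= jp]; lia.
Qed.

Variables (f g : lrMor (osub U) (osub U)).
Hypothesis (gf : lr_comp g f = lr_id (osub U)).

(** The tuples [G(F)] and [X] both give the inclusion, so they are
    proportional; since [X_i] is prime and does not divide [X_j], it divides
    [G_i(F)], and the quotients agree. *)
Lemma comp_tuple (i0 i1 : 'I_n) (x : osub U) F G : i0 != i1 ->
  given_by (lr_comp (osub_incl U) f) F -> given_by (lr_comp (osub_incl U) g) G ->
  exists2 D, D != 0 & forall i, psubst F (G i) = D * 'X_i.
Proof.
move=> i01 fF gG; have := given_by_comp fF gG.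
rewrite -lr_compA gf lr_comp1r => H.
have P := given_by_prop x H (given_by_incl U).
have other (i : 'I_n) : exists j, j != i.
  by have [->|ne] := eqVneq i i0; [exists i1; rewrite eq_sym|exists i0; rewrite eq_sym].
have divX i : {c | psubst F (G i) = 'X_i * c}.
  apply: cid; have [j ji] := other i; have [_ _ pP] := var_prime K i.
  have /pP [//|h] : dvd ('X_i : S) (psubst F (G i) * 'X_j).
    by exists (psubst F (G j)); rewrite P mulrC.
  by case: (var_ndvd _ h); rewrite eq_sym.
have X0 i : ('X_i : S) != 0 by have [] := var_prime K i.
pose D i := sval (divX i); have DE i : psubst F (G i) = 'X_i * D i by exact: (svalP (divX i)).
have DD i j : D i = D j.
  have := P i j; rewrite !DE => e; apply: (mulfI (mulf_neq0 (X0 i) (X0 j))).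
  by rewrite mulrAC e; ring.
exists (D i0); last by move=> i; rewrite DE mulrC (DD i i0).
have [l xl] := projPt_var (osub_incl U x : projPt K n).
have := (given_by_nvar x l H).1 xl; rewrite DE (DD l i0) => h.
by apply/eqP => D0; apply: h; rewrite D0 mulr0; exact: projPt_0 (pt_ideal_proj _).
Qed.
End AutTuples.

Section AutProj.
Variables (K : fieldType) (n : nat).
Local Notation S := {mpoly K[n]}.

Lemma comp_degree (F G : 'I_n -> S) D (i0 : 'I_n) e e' :
  D != 0 -> (forall i, psubst F (G i) = D * 'X_i) ->
  (forall i, F i \is e.-homog) -> (forall i, G i \is e'.-homog) ->
  exists2 d, D \is d.-homog & (e * e' = d.+1)%N.
Proof.
move=> D0 DE Fh Gh.
have Gi : psubst F (G i0) \is (e * e').-homog by exact: psubst_homog.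
have X0 : ('X_i0 : S) != 0 by have [] := var_prime K i0.
have Gi0 : psubst F (G i0) != 0 by rewrite DE mulf_neq0.
have [d [d1 [Dh Xh dE]]] := homog_factor Gi Gi0 (DE i0).
have d11 : d1 = 1%N by apply: (dhomog_uniq X0 Xh); exact: var_homog.
by exists d => //; rewrite dE d11 addn1.
Qed.

(** At the point generated by a prime factor of [D], all [G_i(F)] vanish, so
    its image under [f] would be a common zero of [G]. *)
Lemma proj_degree1 (U : opens (proj K n)) (UT : forall x, sval U x)
  (f g : lrMor (osub U) (osub U)) (i0 i1 : 'I_n) F G D e e' : i0 != i1 ->
  given_by (lr_comp (osub_incl U) f) F -> given_by (lr_comp (osub_incl U) g) G ->
  D != 0 -> (forall i, psubst F (G i) = D * 'X_i) ->
  (forall i, F i \is e.-homog) -> (forall i, G i \is e'.-homog) -> e = 1%N.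
Proof.
move=> i01 fF gG D0 DE Fh Gh.
have [d Dh dE] := comp_degree i0 D0 DE Fh Gh.
have [D1|D1] := pselect (dvd D 1).
  move: dE; rewrite (homog_unit Dh D1) => /eqP.
  by rewrite muln_eq1 => /andP [/eqP].
have [p pp pD] := prime_factor D0 D1.
have [d' ph] := dvd_homog Dh D0 pD.
have [y yE] := prime_projPt i01 pp ph.
pose z : osub U := exist _ y (mem_set (UT y)).
have [l zl] := projPt_var (lr_comp (osub_incl U) g (f z) : projPt K n).
have := (given_by_nvar (f z) l gG).1 zl; case.
have [_ h _] := fF; apply/(h z _ _ (Gh l)); rewrite DE.
by apply/yE; apply: dvd_mulr.
Qed.

Lemma lin_form_lf (f : S) : f \is 1.-homog ->
  f = linform [the {rmorphism K -> K} of idfun] (\row_j f@_U_(j)).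
Proof.
move=> fh; rewrite /linform; apply/mpolyP => m.
have [md|md] := eqVneq (mdeg m) 1%N; last first.
  rewrite (dhomog_nemf_coeff fh md) (dhomog_nemf_coeff _ md) //.
  exact: (lf_homog [the {rmorphism K -> K} of idfun] (\row_j f@_U_(j))).
have /eqP := md; rewrite mdeg_eq1 => /existsP [i /eqP ->].
by rewrite (mcoeff_lin (fun i => (\row_j f@_U_(j)) 0 i)) mxE.
Qed.
End AutProj.

(** * Automorphisms of Omega have degree one *)

Section OmegaAut.
Variables (k : finFieldType) (K : fieldType) (n : nat) (iota : {rmorphism k -> K}).
Variable U : opens (proj K n).
Local Notation S := {mpoly K[n]}.
Local Notation lf := (linform iota).
Hypothesis UE : forall x : projPt K n, sval U x <-> forall v : 'rV[k]_n, v != 0 -> ~ x (lf v).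
Variables (i0 i1 : 'I_n).
Hypothesis i01 : i0 != i1.

Lemma colin_minors (x y : 'rV[k]_n) : x != 0 -> y != 0 ->
  (forall p q, x 0 p * y 0 q = x 0 q * y 0 p) -> colin x y.
Proof.
move=> x0 y0 xy; have /rV0Pn [p xp] := x0; apply/colinP.
have yE : y = (y 0 p / x 0 p) *: x.
  apply/rowP => q; rewrite mxE mulrAC; apply: (mulIf xp); rewrite divfK //.
  by rewrite mulrC xy mulrC.
exists (y 0 p / x 0 p) => //; apply: contraNneq y0 => c0.
by rewrite yE c0 scale0r.
Qed.

Lemma mcoeff_lf (v : 'rV[k]_n) i : (lf v)@_U_(i) = iota (v 0 i).
Proof. exact: (mcoeff_lin (fun j => iota (v 0 j))). Qed.

(** Taking 2 by 2 minors against [m] eliminates [c] and leaves a linear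
    relation between [c0] and [c1] with coefficients in [k]; it is nontrivial
    unless [m0] and [m1] are both collinear to [m]. *)
Lemma rational_ratio (m0 m1 m : 'rV[k]_n) (c0 c1 c : K) : m0 != 0 -> m1 != 0 -> m != 0 ->
  ~~ colin m0 m1 -> c0 != 0 -> c0 *: lf m0 + c1 *: lf m1 = c *: lf m ->
  exists a : k, c1 = c0 * iota a.
Proof.
move=> m00 m10 mm0 nc c00 e.
have E p : c0 * iota (m0 0 p) + c1 * iota (m1 0 p) = c * iota (m 0 p).
  by have := congr1 (mcoeff U_(p)%MM) e; rewrite mcoeffD !mcoeffZ !mcoeff_lf.
have E2 p q : c1 * iota (m1 0 p * m 0 q - m1 0 q * m 0 p) =
    c0 * iota (m0 0 q * m 0 p - m0 0 p * m 0 q).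
  rewrite !rmorphB !rmorphM; apply/eqP; rewrite -subr_eq0; apply/eqP.
  transitivity ((c0 * iota (m0 0 p) + c1 * iota (m1 0 p)) * iota (m 0 q) -
    (c0 * iota (m0 0 q) + c1 * iota (m1 0 q)) * iota (m 0 p)); first by ring.
  by rewrite !E; ring.
have [[p [q ne]]|nex] := pselect (exists p q, m1 0 p * m 0 q - m1 0 q * m 0 p != 0).
  exists ((m0 0 q * m 0 p - m0 0 p * m 0 q) / (m1 0 p * m 0 q - m1 0 q * m 0 p)).
  have ine : iota (m1 0 p * m 0 q - m1 0 q * m 0 p) != 0 by rewrite fmorph_eq0.
  by rewrite fmorph_div mulrA -E2 mulfK.
have H1 p q : m1 0 p * m 0 q - m1 0 q * m 0 p = 0.
  by apply: contrapT => /eqP h; apply: nex; exists p, q.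
have c1m : colin m1 m by apply: colin_minors => // p q; apply/eqP; rewrite -subr_eq0 H1.
have c0m : colin m0 m.
  apply: colin_minors => // p q; apply/eqP; rewrite -subr_eq0.
  have := E2 q p; rewrite H1 rmorph0 mulr0 => /esym/eqP.
  by rewrite mulf_eq0 (negbTE c00) fmorph_eq0.
by case/negP: nc; rewrite (colin_eq _ c0m) colin_sym.
Qed.

Lemma lf_product_homog (h : S) t : lf_product iota h t -> h \is (size t).-homog.
Proof.
case=> c _ ->; apply: rpredZ; elim: t => [|m t IH]; first by rewrite big_nil dhomog1.
by rewrite big_cons; exact: dhomogM (lf_homog iota m) IH.
Qed.

(** A prime factor [p] of a form without zeros on [U] generates a point outside
    [U], which therefore contains a rational linear form. As [p] divides this
    form, it is a multiple of it. *)
Lemma omega_factor (h : S) d : h \is d.-homog -> h != 0 ->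
  (forall x : projPt K n, sval U x -> ~ x h) ->
  exists2 t : seq 'rV[k]_n, (forall m, m \in t -> m != 0) & lf_product iota h t.
Proof.
move=> hd h0 Uh; have [u [s [u1 ps hE]]] := mpoly_factorial h0.
have [c c0 uE] := dvd1_const u1.
have sL p : p \in s -> exists m a, [/\ m != 0, a != 0 & p = a *: lf m].
  move=> ps'; have pp := ps p ps'.
  have ph : dvd p h by rewrite hE (big_rem p) //=; exact/dvd_mull/dvd_mulr/dvd_refl.
  have [d' pd] := dvd_homog hd h0 ph.
  have [y yE] := prime_projPt i01 pp pd.
  have nU : ~ sval U y by move=> Uy; apply: (Uh y Uy); apply/yE.
  apply: contrapT => nex; apply: nU; apply/UE => m m0 /yE pm.
  have [a a0 pE] := dvd_prime_assoc pp (lf_prime iota m0) pm.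
  by apply: nex; exists m, a.
have [t t0 [b b0 sE]] : exists2 t : seq 'rV[k]_n, (forall m, m \in t -> m != 0) &
    lf_product iota (\prod_(p <- s) p) t.
  elim: s sL {ps hE} => [|p s IH] sL.
    by exists [::] => //; exists 1; rewrite ?oner_neq0 // !big_nil scale1r.
  have [m [a [m0 a0 pE]]] := sL p (mem_head _ _).
  have [|t t0 [b b0 sE]] := IH; first by move=> q qs; apply: sL; rewrite in_cons qs orbT.
  exists (m :: t); first by move=> x; rewrite in_cons => /orP [/eqP ->|/t0].
  exists (a * b); first by rewrite mulf_neq0.
  by rewrite !big_cons pE sE -scalerAl -scalerAr scalerA.
exists t => //; exists (c * b); first by rewrite mulf_neq0.
by rewrite hE uE mul_mpolyC sE scalerA.
Qed.

End OmegaAut.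

Section OmegaTuple.
Variables (k K : fieldType) (n : nat) (iota : {rmorphism k -> K}).
Local Notation S := {mpoly K[n]}.
Local Notation lf := (linform iota).
Implicit Types (F : 'I_n -> S) (v : 'rV[k]_n).

(** The extension of the tuple [F] to all vectors over [k]: for the vector with
    coordinates [a_i] it is the sum of the [a_i F_i]. *)
Definition lin_ext F v : S := psubst F (lf v).

Lemma psubstZ F c a : psubst F (c *: a) = c *: psubst F a.
Proof. by rewrite -!mul_mpolyC (rmorphM (psubst F)) psubstC. Qed.

Lemma lin_extD F u v : lin_ext F (u + v) = lin_ext F u + lin_ext F v.
Proof. by rewrite /lin_ext lfD (rmorphD (psubst F)). Qed.

Lemma lin_extZ F c v : lin_ext F (c *: v) = iota c *: lin_ext F v.
Proof. by rewrite /lin_ext lfZ psubstZ. Qed.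

Lemma lin_ext_delta F i : lin_ext F (delta_mx 0 i) = F i.
Proof. by rewrite /lin_ext lf_delta psubstX. Qed.

Lemma lin_extE F v : lin_ext F v = \sum_i iota (v 0 i) *: F i.
Proof.
rewrite /lin_ext /linform (rmorph_sum (psubst F)); apply: eq_bigr => i _.
by rewrite psubstZ psubstX.
Qed.

Lemma psubst_lin_ext F G D : (forall i, psubst F (G i) = D * 'X_i) ->
  forall v, psubst F (lin_ext G v) = D * lf v.
Proof.
move=> DE v; rewrite lin_extE (rmorph_sum (psubst F)) /linform mulr_sumr.
by apply: eq_bigr => i _; rewrite psubstZ DE scalerAr.
Qed.

(** The inverse tuple recovers [v] from the form up to the factor [D]. *)
Lemma lin_ext_neq0 F G D : D != 0 -> (forall i, psubst F (G i) = D * 'X_i) ->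
  forall v, v != 0 -> lin_ext G v != 0.
Proof.
move=> D0 DE v v0; apply/eqP => h.
have := psubst_lin_ext DE v; rewrite h rmorph0 => /esym/eqP.
by rewrite mulf_eq0 (negbTE D0) lf_eq0 (negbTE v0).
Qed.
End OmegaTuple.

Section OmegaMain.
Variables (k : finFieldType) (K : fieldType) (n : nat) (iota : {rmorphism k -> K}).
Variable U : opens (proj K n).
Local Notation S := {mpoly K[n]}.
Local Notation lf := (linform iota).
Hypothesis UE : forall x : projPt K n, sval U x <-> forall v : 'rV[k]_n, v != 0 -> ~ x (lf v).
Variables (i0 i1 : 'I_n).
Hypothesis i01 : i0 != i1.

(** The value at [x] of the form of [v] is that of the linear form of [v] at
    the point [f x] of [U], so it does not vanish. *)
Lemma lin_ext_factor (f : lrMor (osub U) (osub U)) (F : 'I_n -> S) (G : 'I_n -> S) D' e :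
  given_by (lr_comp (osub_incl U) f) F -> D' != 0 ->
  (forall i, psubst G (F i) = D' * 'X_i) -> (forall i, F i \is e.-homog) ->
  exists s : 'rV[k]_n -> seq 'rV[k]_n, [/\
    forall v, v != 0 -> lf_product iota (lin_ext iota F v) (s v),
    forall v m, v != 0 -> m \in s v -> m != 0 &
    forall v, v != 0 -> size (s v) = e].
Proof.
move=> [_ fP _] D0' DE' Fh.
have Lh v : lin_ext iota F v \is e.-homog.
  by rewrite lin_extE; apply: rpred_sum => i _; exact: rpredZ.
have H (v : 'rV[k]_n) : exists t : seq 'rV[k]_n, v != 0 ->
    (forall m, m \in t -> m != 0) /\ lf_product iota (lin_ext iota F v) t.
  have [->|v0] := eqVneq v 0; first by exists [::].
  have [|t t0 tP] := omega_factor UE i01 (Lh v) (lin_ext_neq0 iota D0' DE' v0); last by exists t.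
  move=> x Ux; pose z : osub U := exist _ x (mem_set Ux).
  have /UE /(_ v v0) fz := optP (f z).
  by move=> h; apply: fz; apply/(fP z _ _ (lf_homog iota v)).
have [s sP] := boolp.choice H.
exists s; split=> [v /sP [] //|v m /sP [h _] /h //|v v0].
have [_ p] := sP v v0.
exact: dhomog_uniq (lin_ext_neq0 iota D0' DE' v0) (lf_product_homog p) (Lh v).
Qed.

(** A rational linear form that divided all these forms would divide all
    [F i]. *)
Lemma lin_ext_primitive (F : 'I_n -> S) (s : 'rV[k]_n -> seq 'rV[k]_n) : primitive F ->
  (forall v, v != 0 -> lf_product iota (lin_ext iota F v) (s v)) ->
  forall l, l != 0 -> exists2 v, v != 0 & push s (line l) v = 0%N.
Proof.
move=> Fp sP l l0; have [i ni] := Fp _ (lf_prime iota l0).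
have d0 := delta_neq0 k i.
exists (delta_mx 0 i) => //; have [c c0 e] := sP _ d0.
rewrite /push big_seq; apply: big1 => m ms; rewrite /line.
have [/colinP [a a0 mE]|//] := boolP (colin l m).
case: ni; rewrite -(lin_ext_delta iota) e (big_rem m) //= mE lfZ -!mul_mpolyC.
exact/dvd_mull/dvd_mulr/dvd_mull/dvd_refl.
Qed.

Lemma noncolin (l : 'rV[k]_n) : l != 0 -> exists2 v, v != 0 & ~~ colin l v.
Proof.
move=> l0; have d0 i := delta_neq0 k (i : 'I_n).
have [h|h] := boolP (colin l (delta_mx 0 i0)); last by exists (delta_mx 0 i0).
exists (delta_mx 0 i1) => //; rewrite (colin_eq _ h); apply/negP => /colinP [c _].
move/rowP/(_ i1) /eqP; rewrite !mxE !eqxx (eq_sym i1) (negbTE i01) mulr0.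
by rewrite oner_eq0.
Qed.

Variables (f g : lrMor (osub U) (osub U)) (F G : 'I_n -> S) (D D' : S) (e e' : nat).
Hypotheses (fF : given_by (lr_comp (osub_incl U) f) F)
  (gG : given_by (lr_comp (osub_incl U) g) G) (Fp : primitive F) (Gp : primitive G)
  (D0 : D != 0) (DE : forall i, psubst F (G i) = D * 'X_i)
  (D0' : D' != 0) (DE' : forall i, psubst G (F i) = D' * 'X_i)
  (Fh : forall i, F i \is e.-homog) (Gh : forall i, G i \is e'.-homog).

(** This is [rigid] for the factorizations of the two tuples. *)
Lemma omega_linear v : v != 0 -> exists c m, [/\ c != 0, m != 0 &
  lin_ext iota F v = c *: lf m].
Proof.
have [s [sP s0 sd]] := lin_ext_factor fF D0' DE' Fh.
have [s' [sP' s0' sd']] := lin_ext_factor gG D0 DE Gh.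
have FD := lin_extD iota F; have FZ := lin_extZ iota F.
have GD := lin_extD iota G; have GZ := lin_extZ iota G.
have [d _ dE] := comp_degree i0 D0 DE Fh Gh.
have e0 : (0 < e)%N by case: (e) dE.
have sn := push_norm FD FZ sP s0 sd; have sn' := push_norm GD GZ sP' s0' sd'.
have ss' := push_comp sP s0 sd (phi := psubst F) (fun v => erefl _) (psubstC F)
  sP' s0' sd' (psubst_lin_ext iota DE).
have s's := push_comp sP' s0' sd' (phi := psubst G) (fun v => erefl _) (psubstC G)
  sP s0 sd (psubst_lin_ext iota DE').
have R := rigid s0 s0' sd sd' sn sn' ss' s's (lin_ext_primitive Fp sP) (lin_ext_primitive Gp sP') noncolin e0.
move=> v0; have := R v v0; have [c c0] := sP v v0; have := s0 v _ v0.
case: (s v) => [|m [|//]] // /(_ m (mem_head _ _)) m0 E _.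
by exists c, m; split=> //; rewrite E big_seq1.
Qed.

(** The forms of two basis vectors and of their sum are multiples of rational
    linear forms, so the ratio of the first two constants lies in [k]. *)
Lemma omega_rational : exists (A : 'M[k]_n) (c : K), c != 0 /\
  forall i, F i = c *: lf (row i A).
Proof.
have d0 i := delta_neq0 k (i : 'I_n).
have [c0 [m0 [c00 m00 F0]]] := omega_linear (d0 i0); rewrite lin_ext_delta in F0.
have H i : {r : 'rV[k]_n | F i = c0 *: lf r}.
  apply: cid; have [->|ii0] := eqVneq i i0; first by exists m0.
  have [c1 [m1 [c10 m10 F1]]] := omega_linear (d0 i); rewrite lin_ext_delta in F1.
  have di0 : delta_mx 0 i0 + delta_mx 0 i != 0 :> 'rV[k]_n.
    apply/eqP => /rowP /(_ i0) /eqP; rewrite !mxE !eqxx (eq_sym i0 i) (negbTE ii0) addr0.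
    by rewrite oner_eq0.
  have [c [m [c0' m0' F01]]] := omega_linear di0.
  rewrite lin_extD !lin_ext_delta F0 F1 in F01.
  (* If they were collinear, [F i] would be a multiple of [F i0], and applying
  the inverse tuple, [X_i] a multiple of [X_i0]. *)
  have nc : ~~ colin m0 m1.
    apply/negP => /colinP [a a0 m1E].
    have : c0 *: F i = (c1 * iota a) *: F i0.
      by rewrite F0 F1 m1E lfZ !scalerA; congr (_ *: _); ring.
    move/(congr1 (psubst G)); rewrite !psubstZ !DE' !scalerAr => /(mulfI D0').
    move/(congr1 (mcoeff U_(i)%MM)); rewrite !mcoeffZ !mcoeffX eqxx mulr1.
    case: eqP => [/(congr1 (fun m : 'X_{1..n} => m i0))|_ /eqP]; last first.
      by rewrite mulr0 (negbTE c00).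
    by rewrite !mnm1E eqxx (negbTE ii0).
  have [a aE] := rational_ratio m00 m10 m0' nc c00 F01.
  by exists (a *: m1); rewrite lfZ scalerA -aE.
exists (\matrix_i sval (H i)), c0; split=> // i.
by rewrite rowK; exact: (svalP (H i)).
Qed.
End OmegaMain.

(** * Linear automorphisms *)

Section ProjMapMore.
Variables (K : fieldType) (n : nat).

Lemma proj_map_ext (k L : fieldType) (a b : nat) (t t' : gradedMor k L a b) :
  (forall f, t f = t' f) -> proj_map t = proj_map t'.
Proof.
case: t t' => [t ti th tr] [t' ti' th' tr'] /= /rmor_ext e.
case: _ / e in ti' th' tr' *.
by rewrite (Prop_irrelevance ti ti') (Prop_irrelevance th th') (Prop_irrelevance tr tr').
Qed.

Lemma gm_comp_irrelevant (k L M : fieldType) (a b c : nat) (t : gradedMor k L a b)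
  (t' : gradedMor L M b c) (q : projPt M c) :
  exists d f, [/\ (0 < d)%N, f \is d.-homog & ~ q ([the {rmorphism _ -> _} of t' \o t] f)].
Proof. exact: (gm_irrelevant t (proj_map_pt t' q)). Qed.

Definition gm_comp (k L M : fieldType) (a b c : nat) (t : gradedMor k L a b)
  (t' : gradedMor L M b c) : gradedMor k M a c :=
  @GradedMor k M a c [the {rmorphism _ -> _} of t' \o t]
    (inj_comp (@gm_inj _ _ _ _ t') (@gm_inj _ _ _ _ t))
    (fun d f fh => @gm_homog _ _ _ _ t' d _ (@gm_homog _ _ _ _ t d f fh))
    (gm_comp_irrelevant t t').

(** Although an open subspace on the whole space is not equal to the space, the
    inclusion can be cancelled. Sections are compared by their values in the
    fraction field. *)
Lemma osub_incl_epi (Y : lrSpace) (U : opens (proj K n)) (UT : forall x, sval U x)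
  (f g : lrMor (proj K n) Y) :
  lr_comp f (osub_incl U) = lr_comp g (osub_incl U) -> f = g.
Proof.
move=> e.
have pt x : f x = g x.
  pose z : osub U := exist _ x (mem_set (UT x)).
  exact: (congr1 (fun h : lrMor (osub U) Y => h z) e).
apply: lrMor_ext => // O s W hf hg; apply: sec_ext => x Wx.
pose z : osub U := exist _ x (mem_set (UT x)).
pose W' := preim_open (lr_open (osub_incl U)) W.
have W'z : sval W' z by exact: Wx.
have hf' : sval W' `<=` lr_comp f (osub_incl U) @^-1` sval O by move=> y /hf.
have hg' : sval W' `<=` lr_comp g (osub_incl U) @^-1` sval O by move=> y /hg.
have := congr1 (evo W'z) (pull_congr e s hf' hg').
rewrite (evo_res (V := preim_open (lr_open (lr_comp f (osub_incl U))) O) (hf' z W'z)).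
rewrite (evo_res (V := preim_open (lr_open (lr_comp g (osub_incl U))) O) (hg' z W'z)) => E.
pose Of := preim_open (lr_open f) O; pose Og := preim_open (lr_open g) O.
have fx : sval Of x := hf x Wx; have gx : sval Og x := hg x Wx.
rewrite (ev_res (U := Of) fx) (ev_res (U := Og) gx).
transitivity (@evo _ _ _ (preim_open (lr_open (lr_comp f (osub_incl U))) O) z (hf' z W'z)
  (pull (lr_comp f (osub_incl U)) O s)).
  by apply: esym; exact: (@ev_res _ _ Of (img (preim_open (lr_open (osub_incl U)) Of)) x fx).
rewrite E.
exact: (@ev_res _ _ Og (img (preim_open (lr_open (osub_incl U)) Og)) x gx).
Qed.
End ProjMapMore.

Lemma kAut_eq (k : comPzRingType) (X : kSpace k) (f g : kAut X) : sval f = sval g -> f = g.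
Proof. by case: f g => [f fP] [g gP] /= e; case: _ / e in gP *; rewrite (Prop_irrelevance fP gP). Qed.

Lemma bijective_of (A B : Type) (r : A -> B) : injective r ->
  (forall y, exists x, r x = y) -> bijective r.
Proof.
move=> ri rs; have [h hP] := boolp.choice rs.
by exists h => x; [apply: ri; rewrite hP|exact: hP].
Qed.

Section LinearMaps.
Variables (k : fieldType) (V : vectType k).
Local Notation n := (\dim {:V}).
Local Notation e := (vbasis {:V}).

Definition coords (v : V) : 'rV[k]_n := \row_i coord e i v.

Definition of_coords (r : 'rV[k]_n) : V := \sum_(i < n) r 0 i *: e`_i.

Lemma coordsK : cancel coords of_coords.
Proof.
move=> v; rewrite [RHS](coord_vbasis (memvf v)).
by apply: eq_bigr => i _; rewrite mxE.
Qed.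

Lemma of_coordsK : cancel of_coords coords.
Proof.
move=> r; apply/rowP => i; rewrite mxE coord_sum_free //.
exact: basis_free (vbasisP _).
Qed.

Lemma coords_eq0 v : (coords v == 0) = (v == 0).
Proof.
apply/eqP/eqP => [c0|->]; last by apply/rowP => i; rewrite !mxE linear0.
by rewrite -[v]coordsK c0 /of_coords big1 // => i _; rewrite mxE scale0r.
Qed.

Lemma GL_eq0 (h : GL V) v : (sval h v == 0) = (v == 0).
Proof.
have /lker0P hi := svalP h.
by apply/eqP/eqP => [h0|->]; [apply: hi; rewrite h0|]; rewrite linear0.
Qed.

Lemma GL_ext (g h : GL V) : (forall v, sval g v = sval h v) -> g = h.
Proof. by move=> gh; apply: val_inj; apply/lfunP. Qed.

Lemma GL_invK (h : GL V) v : sval (GL_inv h) (sval h v) = v.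
Proof. exact: lker0_lfunK (svalP h) v. Qed.

Lemma GL_invVK (h : GL V) v : sval h (sval (GL_inv h) v) = v.
Proof. exact: lker0_lfunVK (svalP h) v. Qed.

Section OverK.
Variables (K : fieldType) (iota : {rmorphism k -> K}).
Local Notation S := {mpoly K[n]}.
Local Notation lform := (lform iota).

Lemma lformE (v : V) : lform v = linform iota (coords v).
Proof. by apply: eq_bigr => i _; rewrite mxE. Qed.

Lemma lform_eq0 (v : V) : (lform v == 0) = (v == 0).
Proof. by rewrite lformE lf_eq0 coords_eq0. Qed.

Lemma lform_e (i : 'I_n) : lform e`_i = 'X_i.
Proof. by rewrite lform_basis valK. Qed.

Definition lin_tuple (h : 'End(V)) (i : 'I_n) : S := lform (h e`_i).

Lemma psubst_lform (h : 'End(V)) v : psubst (lin_tuple h) (lform v) = lform (h v).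
Proof.
transitivity (\sum_(i < n) iota (coord e i v) *: lform (h e`_i)).
  rewrite {1}/Defs.lform (rmorph_sum (psubst (lin_tuple h))).
  by apply: eq_bigr => i _; rewrite psubstZ psubstX.
rewrite [in RHS](coord_vbasis (memvf v)) linear_sum /=.
rewrite (big_morph (lform) (lformD iota) (lform0 V iota)).
by apply: eq_bigr => i _; rewrite linearZ lformZ.
Qed.

Lemma psubst_lin_comp (h h' : 'End(V)) f :
  psubst (lin_tuple h) (psubst (lin_tuple h') f) = psubst (lin_tuple (h \o h')%VF) f.
Proof.
rewrite psubst_comp; congr (GRing.RMorphism.sort (psubst _) f); apply: funext => i.
by rewrite psubst_lform /lin_tuple lfunE.
Qed.

Lemma psubst_lin_id f : psubst (lin_tuple \1%VF) f = f.
Proof.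
rewrite -[RHS]psubst_id; congr (GRing.RMorphism.sort (psubst _) f); apply: funext => i.
by rewrite /lin_tuple lfunE /= lform_e.
Qed.

Lemma lin_tupleK (h : GL V) f : psubst (lin_tuple (sval (GL_inv h))) (psubst (lin_tuple (sval h)) f) = f.
Proof. by rewrite psubst_lin_comp (GL_mulVg h) psubst_lin_id. Qed.

Lemma lin_tupleVK (h : GL V) f : psubst (lin_tuple (sval h)) (psubst (lin_tuple (sval (GL_inv h))) f) = f.
Proof. by rewrite psubst_lin_comp (GL_mulgV h) psubst_lin_id. Qed.

Lemma lin_tuple_homog h i : lin_tuple h i \is 1.-homog.
Proof. exact: lform_homog. Qed.

Lemma lin_cmp_homog h d (f : S) : f \is d.-homog -> psubst (lin_tuple h) f \is d.-homog.
Proof. by move=> /(psubst_homog (lin_tuple_homog h)); rewrite mul1n. Qed.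

Lemma lin_irrelevant (h : GL V) (q : projPt K n) :
  exists d f, [/\ (0 < d)%N, f \is d.-homog & ~ q (psubst (lin_tuple (sval h)) f)].
Proof.
have [d [f [d0 fh qf]]] := projPt_irrelevant (pt_ideal_proj q).
exists d, (psubst (lin_tuple (sval (GL_inv h))) f).
by rewrite lin_tupleVK; split=> //; exact: lin_cmp_homog.
Qed.

Definition lin_gm (h : GL V) : gradedMor K K n n :=
  GradedMor (can_inj (lin_tupleK h)) (@lin_cmp_homog (sval h)) (lin_irrelevant h).

(** [Proj] of the symmetric algebra of [h] over [K]. It is contravariant in
    [h]. *)
Definition lin_map (h : GL V) : lrMor (proj K n) (proj K n) := proj_map (lin_gm h).

Lemma lin_map_kMor h : @is_kMor K (proj K n) (proj K n) (lin_map h).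
Proof. by apply: proj_map_kMor => c; exact: psubstC. Qed.

Lemma lin_map_comp (h h' : GL V) : lr_comp (lin_map h) (lin_map h') = lin_map (GL_comp h' h).
Proof. by apply: proj_map_comp => f; rewrite /= psubst_lin_comp. Qed.

Lemma lin_map_id (h : GL V) : (forall v, sval h v = v) -> lin_map h = lr_id (proj K n).
Proof.
move=> hid; apply: proj_map_id => f /=.
have -> : sval h = \1%VF by apply/lfunP => v; rewrite hid lfunE.
exact: psubst_lin_id.
Qed.

Lemma given_by_lin (U : opens (proj K n)) (h : GL V) :
  given_by (lr_comp (lin_map h) (osub_incl U)) (lin_tuple (sval h)).
Proof.
have H := given_by_proj_map U (t := lin_gm h) (fun c => psubstC _ c).
rewrite (_ : lin_tuple (sval h) = fun i => lin_gm h 'X_i) //.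
by apply: funext => i; rewrite /= psubstX.
Qed.
End OverK.
End LinearMaps.

(** * Automorphisms are linear *)

Section MatrixMap.
Variables (k : fieldType) (V : vectType k).
Local Notation n := (\dim {:V}).
Local Notation e := (vbasis {:V}).
Variable A : 'M[k]_n.

Definition mx_map (v : V) : V := of_coords (coords v *m A).

Lemma mx_map_linear : linear mx_map.
Proof.
move=> c u v; apply: (can_inj (@coordsK _ V)); rewrite /mx_map of_coordsK.
have cl a (x y : V) : coords (a *: x + y) = a *: coords x + coords y.
  by apply/rowP => i; rewrite !mxE linearP.
by rewrite cl mulmxDl -scalemxAl cl !of_coordsK.
Qed.

HB.instance Definition _ := GRing.isLinear.Build k V V *:%R mx_map mx_map_linear.

Lemma mx_map_e (i : 'I_n) : mx_map e`_i = of_coords (row i A).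
Proof.
congr (of_coords _); rewrite rowE; congr (_ *m _); apply/rowP => j.
by rewrite !mxE eqxx coord_free ?(basis_free (vbasisP _)) // eq_sym.
Qed.
End MatrixMap.

Section AutLinear.
Variables (k : fieldType) (V : vectType k) (K : fieldType) (iota : {rmorphism k -> K}).
Local Notation n := (\dim {:V}).
Local Notation e := (vbasis {:V}).
Local Notation S := {mpoly K[n]}.
Local Notation incl := (@osub_incl (proj K n)).

(** The matrix is invertible, because the tuple [F] has an inverse up to the
    factor [D']. *)
Lemma tuple_GL (F G : 'I_n -> S) D' (c : K) (A : 'M[k]_n) : D' != 0 ->
  (forall i, psubst G (F i) = D' * 'X_i) -> (forall i, F i = c *: linform iota (row i A)) ->
  exists h : GL V, forall i, F i = c *: lin_tuple iota (sval h) i.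
Proof.
move=> D0' DE' FA; pose h : 'End(V) := linfun (mx_map A).
have FE i : F i = c *: lin_tuple iota h i.
  by rewrite FA /lin_tuple lfunE /= mx_map_e lformE of_coordsK.
have hi : lker h == 0%VS.
  apply/lker0P => u v /eqP; rewrite -subr_eq0 -linearB => /eqP h0.
  apply/eqP; rewrite -subr_eq0; apply/negPn/negP => uv.
  have cuv : coords (u - v) != 0 by rewrite coords_eq0.
  have /eqP := lin_ext_neq0 iota D0' DE' cuv; case.
  rewrite lin_extE.
  transitivity (c *: \sum_(i < n) iota (coords (u - v) 0 i) *: lin_tuple iota h i).
    by rewrite scaler_sumr; apply: eq_bigr => i _; rewrite FE !scalerA mulrC.
  have := psubst_lform iota h (u - v); rewrite h0 lform0 lformE.
  by rewrite -[psubst _ _]/(lin_ext iota _ _) lin_extE => ->; rewrite scaler0.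
by exists (exist _ h hi).
Qed.

Lemma scaled_lin_eq (U : opens (proj K n)) (f : lrMor (osub U) (proj K n)) F (h : GL V) (c : K) :
  given_by f F -> (forall i, F i = c *: lin_tuple iota (sval h) i) ->
  f = lr_comp (lin_map iota h) (incl U).
Proof.
move=> fF FE; apply: given_by_uniq fF (given_by_lin iota U h) _ => i j.
by rewrite !FE -!scalerAl mulrC.
Qed.

Lemma aut_tuples (U : opens (proj K n)) (f : kAut (osub_k U)) (i0 i1 : 'I_n) (x : osub U) :
  i0 != i1 -> exists (g : lrMor (osub U) (osub U)) F G D D' d d',
  [/\ [/\ given_by (lr_comp (incl U) (sval f)) F, given_by (lr_comp (incl U) g) G,
      primitive F & primitive G],
   [/\ D != 0, forall i, psubst F (G i) = D * 'X_i, D' != 0 &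
      forall i, psubst G (F i) = D' * 'X_i],
   forall i, F i \is d.-homog & forall i, G i \is d'.-homog].
Proof.
move=> i01; have [fk [g [fg gf]]] := svalP f.
have gk : @is_kMor K (osub_k U) (osub_k U) g by exact: kMor_inv fk fg gf.
have ik := osub_incl_kMor U.
have [F [fF Fp]] := given_by_ex (kMor_comp ik fk) x.
have [G [gG Gp]] := given_by_ex (kMor_comp ik gk) x.
have [D D0 DE] := comp_tuple gf x i01 fF gG.
have [D' D0' DE'] := comp_tuple fg x i01 gG fF.
have [[d Fh] _ _] := fF; have [[d' Gh] _ _] := gG.
by exists g, F, G, D, D', d, d'; split.
Qed.

Lemma GL_id_subproof : lker (\1%VF : 'End(V)) == 0%VS.
Proof. by apply/lker0P => u v; rewrite !id_lfunE. Qed.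

Definition GL_id : GL V :=
  exist (fun f : 'End(V) => is_true (lker f == 0%VS)) _ GL_id_subproof.

(** With two variables, automorphisms are described by tuples; with fewer,
    there is only one morphism to projective space, and every linear map
    induces it. *)
Lemma aut_lin_ind (U : opens (proj K n)) (f : kAut (osub_k U)) :
  (forall (i0 i1 : 'I_n) (x : osub U), i0 != i1 ->
     exists h : GL V, lr_comp (incl U) (sval f) = lr_comp (lin_map iota h) (incl U)) ->
  exists h : GL V, lr_comp (incl U) (sval f) = lr_comp (lin_map iota h) (incl U).
Proof.
move=> H; have [[x _]|nx] := pselect (exists x : osub U, True); last first.
  by exists GL_id; exact: empty_uniq.
have [n1|n2] := leqP n 1; last first.
  by apply: (H (Ordinal (ltnW n2)) (Ordinal n2) x).
exists GL_id; have ik := osub_incl_kMor U; have [fk _] := svalP f.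
apply: small_uniq n1 _ _; first exact: kMor_comp ik fk.
exact: (@kMor_comp _ (osub_k U) (proj K n) (proj K n)) (lin_map_kMor iota GL_id) ik.
Qed.
End AutLinear.

Lemma proj_aut_lin (k : fieldType) (V : vectType k) (U : opens (proj k (\dim {:V})))
  (UT : forall x, sval U x) (f : kAut (osub_k U)) :
  exists h : GL V, lr_comp (osub_incl U) (sval f) =
    lr_comp (lin_map [the {rmorphism k -> k} of idfun] h) (osub_incl U).
Proof.
apply: aut_lin_ind => i0 i1 x i01.
have [g [F [G [D [D' [d [d' [[fF gG _ _] [D0 DE D0' DE'] Fh Gh]]]]]]]] := aut_tuples f x i01.
have d1 := proj_degree1 UT i01 fF gG D0 DE Fh Gh.
have [|h hE] := @tuple_GL k V k [the {rmorphism k -> k} of idfun] F G D' 1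
  (\matrix_i (\row_j (F i)@_U_(j))) D0' DE'.
  by move=> i; rewrite rowK scale1r; apply: lin_form_lf; rewrite -d1.
exists h; exact: scaled_lin_eq fF hE.
Qed.

Section OmegaK.
Variables (k : finFieldType) (V : vectType k) (K : fieldType) (iota : {rmorphism k -> K}).
Local Notation n := (\dim {:V}).

(** A rational hyperplane is the zero set of a nonzero vector. *)
Lemma OmegaP (x : projPt K n) : sval (Omega_opens V iota) x <->
  forall v : V, v != 0 -> ~ x (lform iota v).
Proof.
split=> [Ox v v0 xv|h].
  apply: Ox; exists <[v]>%VS; first by rewrite /= dim_vline v0.
  move=> w /vlineP [c ->]; rewrite lformZ -mul_mpolyC.
  exact: projPt_M (pt_ideal_proj x) _ _ xv.
case=> W /= W1 xW; have w0 : vpick W != 0 by rewrite vpick0 -dimv_eq0 W1.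
by apply: (h _ w0); apply: xW; exact: memv_pick.
Qed.

Lemma OmegaP_lf (x : projPt K n) : sval (Omega_opens V iota) x <->
  forall v : 'rV[k]_n, v != 0 -> ~ x (linform iota v).
Proof.
rewrite OmegaP; split=> h v v0; last by rewrite lformE; apply: h; rewrite coords_eq0.
rewrite -[v]of_coordsK -lformE; apply: h.
by rewrite -coords_eq0 of_coordsK.
Qed.

Lemma Omega_aut_lin (f : kAut (OmegaK V iota)) :
  exists h : GL V, lr_comp (osub_incl (Omega_opens V iota)) (sval f) =
    lr_comp (lin_map iota h) (osub_incl (Omega_opens V iota)).
Proof.
apply: aut_lin_ind => i0 i1 x i01.
have [g [F [G [D [D' [d [d' [[fF gG Fp Gp] [D0 DE D0' DE'] Fh Gh]]]]]]]] := aut_tuples f x i01.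
have [A [c [c0 FA]]] := omega_rational OmegaP_lf i01 fF gG Fp Gp D0 DE D0' DE' Fh Gh.
have [h hE] := tuple_GL D0' DE' FA.
exists h; exact: scaled_lin_eq fF hE.
Qed.
End OmegaK.

(** * Linear automorphisms with the same action *)

Lemma restrict_comp1 (X : lrSpace) (U : opens X) (f g : lrMor X X)
  (fU : sval U `<=` f @^-1` sval U) (gU : sval U `<=` g @^-1` sval U) :
  lr_comp f g = lr_id X -> lr_comp (lr_restrict fU) (lr_restrict gU) = lr_id (osub U).
Proof.
move=> fg; apply: osub_incl_mono.
by rewrite lr_compA restrict_incl -lr_compA restrict_incl lr_compA fg lr_comp1l lr_comp1r.
Qed.

Lemma restrict_kAut_subproof (k : comPzRingType) (X : kSpace k) (U : opens X) (f g : lrMor X X)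
  (fU : sval U `<=` f @^-1` sval U) (gU : sval U `<=` g @^-1` sval U) :
  is_kMor f -> lr_comp f g = lr_id X -> lr_comp g f = lr_id X ->
  @is_kAut k (osub_k U) (lr_restrict fU).
Proof.
move=> fk fg gf; split; first exact: restrict_kMor.
by exists (lr_restrict gU); split; exact: restrict_comp1.
Qed.

Section FullOpen.
Variables (K : fieldType) (n : nat).

Definition full_open : opens (proj K n) := exist _ setT openT.

Lemma full_openT x : sval full_open x. Proof. by []. Qed.
End FullOpen.

Section Scalars.
Variables (k : finFieldType) (V : vectType k) (K : fieldType) (iota : {rmorphism k -> K}).
Local Notation n := (\dim {:V}).
Local Notation e := (vbasis {:V}).
Local Notation S := {mpoly K[n]}.
Local Notation lform := (lform iota).

(** A linear form divides another one only if they differ by a constant of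
    [K]; comparing coefficients, the 2 by 2 minors vanish in [k]. *)
Lemma dvd_lf_colin (v w : 'rV[k]_n) : v != 0 -> w != 0 ->
  dvd (linform iota v) (linform iota w) -> colin v w.
Proof.
move=> v0 w0 vw; have [c c0 E] := dvd_prime_assoc (lf_prime iota v0) (lf_prime iota w0) vw.
apply: colin_minors => // p q; apply: (fmorph_inj iota); rewrite !rmorphM.
have H i : iota (v 0 i) = c * iota (w 0 i).
  by rewrite -mcoeff_lf E mcoeffZ mcoeff_lf.
by rewrite !H; ring.
Qed.

Lemma lin_tuple_bilinear (a b : 'End(V)) :
  proportional (lin_tuple iota a) (lin_tuple iota b) ->
  forall u w, lform (a u) * lform (b w) = lform (a w) * lform (b u).
Proof.
move=> ab u w; have H (h : 'End(V)) (v : V) : lform (h v) = \sum_i iota (coords v 0 i) *: lin_tuple iota h i.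
  by rewrite -psubst_lform lformE -lin_extE.
rewrite !H !big_distrlr /= exchange_big; apply: eq_bigr => j _; apply: eq_bigr => i _.
by rewrite -!scalerAl -!scalerAr !scalerA ab mulrC.
Qed.

(** Let [C] be the composite of [a] with the inverse of [b]. Proportionality
    says that [C v * w = C w * v] in the symmetric algebra, where [v] is
    prime. So [C v] is a multiple of [v], with a factor that is the same for
    all [v]. *)
Lemma proportional_scale (a b : GL V) :
  proportional (lin_tuple iota (sval a)) (lin_tuple iota (sval b)) ->
  exists2 c : k, c != 0 & sval a = c *: sval b.
Proof.
move=> /lin_tuple_bilinear ab.
have [[v1 v10]|nv] := pselect (exists v : V, v != 0); last first.
  exists 1; first exact: oner_neq0.
  apply/lfunP => v; suff -> : v = 0 by rewrite !linear0.
  by apply/eqP/negPn/negP => v0; apply: nv; exists v.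
pose C (v : V) := sval a (sval (GL_inv b) v).
have CE (v w : V) : lform (C v) * lform w = lform (C w) * lform v.
  by have := ab (sval (GL_inv b) v) (sval (GL_inv b) w); rewrite !GL_invVK.
have C0 (v : V) : v != 0 -> C v != 0 by move=> v0; rewrite /C !GL_eq0.
have ccol (v w : V) : v != 0 -> w != 0 -> colin (coords v) (coords w) -> exists c, w = c *: v.
  move=> v0 w0 /colinP [c c0 E]; exists c.
  apply: (can_inj (@coordsK _ V)); rewrite E.
  by apply/rowP => i; rewrite !mxE linearZ.
have Cv (v : V) : v != 0 -> exists c, C v = c *: v.
  move=> v0; have cv0 : coords v != 0 by rewrite coords_eq0.
  have [[w [w0 nvw]]|all] := pselect (exists w, w != 0 /\ ~~ colin (coords v) (coords w)).
    have [_ _ vP] := lf_prime iota cv0.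
    have /vP [h|h] : dvd (linform iota (coords v)) (lform (C v) * lform w).
      by rewrite CE -lformE; exact/dvd_mull/dvd_refl.
      apply: (ccol _ _ v0 (C0 v v0)); apply: (dvd_lf_colin cv0); last by rewrite -(lformE iota (C v)).
      by rewrite coords_eq0; exact: (C0 v v0).
    case/negP: nvw; apply: (dvd_lf_colin cv0); last by rewrite -(lformE iota w).
    by rewrite coords_eq0.
  apply: (ccol _ _ v0 (C0 v v0)); apply: contrapT => /negP nc.
  by apply: all; exists (C v); split=> //; exact: C0.
have [c cE] := Cv v1 v10.
have CcE v : C v = c *: v.
  have [->|v0] := eqVneq v 0; first by rewrite /C !linear0 ?scaler0.
  have [d dE] := Cv v v0; have := CE v v1; rewrite cE dE !lformZ -!scalerAl.
  rewrite mulrC => E; congr (_ *: _); apply: (fmorph_inj iota); apply/eqP.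
  rewrite -subr_eq0; move/eqP: E; rewrite -subr_eq0 -scalerBl scaler_eq0 => /orP [//|].
  by rewrite mulf_eq0 !lform_eq0 (negbTE v0) (negbTE v10).
exists c.
  apply: contraNneq v10 => c0; rewrite -(GL_eq0 (GL_inv b)) -(GL_eq0 a).
  by rewrite -/(C v1) CcE c0 scale0r.
apply/lfunP => v; rewrite scale_lfunE; have := CcE (sval b v).
by rewrite /C GL_invK.
Qed.

Lemma scale_lin_map (a b : GL V) (c : k) : c != 0 -> sval a = c *: sval b ->
  lin_map iota a = lin_map iota b.
Proof.
move=> c0 ab; apply: (osub_incl_epi (@full_openT K n)).
apply: given_by_uniq (given_by_lin iota _ a) (given_by_lin iota _ b) _ => i j.
by rewrite /lin_tuple ab !scale_lfunE !lformZ -!scalerAl mulrC.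
Qed.

(** The tuple of a morphism on a nonempty open set is unique up to
    proportion. *)
Lemma lin_map_incl_inj (U : opens (proj K n)) (a b : GL V) :
  (forall x : projPt K n, (forall f, x f -> f = 0) -> sval U x) ->
  lr_comp (lin_map iota a) (osub_incl U) = lr_comp (lin_map iota b) (osub_incl U) ->
  exists2 c : k, c != 0 & sval a = c *: sval b.
Proof.
move=> Ug ab; apply: proportional_scale => i j.
have n0 : (0 < n)%N by case: i => i; case: (\dim _).
pose x : projPt K n := ProjPt (zero_is_projPt K n0).
have Ux : sval U x by apply: Ug => f.
pose z : osub U := exist _ x (mem_set Ux).
have ga := given_by_lin iota U a; rewrite ab in ga.
exact: given_by_prop z ga (given_by_lin iota U b) i j.
Qed.
End Scalars.

(** * The automorphism groups *)

Lemma kAut_compE (k : comPzRingType) (X : kSpace k) (f g : kAut X) :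
  sval (kAut_comp f g) = lr_comp (sval f) (sval g).
Proof. by []. Qed.

Section ProjectiveSpace.
Variables (k : finFieldType) (V : vectType k).
Local Notation n := (\dim {:V}).
Local Notation Fid := [the {rmorphism k -> k} of idfun].

Lemma linear_kAutE (g : GL V) : sval (linear_kAut g) = lin_map Fid (GL_inv g).
Proof.
apply: proj_map_ext => f; apply: rmor_mpoly_ext => [c|i] /=.
  by rewrite psubstC; exact: symC.
by rewrite psubstX; exact: symX.
Qed.

Lemma GL_inv_inv (h : GL V) : GL_inv (GL_inv h) = h.
Proof. by apply: GL_ext => v; rewrite -[in RHS](GL_invVK (GL_inv h) v) GL_invVK. Qed.

Lemma kAut_proj_lin (f : kAut (projSpace V)) : exists h : GL V, sval f = lin_map Fid h.
Proof.
have [fk [g [fg gf]]] := svalP f.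
have fT : sval (full_open k n) `<=` sval f @^-1` sval (full_open k n) by [].
have gT : sval (full_open k n) `<=` g @^-1` sval (full_open k n) by [].
have [h hE] := proj_aut_lin (@full_openT k n)
  (exist _ _ (restrict_kAut_subproof fT gT fk fg gf) : kAut (osub_k (full_open k n))).
by exists h; apply: (osub_incl_epi (@full_openT k n)); rewrite -hE /= restrict_incl.
Qed.

Lemma linear_kAut_iso : PGL_iso (@linear_kAut k V).
Proof.
split.
- move=> g h; apply: kAut_eq.
  rewrite -[RHS]/(lr_comp (sval (linear_kAut g)) (sval (linear_kAut h))).
  rewrite !linear_kAutE lin_map_comp; congr (lin_map _ _).
  apply: GL_ext => v; rewrite [RHS]lfunE /=.
  rewrite -{1}(GL_invVK g v) -{1}(GL_invVK h (sval (GL_inv g) v)).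
  have := GL_invK (GL_comp g h) (sval (GL_inv h) (sval (GL_inv g) v)).
  by rewrite /= lfunE.
- move=> g h; split.
    move/(congr1 sval); rewrite !linear_kAutE => gh.
    have gh' := congr1 (fun f => lr_comp f (osub_incl (full_open k n))) gh.
    have [c c0 e] := lin_map_incl_inj (fun x _ => full_openT x) gh'.
    exists c^-1; first by rewrite invr_eq0.
    apply/lfunP => v; rewrite scale_lfunE.
    rewrite -{1}(GL_invK h v); move/lfunP: e => /(_ (sval h v)).
    rewrite scale_lfunE => e; rewrite -[X in sval g X]scale1r -(mulVf c0) -scalerA -e.
    by rewrite linearZ /= GL_invVK.
  move=> [c c0 e]; apply: kAut_eq; rewrite !linear_kAutE.
  apply: (scale_lin_map _ (c := c^-1)); first by rewrite invr_eq0.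
  apply/lfunP => v; rewrite scale_lfunE.
  have gi : injective (sval g) by exact: (lker0P (svalP g)).
  apply: gi; rewrite GL_invVK linearZ /= e scale_lfunE GL_invVK scalerA mulVf // scale1r //.
- move=> f; have [h hE] := kAut_proj_lin f; exists (GL_inv h).
  by apply: kAut_eq; rewrite linear_kAutE GL_inv_inv.
Qed.
End ProjectiveSpace.

Section OmegaAutomorphisms.
Variables (k : finFieldType) (V : vectType k) (K : fieldType) (iota : {rmorphism k -> K}).
Local Notation n := (\dim {:V}).
Local Notation Fid := [the {rmorphism k -> k} of idfun].
Local Notation Om := (Omega_opens V iota).

Lemma lin_map_Omega (h : GL V) : sval Om `<=` lin_map iota h @^-1` sval Om.
Proof.
move=> x /OmegaP Ox; apply/OmegaP => v v0; rewrite /= psubst_lform.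
by apply: Ox; rewrite GL_eq0.
Qed.

Lemma lin_map_inv (h : GL V) : lr_comp (lin_map iota h) (lin_map iota (GL_inv h)) = lr_id (proj K n).
Proof. by rewrite lin_map_comp; apply: lin_map_id => v; rewrite /= lfunE /= GL_invK. Qed.

Lemma lin_map_Vinv (h : GL V) : lr_comp (lin_map iota (GL_inv h)) (lin_map iota h) = lr_id (proj K n).
Proof. by rewrite lin_map_comp; apply: lin_map_id => v; rewrite /= lfunE /= GL_invVK. Qed.

Definition lin_Omega (h : GL V) : kAut (OmegaK V iota) :=
  exist _ _ (restrict_kAut_subproof (@lin_map_Omega h) (@lin_map_Omega (GL_inv h))
    (lin_map_kMor iota h) (lin_map_inv h) (lin_map_Vinv h)).

Lemma lin_OmegaE (h : GL V) : lr_comp (osub_incl Om) (sval (lin_Omega h)) =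
  lr_comp (lin_map iota h) (osub_incl Om).
Proof. exact: restrict_incl. Qed.

Lemma generic_Omega (x : projPt K n) : (forall f, x f -> f = 0) -> sval Om x.
Proof.
move=> x0; apply/OmegaP => v v0 /x0 /eqP.
by rewrite lform_eq0 (negbTE v0).
Qed.

Lemma lin_Omega_inj (a b : GL V) : lin_Omega a = lin_Omega b -> lin_map Fid a = lin_map Fid b.
Proof.
move/(congr1 sval) => e; have := lin_OmegaE a; rewrite e lin_OmegaE => /esym ab.
have [c c0 E] := lin_map_incl_inj generic_Omega ab.
exact: scale_lin_map c0 E.
Qed.

(** The projection from [P(V)_K] to [P(V)]. *)
Definition base_map : lrMor (proj K n) (proj k n) := proj_map (map_mpoly_gm n iota).

(** The coefficients of a linear map lie in [k]. *)
Lemma base_map_lin (h : GL V) :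
  lr_comp base_map (lin_map iota h) = lr_comp (lin_map Fid h) base_map.
Proof.
rewrite (proj_map_comp (u := gm_comp (map_mpoly_gm n iota) (lin_gm iota h))) //.
rewrite (proj_map_comp (u := gm_comp (lin_gm Fid h) (map_mpoly_gm n iota))) //.
apply: proj_map_ext => f.
apply: rmor_mpoly_ext => [c|i] /=.
  by rewrite !(psubstC, map_mpolyC).
rewrite map_mpolyX !psubstX /lin_tuple /lform (rmorph_sum (map_mpoly iota)).
by apply: eq_bigr => j _; rewrite [RHS]map_mpolyZ map_mpolyX.
Qed.

Lemma Omega_projE : lr_comp (Omega_incl V) (Omega_proj V iota) =
  lr_comp base_map (osub_incl Om).
Proof. exact: restrict_incl. Qed.

(** The functions [X_i / X_l] come from [P(V)], so their pull-backs, which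
    determine the tuple of a [K]-morphism, depend only on the composite. *)
Lemma base_map_mono (U : opens (proj K n)) (p p' : lrMor (osub U) (proj K n)) :
  @is_kMor K (osub_k U) (proj K n) p -> @is_kMor K (osub_k U) (proj K n) p' ->
  lr_comp base_map p = lr_comp base_map p' -> p = p'.
Proof.
move=> pk pk' e; have [[x _]|nx] := pselect (exists x : osub U, True); last exact: empty_uniq.
have [F [pF _]] := given_by_ex pk x; have [F' [pF' _]] := given_by_ex pk' x.
apply: (given_by_uniq pF pF').
have ex : base_map (p x) = base_map (p' x) by exact: (congr1 (fun h : lrMor (osub U) (proj k n) => h x) e).
have [l xl] := projPt_var (base_map (p x) : projPt k n).
have xl' : ~ (base_map (p' x) : projPt k n) 'X_l by rewrite -ex.
have mX i : map_mpoly iota ('X_i : {mpoly k[n]}) = 'X_i by rewrite map_mpolyX.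
have X0 : ('X_l : {mpoly k[n]}) != 0 by have [] := var_prime k l.
pose O := preim_open (lr_open base_map) (Dvar k l).
have key (q : lrMor (osub U) (proj K n)) H : given_by q H ->
    forall (ql : ~ (base_map (q x) : projPt k n) 'X_l), H l != 0 /\ forall i,
    @evo _ _ _ (preim_open (lr_open (lr_comp base_map q)) (Dvar k l)) x ql
      (pull (lr_comp base_map q) (Dvar k l) (coord_sec k l i)) = tofrac (H i) / tofrac (H l).
  move=> qH ql; have qlK : ~ (q x : projPt K n) 'X_l by move: ql; rewrite /= mX.
  have Hl := (given_by_nvar x l qH).1 qlK.
  split; first by apply/eqP => H0; apply: Hl; rewrite H0; exact: projPt_0 (pt_ideal_proj _).
  move=> i; have [_ _ qs] := qH.
  have := qs x O ql (pull base_map (Dvar k l) (coord_sec k l i)) _ _ _ (var_homog K i) (var_homog K l) qlK.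
  rewrite !psubstX; apply.
  transitivity (frac_map (map_mpoly iota) (tofrac ('X_i : {mpoly k[n]}) / tofrac ('X_l : {mpoly k[n]}))).
    by [].
  by rewrite (frac_mapE (@map_mpoly_inj _ _ n iota) _ X0) /= !map_mpolyX.
have [Fl FE] := key p F pF xl; have [Fl' FE'] := key p' F' pF' xl'.
have E i : F i * F' l = F' i * F l.
  apply/(tofrac_div_eq _ _ Fl Fl'); rewrite -FE -FE'.
  pose W := preim_open (lr_open (lr_comp base_map p)) (Dvar k l).
  have Wx : sval W x by exact: xl.
  have hp : sval W `<=` lr_comp base_map p @^-1` sval (Dvar k l) by [].
  have hp' : sval W `<=` lr_comp base_map p' @^-1` sval (Dvar k l) by rewrite -e.
  have := congr1 (evo Wx) (pull_congr e (coord_sec k l i) hp hp').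
  rewrite (evo_res (V := W) xl).
  by rewrite (evo_res (V := preim_open (lr_open (lr_comp base_map p')) (Dvar k l)) xl').
by move=> i j; rewrite [RHS]mulrC; exact: cross_cancel Fl' Fl (E i) (E j).
Qed.
End OmegaAutomorphisms.

Theorem theorem1p1 (k : finFieldType) (V : vectType k) :
  PGL_iso (@linear_kAut k V) /\
  exists res : kAut (projSpace V) -> kAut (Omega V),
    [/\ (forall (f : kAut (projSpace V)) (g : kAut (Omega V)),
          lr_comp (Omega_incl V) (sval g) = lr_comp (sval f) (Omega_incl V) <->
          g = res f),
        kAut_iso res &
        forall (K : fieldType) (iota : {rmorphism k -> K}),
        exists bc : kAut (projSpace V) -> kAut (OmegaK V iota),
          (forall (f : kAut (projSpace V)) (g : kAut (OmegaK V iota)),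
             lr_comp (Omega_proj V iota) (sval g) =
             lr_comp (sval (res f)) (Omega_proj V iota) <->
             g = bc f) /\
          kAut_iso bc].
Proof.
split; first exact: linear_kAut_iso.
set Fid := [the {rmorphism k -> k} of idfun].
have [m mP] := boolp.choice (@kAut_proj_lin k V).
pose res f := lin_Omega Fid (m f).
have resE f : lr_comp (Omega_incl V) (sval (res f)) = lr_comp (sval f) (Omega_incl V).
  by rewrite mP; exact: lin_OmegaE.
have resP f g : lr_comp (Omega_incl V) (sval g) = lr_comp (sval f) (Omega_incl V) <-> g = res f.
  split=> [e|->]; last exact: resE.
  by apply: kAut_eq; apply: osub_incl_mono; rewrite [LHS]e -resE.
have resM f g : res (kAut_comp f g) = kAut_comp (res f) (res g).
  by apply/esym/resP; rewrite !kAut_compE lr_compA resE -lr_compA resE lr_compA.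
exists res; split; first exact: resP.
  split; first exact: resM.
  apply: bijective_of.
    move=> f g /lin_Omega_inj e; apply: kAut_eq; by rewrite !mP.
  move=> g; have [h hE] := Omega_aut_lin g; exists (linear_kAut (GL_inv h)).
  by apply/esym/resP; rewrite linear_kAutE GL_inv_inv.
move=> K iota.
pose bc f := lin_Omega iota (m f).
(* A linear map that induces [f] on [P(V)] and [g] on [Omega_K] commutes with
the projection, so [g] lies over [res f]. *)
have over f (g : kAut (OmegaK V iota)) h : sval f = lin_map Fid h ->
    lr_comp (osub_incl (Omega_opens V iota)) (sval g) =
      lr_comp (lin_map iota h) (osub_incl (Omega_opens V iota)) ->
    lr_comp (Omega_proj V iota) (sval g) = lr_comp (sval (res f)) (Omega_proj V iota).
  move=> fh gh; apply: osub_incl_mono; rewrite !lr_compA.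
  rewrite -/(Omega_incl V) resE fh Omega_projE -!lr_compA Omega_projE gh.
  by rewrite !lr_compA base_map_lin.
have bcE f : lr_comp (Omega_proj V iota) (sval (bc f)) = lr_comp (sval (res f)) (Omega_proj V iota).
  exact: over (mP f) (lin_OmegaE iota (m f)).
have bcP f (g : kAut (OmegaK V iota)) : lr_comp (Omega_proj V iota) (sval g) =
    lr_comp (sval (res f)) (Omega_proj V iota) <-> g = bc f.
  split=> [e|->]; last exact: bcE.
  have ik := osub_incl_kMor (Omega_opens V iota).
  have [gk _] := svalP g; have [bk _] := svalP (bc f).
  apply: kAut_eq; apply: osub_incl_mono.
  apply: base_map_mono (kMor_comp ik gk) (kMor_comp ik bk) _.
  have := congr1 (lr_comp (Omega_incl V)) (etrans e (esym (bcE f))).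
  by rewrite !lr_compA Omega_projE -!lr_compA; exact.
exists bc; split; first exact: bcP.
split.
  move=> f g; apply/esym/bcP; rewrite resM.
  transitivity (lr_comp (lr_comp (Omega_proj V iota) (sval (bc f))) (sval (bc g))).
    exact: lr_compA.
  by rewrite bcE -lr_compA bcE lr_compA.
apply: bijective_of.
  by move=> f g /lin_Omega_inj e; apply: kAut_eq; rewrite !mP.
move=> g; have [h hE] := Omega_aut_lin g; exists (linear_kAut (GL_inv h)).
apply/esym/bcP; apply: over hE.
by rewrite linear_kAutE GL_inv_inv.
Qed.
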